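(* The operators $\{E_i,F_i,H_i\}_{i\in\mathbb Z/4}$ defined in the context generate an action of the affine Lie algebra $\widehat{\mathfrak{sl}}_4$ on the space $\Omega^{\bullet\bullet\bullet\bullet}$ of complex Clifford forms; that is, with indices modulo $4$ they satisfy $$[E_i,F_i]=H_i,\quad [H_i,E_i]=2E_i,\quad [H_i,F_i]=-2F_i,$$ $$[E_i,[E_i,E_{i\pm1}]]=0,\quad [F_i,[F_i,F_{i\pm1}]]=0,$$ $$[E_i,F_j]=0\ \text{ for } i\neq j,\qquad [E_i,E_{i+2}]=0,$$ and the remaining defining relations of $\widehat{\mathfrak{sl}}_4$ in its Chevalley generators.
   Context: $\mathrm V^{\mathbb R}$ is a real vector space of dimension $2n$ with nondegenerate symmetric bilinear form $\eta$ and a complex structure $J$ ($J^2=-1$, $\eta(Jv_1,Jv_2)=\eta(v_1,v_2)$). Its complexification splits into isotropic $J$-eigenspaces $\mathrm V^{\mathbb C}=\mathrm V\oplus\bar{\mathrm V}$, $\dim_{\mathbb C}\mathrm V=n$. The complex Clifford algebra $Cl(\mathrm V^{\mathbb C})$ has relations $vv'+v'v=2\eta(v,v')$. For $v\in\mathrm V^{\mathbb C}$ and $a$ of parity $\deg a$ put $v\wedge a=\frac12(va+(-1)^{\deg a}av)$ and $v\vdash a=\frac12(va-(-1)^{\deg a}av)$; each gives an action of $\Lambda(\mathrm V^{\mathbb C})$ on $Cl(\mathrm V^{\mathbb C})$. The linear isomorphism $x\mapsto x\wedge1$ from $\Lambda(\mathrm V\oplus\bar{\mathrm V})$ to $Cl(\mathrm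 V^{\mathbb C})$ gives a bigrading $Cl^{p\bar p}$ ($p$ factors from $\mathrm V$, $\bar p$ from $\bar{\mathrm V}$). Fix $\mathbf v$ in the top component with $\mathbf v^2=1$. The Hodge star $*$ is the linear automorphism of $Cl(\mathrm V^{\mathbb C})\cong\Lambda(\mathrm V^{\mathbb C})$ with $*\mathbf v=1$ and $v\wedge( *a)=*(v\vdash a)$. $M$ is a $2n$-dimensional manifold with a vielbein $\theta^{\mathbb R}$, i.e. a $\mathrm V^{\mathbb R}$-valued 1-form giving an isomorphism $T_mM\to\mathrm V^{\mathbb R}$ at each point. It induces an almost complex structure on $M$, and $\Omega^{p\bar pq\bar q}$ denotes the forms of type $(q,\bar q)$ on $M$ with values in $Cl^{p\bar p}$. Multiplication is $(a\otimes\alpha)(b\otimes\beta)=ab\otimes\alpha\wedge\beta$ (no extra sign). Write $\theta^{\mathbb R}=\theta+\bar\theta$ with $\theta\in\Omega^{1010}$, $\bar\theta\in\Omega^{0101}$. $\theta^{\mathbb R}$ identifies the complexified cotangent spaces with $\mathrm V^*\oplus\bar{\mathrm V}^*$. The operator $*_1$ is the Hodge star acting on the Clifford factor, and $*_2$ is the Hodge star on the form factor, defined in the same way for $(\mathrm V^{\mathbb C})^*$ with the inverse form $\eta^{-1}$. For $x\in\Omega^{p\bar pq\bar q}$ put $s=(-1)^{p+\bar p+q+\bar q}$ and define $$2E_0x=\theta x+s\,x\theta,\quad 2F_1x=\theta x-s\,x\theta,\quad 2F_2x=\bar\theta x+s\,x\bar\theta,\quad 2E_3x=\bar\theta x-s\,x\bar\theta,$$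 $$E_1=*_2^{-1}F_2*_2,\quad E_2=*_1^{-1}*_2^{-1}E_0*_2*_1,\quad F_0=*_1^{-1}*_2^{-1}F_2*_2*_1,\quad F_3=*_2^{-1}E_0*_2,$$ $$H_0x=(p+q-n)x,\quad H_1x=(\bar p-q)x,\quad H_2x=(n-\bar p-\bar q)x,\quad H_3x=(\bar q-p)x.$$ Here $\widehat{\mathfrak{sl}}_4$ is the affine Kac–Moody algebra of type $A_3^{(1)}$ (without derivation), with Chevalley generators $E_i,F_i,H_i$, $i\in\mathbb Z/4$. *)

(* Defs.v *)
From HB Require Import structures.
From mathcomp Require Import all_boot all_order all_algebra.
From mathcomp Require Import all_classical all_reals all_analysis complex.

Set Implicit Arguments.
Unset Strict Implicit.
Unset Printing Implicit Defensive.

Import Order.TTheory GRing.Theory Num.Theory numFieldNormedType.Exports.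

Local Open Scope classical_set_scope.
Local Open Scope ring_scope.
Local Open Scope complex_scope.

Section Span.
Variables (F : fieldType) (W : lmodType F).

Definition lspan (X : set W) : set W :=
  [set x | exists (k : nat) (c : 'I_k -> F) (w : 'I_k -> W),
     (forall i, X (w i)) /\ x = \sum_i c i *: w i].

(* The [i]-th component of [x] in a direct sum decomposition of [W] into the
   subspaces [S i]. *)
Definition component (I : finType) (S : I -> set W) (x : W) (i : I) : W :=
  xget 0 [set y : {ffun I -> W} | (forall j, S j (y j)) /\ x = \sum_j y j] i.

(* The linear extension of a map given by the formula [f i] on [S i]. *)
Definition linext (I : finType) (S : I -> set W) (W' : lmodType F)
  (f : I -> W -> W') (x : W) : W' := \sum_i f i (component S x i).

End Span.

(* The complexification of [V]; the pair [(v, w)] stands for [v + i w]. *)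
Definition complexified (R : rcfType) (V : vectType R) : Type := (V * V)%type.

Section Complexified.
Variables (R : rcfType) (V : vectType R).
Notation VC := (complexified V).

HB.instance Definition _ := GRing.Zmodule.copy VC (V * V)%type.

Definition complexified_scale (z : R[i]) (u : VC) : VC :=
  (complex.Re z *: u.1 - complex.Im z *: u.2,
   complex.Re z *: u.2 + complex.Im z *: u.1).

Lemma complexified_scaleA a b u :
  complexified_scale a (complexified_scale b u) = complexified_scale (a * b) u.
Proof.
have aux (p q r t : V) : p + q + (r + t) = p + t + (q + r).
  by rewrite -!addrA; congr (_ + _); rewrite addrA addrC.
case: a b u => [a a'] [b b'] [v w]; rewrite /complexified_scale /=.
by congr pair; rewrite !scalerBr !scalerDr !scalerA ?scalerBl ?scalerDl ?opprD aux.
Qed.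

Lemma complexified_scale1 : left_id 1 complexified_scale.
Proof. by case=> v w; rewrite /complexified_scale /= !scale1r !scale0r subr0 addr0. Qed.

Lemma complexified_scaleDr : right_distributive complexified_scale +%R.
Proof.
move=> z [v w] [v' w']; rewrite /complexified_scale /=.
by congr pair; rewrite /= !scalerDr ?opprD addrACA.
Qed.

Lemma complexified_scaleDl u : {morph complexified_scale^~ u : a b / a + b}.
Proof.
case: u => v w [a a'] [b b']; rewrite /complexified_scale /=.
by congr pair; rewrite /= !scalerDl ?opprD addrACA.
Qed.

HB.instance Definition _ := GRing.Zmodule_isLmodule.Build R[i] VC
  complexified_scaleA complexified_scale1 complexified_scaleDr
  complexified_scaleDl.

Import VectorInternalTheory.

Lemma complexified_vect_axiom :
  {f : VC -> 'rV[R[i]]_(dim V) | linear f & bijective f}.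
Proof.
pose f (u : VC) : 'rV[R[i]]_(dim V) :=
  \row_j (v2r u.1 0 j +i* v2r u.2 0 j).
pose g (r : 'rV[R[i]]_(dim V)) : VC :=
  (r2v (\row_j complex.Re (r 0 j)), r2v (\row_j complex.Im (r 0 j))).
have f_linear : linear f.
  move=> z [v w] [v' w']. apply/rowP => j; case: z => a b.
  rewrite !mxE /= !linearD !linearN !linearZ !mxE /=.
  by apply/eqP; rewrite eq_complex /= !mulrN !eqxx.
have f_bij : bijective f.
  exists g => [[v w]|r].
    by rewrite /g /f /=; congr pair; rewrite -[RHS]v2rK; congr r2v;
      apply/rowP => j; rewrite !mxE.
  by apply/rowP => j; rewrite !mxE /= !r2vK !mxE; case: (r 0 j).
by exists f.
Qed.

HB.instance Definition _ :=
  Lmodule_hasFinDim.Build R[i] VC complexified_vect_axiom.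

End Complexified.

(* The signature of [hs_eta] is arbitrary. *)
Record hermitian_space (R : realType) (n : nat) := HermitianSpace {
  hs_space :> vectType R;
  hs_dim : \dim {: hs_space} = n.*2;
  hs_eta : hs_space -> hs_space -> R;
  hs_eta_linear : forall w, scalar (hs_eta ^~ w);
  hs_eta_sym : forall v w, hs_eta v w = hs_eta w v;
  hs_eta_nondeg : forall v, (forall w, hs_eta v w = 0) -> v = 0;
  hs_J : {linear hs_space -> hs_space};
  hs_JJ : forall v, hs_J (hs_J v) = - v;
  hs_eta_J : forall v w, hs_eta (hs_J v) (hs_J w) = hs_eta v w }.

Section HermitianSpace.
Variables (R : realType) (n : nat) (V : hermitian_space R n).

Definition VC : vectType R[i] := complexified V.

Definition VC_of (v : V) : VC := (v, 0).

Definition etaC (u w : VC) : R[i] :=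
  (hs_eta u.1 w.1 - hs_eta u.2 w.2) +i* (hs_eta u.1 w.2 + hs_eta u.2 w.1).

Definition JC (u : VC) : VC := (hs_J V u.1, hs_J V u.2).

(* [holo true] is the eigenspace of [J] for [i], [holo false] the one for [-i]. *)
Definition holo (b : bool) : set VC :=
  [set v | JC v = (0 +i* (if b then 1 else -1)) *: v].

Definition dualVC : vectType R[i] := 'Hom(VC, R[i]^o).

(* The dual of [holo b], embedded in the dual of the whole space by means of the
   decomposition into eigenspaces. *)
Definition dual_holo (b : bool) : set dualVC :=
  [set l | forall v, holo (~~ b) v -> l v = 0].

Definition sharp (l : dualVC) : VC := xget 0 [set v | forall w, etaC v w = l w].

(* The form on the dual for which [v |-> etaC v] is an isometry. *)
Definition etaC_inv (l k : dualVC) : R[i] := etaC (sharp l) (sharp k).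

End HermitianSpace.

(* The relation is [v w + w v = 2 B(v, w)], without a sign. *)
Definition clifford_map (F : fieldType) (W : lmodType F) (B : W -> W -> F)
  (A : algType F) (f : W -> A) : Prop :=
  forall v w, f v * f w + f w * f v = (B v w *+ 2)%:A.

Record clifford_algebra (F : fieldType) (W : lmodType F) (B : W -> W -> F) :=
  CliffordAlgebra {
  cl_alg :> algType F;
  cl_in : {linear W -> cl_alg};
  cl_inP : clifford_map B cl_in;
  cl_univ : forall (A : algType F) (f : {linear W -> A}), clifford_map B f ->
    exists g : {lrmorphism cl_alg -> A}, (forall v, g (cl_in v) = f v) /\
      forall g' : {lrmorphism cl_alg -> A},
        (forall v, g' (cl_in v) = f v) -> g' =1 g }.

Section Clifford.
Variables (F : fieldType) (W : lmodType F) (B : W -> W -> F).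
Variable (Cl : clifford_algebra B).

(* The even ([b = false]) and odd ([b = true]) parts. *)
Definition cl_parity (b : bool) : set Cl :=
  lspan [set a : Cl | exists2 s : seq W,
           odd (size s) = b & a = \prod_(v <- s) cl_in Cl v].

Definition cl_wedge (v : W) : Cl -> Cl :=
  linext cl_parity (fun b a =>
    2^-1 *: (cl_in Cl v * a + (-1) ^+ b *: (a * cl_in Cl v))).

Definition cl_contr (v : W) : Cl -> Cl :=
  linext cl_parity (fun b a =>
    2^-1 *: (cl_in Cl v * a - (-1) ^+ b *: (a * cl_in Cl v))).

(* The image of [v_1 /\ ... /\ v_k] under [x |-> x /\ 1]. *)
Definition cl_wedges (s : seq W) : Cl := foldr cl_wedge 1 s.

Definition cl_degree (k : nat) : set Cl :=
  lspan [set a | exists2 s : seq W, size s = k & a = cl_wedges s].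

Definition hodge_star (vol : Cl) (star : {linear Cl -> Cl}) : Prop :=
  [/\ bijective star, star vol = 1 &
      forall v a, cl_wedge v (star a) = star (cl_contr v a)].

End Clifford.

(* [x : ext d A] stands for [\sum_S x S (x) dx^S], where [dx^S] is the product of
   the [dx^i], [i \in S], in increasing order: it represents an element of the
   tensor product of [A] with the exterior algebra on [dx^0, ..., dx^(d-1)]. *)
Notation ext d A := {ffun {set 'I_d} -> A}.

Section Exterior.
Variables (d : nat) (A : pzRingType).

Definition inversions (S T : {set 'I_d}) : nat :=
  (\sum_(i in S) \sum_(j in T) (j < i))%N.

(* [(a (x) alpha) (b (x) beta) = ab (x) (alpha /\ beta)] *)
Definition ext_mul (x y : ext d A) : ext d A :=
  [ffun S : {set 'I_d} => \sum_(T : {set 'I_d} | T \subset S)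
     (-1) ^+ inversions T (S :\: T) * (x T * y (S :\: T))].

Definition ext_one : ext d A := [ffun S : {set 'I_d} => (S == finset.set0)%:R].

(* [\sum_i c i (x) dx^i] *)
Definition one_form (c : 'I_d -> A) : ext d A :=
  [ffun S : {set 'I_d} => \sum_(i | S == finset.set1 i) c i].

Definition wedges (s : seq ('I_d -> A)) : ext d A :=
  foldr (fun c y => ext_mul (one_form c) y) ext_one s.

End Exterior.

(* [dx^S], pulled back along the linear map [v |-> v *m J]. *)
Definition ext_pull_basis (R : pzRingType) (d : nat) (J : 'M[R]_d)
  (S : {set 'I_d}) : ext d R := wedges [seq (fun i => J i j) | j <- enum S].

Definition ext_pull (R : rcfType) (A : lmodType R[i]) (d : nat) (J : 'M[R]_d)
  (x : ext d A) : ext d A :=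
  [ffun T : {set 'I_d} => \sum_S (ext_pull_basis J S T)%:C *: x S].

Section Smooth.
Variables (R : realType) (d : nat).

Fixpoint Ck (k : nat) (U : set 'rV[R]_d) (f : 'rV[R]_d -> R) : Prop :=
  (forall y, U y -> {for y, continuous f}) /\
  if k is k'.+1 then
    forall i : 'I_d, (forall y, U y -> derivable f y (delta_mx 0 i)) /\
      Ck k' U (fun y => 'D_(delta_mx 0 i) f y)
  else True.

Definition smooth (U : set 'rV[R]_d) (f : 'rV[R]_d -> R) : Prop :=
  forall k, Ck k U f.

(* Smoothness of functions with values in a finite dimensional space, tested by
   linear functionals. *)
Definition smooth_vec (W : lmodType R) (U : set 'rV[R]_d) (f : 'rV[R]_d -> W) :=
  forall l : {linear W -> R^o}, smooth U (l \o f).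

Definition smooth_cvec (W : lmodType R[i]) (U : set 'rV[R]_d)
  (f : 'rV[R]_d -> W) :=
  forall l : {linear W -> R[i]^o},
    smooth U (fun y => complex.Re (l (f y))) /\
    smooth U (fun y => complex.Im (l (f y))).

(* A tangent vector [v] is mapped to [v *m jacobian_mx f y]. *)
Definition jacobian_mx (f : 'rV[R]_d -> 'rV[R]_d) (y : 'rV[R]_d) : 'M[R]_d :=
  \matrix_(i, j) 'D_(delta_mx 0 i) (fun z => f z 0 j) y.

End Smooth.

Record chart (R : realType) (d : nat) (M : topologicalType) := Chart {
  ch_dom : set M;
  ch_map :> M -> 'rV[R]_d;
  ch_inv : 'rV[R]_d -> M;
  ch_dom_open : open ch_dom;
  ch_img_open : open (ch_map @` ch_dom);
  ch_mapK : {in ch_dom, cancel ch_map ch_inv};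
  ch_map_cont : {within ch_dom, continuous ch_map};
  ch_inv_cont : {within ch_map @` ch_dom, continuous ch_inv} }.

Definition transition (R : realType) (d : nat) (M : topologicalType)
  (c c' : chart R d M) (y : 'rV[R]_d) : 'rV[R]_d := c' (ch_inv c y).

(* The smooth structure is given by an atlas indexed by the points of the
   manifold; any smooth atlas can be so indexed by choosing a chart around each
   point. *)
Record manifold (R : realType) (d : nat) := Manifold {
  mf_top :> topologicalType;
  mf_hausdorff : hausdorff_space mf_top;
  mf_second_countable : @second_countable mf_top;
  mf_chart : mf_top -> chart R d mf_top;
  mf_chart_mem : forall m, ch_dom (mf_chart m) m;
  mf_smooth : forall m m' j,
    smooth (mf_chart m @` (ch_dom (mf_chart m) `&` ch_dom (mf_chart m')))
      (fun y => transition (mf_chart m) (mf_chart m') y 0 j) }.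

Section Manifold.
Variables (R : realType) (d : nat) (M : manifold R d).

(* The tangent space at [m] is identified with ['rV_d] by the coordinates of
   [mf_chart m]. For [m] the point of coordinates [y] in the chart at [m0],
   [to_frame m0 y] converts components of tangent vectors at [m] with respect to
   the chart at [m0] into components with respect to the chart at [m]. *)
Definition to_frame (m0 : M) (y : 'rV[R]_d) : 'M[R]_d :=
  let m := ch_inv (mf_chart m0) y in
  jacobian_mx (transition (mf_chart m0) (mf_chart m)) y.

Definition coord_image (m0 : M) : set 'rV[R]_d :=
  mf_chart m0 @` ch_dom (mf_chart m0).

(* A not necessarily smooth form [x] is given at each point [m] by its components
   [x m] in the coordinates of [mf_chart m]; [local_form x m0] is its expression
   in the chart at [m0]. *)
Definition local_form (A : lmodType R[i]) (x : M -> ext d A) (m0 : M)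
  (y : 'rV[R]_d) : ext d A :=
  ext_pull (to_frame m0 y) (x (ch_inv (mf_chart m0) y)).

Definition smooth_form (A : lmodType R[i]) : set (M -> ext d A) :=
  [set x | forall m0 S,
     smooth_cvec (coord_image m0) (fun y => local_form x m0 y S)].

Record vielbein (V : vectType R) := Vielbein {
  vb_map :> forall m : M, {linear 'rV[R]_d -> V};
  vb_bij : forall m, bijective (vb_map m);
  vb_smooth : forall m0 i, smooth_vec (coord_image m0)
    (fun y => vb_map (ch_inv (mf_chart m0) y) (row i (to_frame m0 y))) }.

End Manifold.

Section CliffordForms.
Variables (R : realType) (n : nat) (V : hermitian_space R n).
Variables (Cl : clifford_algebra (@etaC R n V)).
Variables (Cl' : clifford_algebra (@etaC_inv R n V)).
Variables (star : {linear Cl -> Cl}) (star' : {linear Cl' -> Cl'}).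
Variables (M : manifold R n.*2) (theta : vielbein M V).

Definition cl_type (p pb : nat) : set Cl :=
  lspan [set a | exists s t : seq (VC V),
    [/\ size s = p, size t = pb, {in s, forall v, holo true v},
        {in t, forall v, holo false v} & a = cl_wedges Cl (s ++ t)]].

Local Notation form := (ext n.*2 Cl).

Section AtPoint.
Variable m : M.

(* [theta^R (d/dx^i)] *)
Definition vb_coef (i : 'I_(n.*2)) : VC V := VC_of (theta m (delta_mx 0 i)).

(* [theta] for [b = true], and its conjugate for [b = false]. *)
Definition theta_form (b : bool) : form :=
  one_form (fun i => cl_in Cl (component (@holo R n V) (vb_coef i) b)).

(* The complex covector [l \o theta^R] on the tangent space at [m]. *)
Definition vb_covector (l : dualVC V) : 'I_(n.*2) -> R[i] :=
  fun i => l (vb_coef i).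

Definition form_index : finType := ('I_n.+1 * 'I_n.+1 * 'I_n.+1 * 'I_n.+1)%type.

(* The fibre at [m] of the forms of type [(q, qb)] with values in [Cl^(p, pb)],
   for [k = (p, pb, q, qb)]. *)
Definition form_type (k : form_index) : set form :=
  let: (p, pb, q, qb) := k in
  lspan [set x | exists (a : Cl) (s t : seq (dualVC V)),
    [/\ cl_type p pb a, size s = q :> nat, size t = qb :> nat,
        {in s, forall l, dual_holo true l} /\
        {in t, forall l, dual_holo false l} &
        x = [ffun S : {set 'I_(n.*2)} => wedges (map vb_covector (s ++ t)) S *: a]]].

Definition cliff_sign (k : form_index) : R[i] :=
  let: (p, pb, q, qb) := k in (-1) ^+ (p + pb + q + qb)%N.

(* [(theta x + s x theta) / 2] and [(theta x - s x theta) / 2], with [theta]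
   replaced by its conjugate for [b = false]. *)
Definition mul_plus (b : bool) : form -> form :=
  linext form_type (fun k x => 2^-1 *:
    (ext_mul (theta_form b) x + cliff_sign k *: ext_mul x (theta_form b))).

Definition mul_minus (b : bool) : form -> form :=
  linext form_type (fun k x => 2^-1 *:
    (ext_mul (theta_form b) x - cliff_sign k *: ext_mul x (theta_form b))).

(* [dx^i] transported to the dual of [V^C] by [theta^R]. *)
Definition vb_dual (i : 'I_(n.*2)) : dualVC V :=
  xget 0 [set l : dualVC V | forall j, l (vb_coef j) = (i == j)%:R].

(* The exterior algebra of the complexified cotangent space at [m], identified
   with that of the dual of [V^C] by [theta^R], and then with [Cl'] by
   [x |-> x /\ 1]. *)
Definition form_to_cl (x : ext n.*2 R[i]) : Cl' :=
  \sum_S x S *: cl_wedges Cl' (map vb_dual (enum S)).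

Definition cotangent_star (x : ext n.*2 R[i]) : ext n.*2 R[i] :=
  'pinv_(fun=> 0) setT form_to_cl (star' (form_to_cl x)).

Definition star1 (x : form) : form := [ffun S : {set 'I_(n.*2)} => star (x S)].

Definition star2 (x : form) : form :=
  [ffun S : {set 'I_(n.*2)} => \sum_T cotangent_star [ffun U : {set 'I_(n.*2)} => (U == T)%:R] S *: x T].

Definition star1_inv : form -> form := 'pinv_(fun=> 0) setT star1.
Definition star2_inv : form -> form := 'pinv_(fun=> 0) setT star2.

Definition opE (i : 'I_4) : form -> form :=
  match val i with
  | 0%N => mul_plus true
  | 1%N => star2_inv \o mul_plus false \o star2
  | 2%N => star1_inv \o star2_inv \o mul_plus true \o star2 \o star1
  | _ => mul_minus false
  end.

Definition opF (i : 'I_4) : form -> form :=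
  match val i with
  | 0%N => star1_inv \o star2_inv \o mul_plus false \o star2 \o star1
  | 1%N => mul_minus true
  | 2%N => mul_plus false
  | _ => star2_inv \o mul_plus true \o star2
  end.

Definition cliff_weight (i : 'I_4) (k : form_index) : R[i] :=
  let: (p, pb, q, qb) := k in
  match val i with
  | 0%N => (p + q)%N%:R - n%:R
  | 1%N => pb%:R - q%:R
  | 2%N => n%:R - (pb + qb)%N%:R
  | _ => qb%:R - p%:R
  end.

Definition opH (i : 'I_4) : form -> form :=
  linext form_type (fun k x => cliff_weight i k *: x).

End AtPoint.

Definition clifford_E (i : 'I_4) (x : M -> form) : M -> form := fun m => opE m i (x m).
Definition clifford_F (i : 'I_4) (x : M -> form) : M -> form := fun m => opF m i (x m).
Definition clifford_H (i : 'I_4) (x : M -> form) : M -> form := fun m => opH m i (x m).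

End CliffordForms.

Section KacMoody.
Variables (K : fieldType) (W : lmodType K).

Definition op_bracket (f g : W -> W) : W -> W := fun x => f (g x) - g (f x).

Definition linear_operator_on (O : set W) (f : W -> W) : Prop :=
  (forall x, O x -> O (f x)) /\
  (forall (a : K) x y, O x -> O y -> f (a *: x + y) = a *: f x + f y).

(* An action on the subspace [O] of [W] of the (derived) Kac-Moody algebra with
   symmetrizable generalized Cartan matrix [A], presented by its Chevalley
   generators and relations, where [E i], [F i], [H i] are the operators by which
   the generators act. The last clause contains the Serre relations
   [(ad E_i)^(1 - a_ij) E_j = 0] and [(ad F_i)^(1 - a_ij) F_j = 0]. *)
Definition kac_moody_action (I : finType) (A : I -> I -> int)
  (O : set W) (E F H : I -> W -> W) : Prop :=
  [/\ O 0 /\ (forall (a : K) x y, O x -> O y -> O (a *: x + y)),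
      forall i, [/\ linear_operator_on O (E i), linear_operator_on O (F i) &
                    linear_operator_on O (H i)],
      forall i j x, O x ->
        [/\ op_bracket (H i) (H j) x = 0,
            op_bracket (H i) (E j) x = (A i j)%:~R *: E j x,
            op_bracket (H i) (F j) x = - ((A i j)%:~R *: F j x) &
            op_bracket (E i) (F j) x = if i == j then H i x else 0] &
      forall i j x, i != j -> O x ->
        iter `|1 - A i j|%N (op_bracket (E i)) (E j) x = 0 /\
        iter `|1 - A i j|%N (op_bracket (F i)) (F j) x = 0].

End KacMoody.

(* The Cartan matrix of type [A_3^(1)]; addition in ['I_4 = 'Z_4] is modulo 4. *)
Definition cartan_A31 (i j : 'I_4) : int :=
  if i == j then 2 else if (j == i + 1) || (i == j + 1) then -1 else 0.

(* Main.v *)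
Require Import Defs.
From HB Require Import structures.
From mathcomp Require Import all_boot all_order all_algebra.
From mathcomp Require Import all_classical all_reals all_analysis complex.
From mathcomp Require Import ring.

(** At a point, forms with values in the Clifford algebra are the tensor product of
    [Cl] with the exterior algebra of the cotangent space, which is identified with
    [Cl'] by the vielbein. On either factor, exterior products and contractions are
    fermionic creation and annihilation operators ([cl_fermion_anticomm]), and
    operators on different factors commute. Choose dual bases [e true] and [e false]
    of the two eigenspaces of [J] ([polarization_ex]), and let [C t b i] and
    [D t b i] be the operators of creation ([t = true]) or annihilation
    ([t = false]) given by [e b i] on the Clifford factor and by the corresponding
    covector on the form factor. They anticommute, except that [C t b i] and
    [C (~~ t) (~~ b) i] have anticommutator [1], and likewise for [D].

    Multiplication by [theta] from both sides gives the operators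
    [bilin t t' b = \sum_i C t b i * D t' b i] with [t' = true] ([half_theta]), and
    conjugation by a Hodge star exchanges creation and annihilation on its factor
    ([hodge_fermion]). So the eight operators [E_i] and [F_i] are exactly the eight
    bilinears ([opE_chevalley], [opF_chevalley]), where [F_i] has the three flags
    of [E_i] reversed. The commutator of two bilinears is computed once and for all
    ([comm_bilin]), and the relations of the affine algebra become finite checks on
    the flags ([chevalley_he], [chevalley_ef], [chevalley_serre]). Moreover
    [[E_i, F_i]] is a combination of number operators, whose eigenvalues on the forms
    of a given type are the degrees; this identifies it with [H_i]
    ([opH_chevalley]).

    The Clifford algebras are given by their universal property. It provides the
    parity automorphism and the fact that vectors generate ([cl_generatedT]), and the
    anticommutation relations then yield bases of words in dual bases
    ([cl_word_span], [cl_word_free]), from which come the identification of the two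
    models of the exterior algebra ([Phi_bij]) and the spanning of all forms by
    homogeneous ones ([form_type_span]). An operator prescribed type by type is thereby
    determined, each time as the restriction of a globally defined linear operator
    ([linext_linear]).

    It remains to see that the operators preserve smoothness. In a fixed chart, the
    creation operators have coefficients that are covectors applied to the vielbein,
    and the annihilation operators have coefficients given by the inverse matrix of
    the frame ([vector_smooth_ex]). That the frame is invertible in every chart rests
    on the invertibility of the Jacobian matrices of the changes of coordinates
    ([to_frame_unit]), that is, on the chain rule for functions with continuous partial
    derivatives ([jacobian_inverse]). *)

Set Implicit Arguments.
Unset Strict Implicit.
Unset Printing Implicit Defensive.

Import Order.TTheory GRing.Theory Num.Theory numFieldNormedType.Exports.

Local Open Scope classical_set_scope.
Local Open Scope ring_scope.
Local Open Scope complex_scope.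

(** * Linear extension from a spanning family of subspaces *)

Section Subspaces.
Variables (F : fieldType) (W : lmodType F).

Definition vsubspace (P : set W) : Prop :=
  P 0 /\ forall (a : F) x y, P x -> P y -> P (a *: x + y).

Lemma vsubspaceZ (P : set W) a x : vsubspace P -> P x -> P (a *: x).
Proof. by case=> P0 PL Px; rewrite -[a *: x]addr0; apply: PL. Qed.

Lemma vsubspaceD (P : set W) x y : vsubspace P -> P x -> P y -> P (x + y).
Proof. by case=> P0 PL Px Py; rewrite -[x]scale1r; apply: PL. Qed.

Lemma vsubspace_sum (P : set W) (I : Type) (r : seq I) (Q : pred I) (f : I -> W) :
  vsubspace P -> (forall i, Q i -> P (f i)) -> P (\sum_(i <- r | Q i) f i).
Proof.
by move=> PS Pf; elim/big_ind: _ => [|x y|i /Pf//]; [case: PS | apply: vsubspaceD].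
Qed.

Lemma lspan_subspace (X : set W) : vsubspace (lspan X).
Proof.
split; first by exists 0, (fun=> 0), (fun=> 0); split=> [[]//|]; rewrite big_ord0.
move=> a _ _ [k [c [w [Xw ->]]]] [l [d [v [Xv ->]]]].
exists (k + l)%N, (fun i => match fintype.split i with inl j => a * c j | inr j => d j end),
  (fun i => match fintype.split i with inl j => w j | inr j => v j end).
split=> [i|]; first by case: (fintype.split i).
rewrite big_split_ord /= scaler_sumr; congr (_ + _); apply: eq_bigr => i _.
  by rewrite (unsplitK (inl i)) scalerA.
by rewrite (unsplitK (inr i)).
Qed.

Lemma lspan0 (X : set W) : lspan X 0.
Proof. exact: (lspan_subspace X).1. Qed.

Lemma lspanP (X : set W) (a : F) x y :
  lspan X x -> lspan X y -> lspan X (a *: x + y).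
Proof. exact: (lspan_subspace X).2. Qed.

Lemma lspan_gen (X : set W) x : X x -> lspan X x.
Proof.
move=> Xx; exists 1%N, (fun=> 1), (fun=> x); split=> //.
by rewrite big_ord1 scale1r.
Qed.

Lemma lspan_min (X P : set W) : vsubspace P -> X `<=` P -> lspan X `<=` P.
Proof.
move=> PS XP _ [k [c [w [Xw ->]]]]; apply: vsubspace_sum => // i _.
by apply: vsubspaceZ => //; apply: XP.
Qed.

Lemma linear_eq_vsubspace (W' : lmodType F) (f g : {linear W -> W'}) :
  vsubspace [set x | f x = g x].
Proof. by split=> [|a x y] /=; rewrite ?linear0// !linearP => -> ->. Qed.

(** If the formulas [f i] are the restrictions to the [S i] of one linear map [g], then
    any decomposition of [x] gives the value [g x]; hence it is enough to know that
    the [S i] span. *)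
Lemma linext_linear (I : finType) (S : I -> set W) (W' : lmodType F)
  (f : I -> W -> W') (g : {linear W -> W'}) :
  (forall x, exists y : {ffun I -> W}, (forall j, S j (y j)) /\ x = \sum_j y j) ->
  (forall j x, S j x -> f j x = g x) -> linext S f =1 g.
Proof.
move=> ex fg x; rewrite /linext /component.
case: (xgetPex 0 (ex x)); set y := xget _ _ => Sy xE.
by rewrite [in RHS]xE linear_sum; apply: eq_bigr => i _; apply: fg.
Qed.

Lemma componentE (I : finType) (S : I -> set W) (p : I -> {linear W -> W}) x :
  (forall j, S j (p j x)) -> x = \sum_j p j x ->
  (forall i j y, S j y -> p i y = if i == j then y else 0) ->
  forall i, component S x i = p i x.
Proof.
move=> Sp xE pS i; rewrite /component.
have ex : exists y : {ffun I -> W}, (forall j, S j (y j)) /\ x = \sum_j y j.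
  by exists [ffun j => p j x]; split=> [j|]; rewrite ?ffunE// {1}xE;
    apply: eq_bigr => j _; rewrite ffunE.
case: (xgetPex 0 ex); set y := xget _ _ => Sy ->.
rewrite linear_sum (bigD1 i)//= (pS i i)// eqxx big1 ?addr0// => j /negPf jNi.
by rewrite (pS i j)// eq_sym jNi.
Qed.

End Subspaces.

Lemma sum_subspaces (F : fieldType) (W : lmodType F) (I : finType) (S : I -> set W) :
  (forall i, vsubspace (S i)) ->
  let Q := [set x | exists y : {ffun I -> W}, (forall j, S j (y j)) /\ x = \sum_j y j] in
  vsubspace Q /\ (forall i x, S i x -> Q x).
Proof.
move=> SS Q; split=> [|i x Sx].
  split=> [|a _ _ [y [yS ->]] [z [zS ->]]].
    exists [ffun=> 0]; split=> [j|]; first by rewrite ffunE; case: (SS j).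
    by rewrite big1// => j _; rewrite ffunE.
  exists [ffun j => a *: y j + z j]; split=> [j|].
    by rewrite ffunE; case: (SS j) => _; apply.
  by rewrite scaler_sumr -big_split; apply: eq_bigr => j _; rewrite ffunE.
exists [ffun j => if j == i then x else 0]; split=> [j|].
  by rewrite ffunE; case: eqP => [->//|_]; case: (SS j).
rewrite (bigD1 i)//= ffunE eqxx big1 ?addr0// => j /negPf ji.
by rewrite ffunE ji.
Qed.

(** * The ring of linear endomorphisms *)

Section Endomorphisms.
Variables (K : pzRingType) (W : lmodType K).

(** A type of its own, so that the product of the ring structure below is composition
    and not the pointwise product. *)
Record endo := Endo { endo_fun :> W -> W; endo_linear : linear endo_fun }.

HB.instance Definition _ (f : endo) :=
  GRing.isLinear.Build K W W *:%R (endo_fun f) (endo_linear f).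

HB.instance Definition _ := gen_eqMixin endo.
HB.instance Definition _ := gen_choiceMixin endo.

Lemma endoP (f g : endo) : f =1 g -> f = g.
Proof.
case: f g => [f lf] [g lg] /= /funext fg; case: g / fg in lg *.
by congr Endo; apply: Prop_irrelevance.
Qed.

Definition endo_of (f : {linear W -> W}) : endo := Endo (@linearP _ _ _ _ f).

Definition endo0 := endo_of \0.
Definition endo1 := endo_of idfun.
Definition endoD (f g : endo) := endo_of (f \+ g).
Definition endoN (f : endo) := endo_of (\- f).
Definition endoM (f g : endo) := endo_of (f \o g).

Lemma endoDA : associative endoD.
Proof. by move=> f g h; apply: endoP => x; apply: addrA. Qed.
Lemma endoDC : commutative endoD.
Proof. by move=> f g; apply: endoP => x; apply: addrC. Qed.
Lemma endo0D : left_id endo0 endoD.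
Proof. by move=> f; apply: endoP => x; apply: add0r. Qed.
Lemma endoND : left_inverse endo0 endoN endoD.
Proof. by move=> f; apply: endoP => x; apply: addNr. Qed.
Lemma endoMA : associative endoM.
Proof. by move=> f g h; apply: endoP. Qed.
Lemma endo1M : left_id endo1 endoM.
Proof. by move=> f; apply: endoP. Qed.
Lemma endoM1 : right_id endo1 endoM.
Proof. by move=> f; apply: endoP. Qed.
Lemma endoDM : left_distributive endoM endoD.
Proof. by move=> f g h; apply: endoP. Qed.
Lemma endoMD : right_distributive endoM endoD.
Proof. by move=> f g h; apply: endoP => x /=; rewrite linearD. Qed.

HB.instance Definition _ :=
  GRing.isZmodule.Build endo endoDA endoDC endo0D endoND.
HB.instance Definition _ :=
  GRing.Zmodule_isPzRing.Build endo endoMA endo1M endoM1 endoDM endoMD.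

Lemma endo_add (f g : endo) x : (f + g) x = f x + g x. Proof. by []. Qed.
Lemma endo_opp (f : endo) x : (- f) x = - f x. Proof. by []. Qed.
Lemma endo_mul (f g : endo) x : (f * g) x = f (g x). Proof. by []. Qed.
Lemma endo_sum (I : Type) (r : seq I) (P : pred I) (f : I -> endo) x :
  (\sum_(i <- r | P i) f i) x = \sum_(i <- r | P i) f i x.
Proof. by elim/big_rec2: _ => // i y g _ <-. Qed.
Lemma endo_nat (k : nat) x : (k%:R : endo) x = x *+ k.
Proof. by elim: k => [//|k IH]; rewrite !mulrS endo_add IH. Qed.
Lemma endo_mulrz (f : endo) (k : int) x : (f *~ k) x = (f x) *~ k.
Proof.
have aux m : (f *+ m) x = f x *+ m.
  by elim: m => [//|m IH]; rewrite !mulrS endo_add IH.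
by case: k => m; rewrite /intmul ?endo_opp ?aux.
Qed.

End Endomorphisms.

Lemma linear_bij_inv (F : fieldType) (W : lmodType F) (f : {linear W -> W}) :
  bijective f -> exists g : endo W, cancel f g /\ cancel g f.
Proof. by case=> g fK gK; exists (Endo (can2_linear fK gK)). Qed.

(** * Commutators of fermion bilinears *)

Definition commutator (A : pzRingType) (x y : A) := x * y - y * x.

Lemma commutator_mulr (A : pzRingType) (x y z : A) :
  commutator x (y * z) = commutator x y * z + y * commutator x z.
Proof. by rewrite /commutator mulrBl mulrBr !mulrA addrA subrK. Qed.

Lemma commutatorBl (A : pzRingType) (x y z : A) :
  commutator (x - y) z = commutator x z - commutator y z.
Proof. by rewrite /commutator mulrBl mulrBr !opprB addrACA [RHS]addrACA [X in _ + X]addrC. Qed.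

Lemma commutatorBr (A : pzRingType) (x y z : A) :
  commutator x (y - z) = commutator x y - commutator x z.
Proof. by rewrite /commutator mulrBl mulrBr !opprB addrACA [RHS]addrACA [X in _ + X]addrC. Qed.

Lemma commutator_sumr (A : pzRingType) (x : A) (I : Type) (r : seq I) (P : pred I)
  (f : I -> A) :
  commutator x (\sum_(i <- r | P i) f i) = \sum_(i <- r | P i) commutator x (f i).
Proof. by rewrite /commutator mulr_sumr mulr_suml -sumrB. Qed.

Section OneSpecies.
Variables (A : pzRingType) (n : nat) (C : bool -> bool -> 'I_n -> A).
Hypothesis CC : forall t b i s c j,
  C t b i * C s c j + C s c j * C t b i = [&& t != s, b != c & i == j]%:R.

(** Moving [C s c j] through the number operator picks up one term from each factor
    with which it does not anticommute: [C t b j], and the operator dual to it. *)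
Lemma commutator_number t b s c j :
  commutator (\sum_i C (~~ t) (~~ b) i * C t b i) (C s c j) =
  C s c j *~ (((t != s) && (b != c))%:Z - ((t == s) && (b == c))%:Z).
Proof.
have CCE t1 b1 i1 t2 b2 i2 : C t1 b1 i1 * C t2 b2 i2 =
    [&& t1 != t2, b1 != b2 & i1 == i2]%:R - C t2 b2 i2 * C t1 b1 i1.
  by rewrite -CC addrK.
have term i : C (~~ t) (~~ b) i * C t b i * C s c j
    - C s c j * (C (~~ t) (~~ b) i * C t b i) =
    (if i == j then C s c j *~
      (((t != s) && (b != c))%:Z - ((t == s) && (b == c))%:Z) else 0).
  rewrite -mulrA [C t b i * C s c j]CCE mulrBr !mulrA -addrA -opprD -mulrDl CC.
  have [->|ij] := eqVneq i j; last by rewrite !andbF mulr0 mul0r oppr0 addr0.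
  rewrite !andbT; case: t s b c => [] [] [] [];
    by rewrite /= ?mulr0 ?mul0r ?mulr1 ?mul1r ?subr0 ?sub0r ?mulrNz ?mulr1z ?mulr0z
      ?oppr0.
rewrite /commutator mulr_suml mulr_sumr -sumrB.
under eq_bigr => i _ do rewrite term.
by rewrite -big_mkcond big_pred1_eq.
Qed.

End OneSpecies.

(** Two commuting families [C] and [D] of fermion operators. The first flag separates
    creation from annihilation, the second one distinguishes two species; an operator
    is dual to the one with both flags reversed and the same index. *)
Section FermionBilinears.
Variables (A : pzRingType) (n : nat) (C D : bool -> bool -> 'I_n -> A).
Hypothesis CC : forall t b i s c j,
  C t b i * C s c j + C s c j * C t b i = [&& t != s, b != c & i == j]%:R.
Hypothesis DD : forall t b i s c j,
  D t b i * D s c j + D s c j * D t b i = [&& t != s, b != c & i == j]%:R.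
Hypothesis CD : forall t b i s c j, C t b i * D s c j = D s c j * C t b i.

Definition bilin (t t' b : bool) : A := \sum_i C t b i * D t' b i.

Let comm := @commutator A.

Let CCE t b i s c j :
  C t b i * C s c j = [&& t != s, b != c & i == j]%:R - C s c j * C t b i.
Proof. by rewrite -CC addrK. Qed.

Let DDE t b i s c j :
  D t b i * D s c j = [&& t != s, b != c & i == j]%:R - D s c j * D t b i.
Proof. by rewrite -DD addrK. Qed.

(** Anticommuting [C] past [C] and [D] past [D] leaves a sign [(-1) (-1) = 1] on the
    reordered product, which cancels in the commutator. What remains are the terms in
    which at least one of the two anticommutators is nonzero, that is [i = j]. *)
Lemma comm_bilin t t' b s s' c :
  comm (bilin t t' b) (bilin s s' c) =
    ((t != s) && (b != c))%:R * ((t' != s') && (b != c))%:R * n%:R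
    - ((t != s) && (b != c))%:R * \sum_i D s' c i * D t' b i
    - ((t' != s') && (b != c))%:R * \sum_i C s c i * C t b i.
Proof.
set al := (t != s) && _; set be := (t' != s') && _.
have mulb (k : bool) (x : A) : x * k%:R = k%:R * x by rewrite mulr_natl mulr_natr.
have term i j : comm (C t b i * D t' b i) (C s c j * D s' c j) =
    (al && (i == j))%:R * (be && (i == j))%:R
    - (al && (i == j))%:R * (D s' c j * D t' b i)
    - (be && (i == j))%:R * (C s c j * C t b i).
  have CDCD t1 b1 i1 t2 b2 i2 t1' t2' :
      C t1 b1 i1 * D t1' b1 i1 * (C t2 b2 i2 * D t2' b2 i2) =
      C t1 b1 i1 * C t2 b2 i2 * (D t1' b1 i1 * D t2' b2 i2).
    by rewrite -mulrA [X in _ * X]mulrA -CD !mulrA.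
  rewrite /comm /commutator !CDCD CCE DDE !andbA -/al -/be.
  rewrite mulrBl !mulrBr opprB -[LHS]addrA; congr (_ + _).
  by rewrite addrAC subrr add0r mulb.
rewrite /comm /commutator /bilin mulr_suml mulr_sumr -sumrB.
under eq_bigr => i _.
  rewrite mulr_sumr mulr_suml -sumrB.
  under eq_bigr => j _ do rewrite [_ - _]term.
  rewrite (bigD1 i)//= eqxx !andbT big1 ?addr0; last first.
    by move=> j /negPf jNi; rewrite [i == j]eq_sym jNi !andbF !mul0r !subr0.
  over.
by rewrite !sumrB sumr_const card_ord -[_ *+ n]mulr_natr !mulr_sumr.
Qed.

Lemma bilin_comm0 t t' b s s' c :
  ~~ ((t != s) && (b != c)) -> ~~ ((t' != s') && (b != c)) ->
  comm (bilin t t' b) (bilin s s' c) = 0.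
Proof.
by move=> /negPf al /negPf be; rewrite comm_bilin al be !mul0r !subr0.
Qed.

(** Unless the two bilinears are dual to each other, at most one kind of contraction
    contributes to their commutator, which is then a sum of products [C C] or [D D].
    All factors of these anticommute with the [C], or with the [D], of the first
    bilinear, so the products commute with it. *)
Lemma serre_bilin t t' b s s' c :
  ~~ [&& t != s, t' != s' & b != c] ->
  comm (bilin t t' b) (comm (bilin t t' b) (bilin s s' c)) = 0.
Proof.
move=> H.
have anti (x y z : A) : x * y = - (y * x) -> x * z = - (z * x) -> 
    x * (y * z) = y * z * x.
  by move=> xy xz; rewrite mulrA xy mulNr -mulrA xz mulrN opprK mulrA.
have CZ u v w : ~~ ((t != s) && (b != c)) ->
    C t b u * (C s c v * C t b w) = C s c v * C t b w * C t b u.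
  by move=> /negPf al; apply: anti; rewrite CCE ?andbA ?al ?eqxx sub0r.
have DZ u v w : ~~ ((t' != s') && (b != c)) ->
    D t' b u * (D s' c v * D t' b w) = D s' c v * D t' b w * D t' b u.
  by move=> /negPf be; apply: anti; rewrite DDE ?andbA ?be ?eqxx sub0r.
have CDD s1 b1 i1 t1 c1 j1 t2 c2 j2 :
    C s1 b1 i1 * (D t1 c1 j1 * D t2 c2 j2) = D t1 c1 j1 * D t2 c2 j2 * C s1 b1 i1.
  by rewrite mulrA CD -mulrA CD mulrA.
have DCC s1 b1 i1 t1 c1 j1 t2 c2 j2 :
    D s1 b1 i1 * (C t1 c1 j1 * C t2 c2 j2) = C t1 c1 j1 * C t2 c2 j2 * D s1 b1 i1.
  by rewrite mulrA -CD -mulrA -CD mulrA.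
rewrite [X in comm _ X]comm_bilin.
case al: ((t != s) && (b != c)); case be: ((t' != s') && (b != c)).
- by case/andP: al be H => -> -> /andP[->].
- rewrite !mul0r mulr0 mul0r mul1r sub0r subr0 /comm /commutator mulrN mulNr opprK addrC.
  apply/eqP; rewrite subr_eq0; apply/eqP.
  rewrite /bilin mulr_suml mulr_sumr; apply: eq_bigr => i _.
  rewrite mulr_suml mulr_sumr; apply: eq_bigr => j _.
  by rewrite -[RHS]mulrA DZ ?be// [RHS]mulrA CDD mulrA.
- rewrite !mul0r mul1r subr0 sub0r /comm /commutator mulrN mulNr opprK addrC.
  apply/eqP; rewrite subr_eq0; apply/eqP.
  rewrite /bilin mulr_suml mulr_sumr; apply: eq_bigr => i _.
  rewrite mulr_suml mulr_sumr; apply: eq_bigr => j _.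
  by rewrite -[RHS]mulrA DCC [RHS]mulrA CZ ?al// mulrA.
- by rewrite !mul0r !subr0 /comm /commutator mulr0 mul0r subrr.
Qed.

(** The eigenvalue of [C s c j] under the commutator with the number operator of the
    pair formed by [C t b] and its dual. *)
Definition weight_shift (t b s c : bool) : int :=
  ((t != s) && (b != c))%:Z - ((t == s) && (b == c))%:Z.

Lemma comm_bilin_dual t t' b :
  comm (bilin t t' b) (bilin (~~ t) (~~ t') (~~ b)) =
    n%:R - \sum_i D (~~ t') (~~ b) i * D t' b i
         - \sum_i C (~~ t) (~~ b) i * C t b i.
Proof. by rewrite comm_bilin; case: t t' b => [] [] []; rewrite !mul1r. Qed.

Lemma comm_cartan_bilin t t' b s s' c :
  comm (comm (bilin t t' b) (bilin (~~ t) (~~ t') (~~ b))) (bilin s s' c) =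
  bilin s s' c *~ - (weight_shift t b s c + weight_shift t' b s' c).
Proof.
rewrite comm_bilin_dual; set ND := \sum_i _; set NC := \sum_i _.
have NCD j : comm NC (D s' c j) = 0.
  rewrite /comm /commutator mulr_suml mulr_sumr -sumrB big1// => i _.
  by rewrite -mulrA CD mulrA CD -mulrA subrr.
have NDC j : comm ND (C s c j) = 0.
  rewrite /comm /commutator mulr_suml mulr_sumr -sumrB big1// => i _.
  by rewrite -mulrA -CD mulrA -CD -mulrA subrr.
have NCX : comm NC (bilin s s' c) = bilin s s' c *~ weight_shift t b s c.
  rewrite /comm /bilin commutator_sumr mulrz_suml; apply: eq_bigr => j _.
  by rewrite commutator_mulr [commutator NC (D _ _ _)]NCD mulr0 addr0
    (commutator_number CC) mulrzAl.
have NDX : comm ND (bilin s s' c) = bilin s s' c *~ weight_shift t' b s' c.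
  rewrite /comm /bilin commutator_sumr mulrz_suml; apply: eq_bigr => j _.
  by rewrite commutator_mulr [commutator ND (C _ _ _)]NDC mul0r add0r
    (commutator_number DD) mulrzAr.
rewrite mulrNz mulrzDr -NCX -NDX /comm !commutatorBl.
by rewrite /(commutator n%:R _) mulr_natl mulr_natr subrr sub0r -opprD addrC.
Qed.

(** Reversing all three flags exchanges [E_i] and [F_i]. The species [b] alternates
    along the cyclic Dynkin diagram, and one passes from a node to the next by
    reversing [b] and one of the other two flags. *)
Definition chevalley_flags (i : 'I_4) : bool * bool * bool :=
  match val i with
  | 0%N => (true, true, true)
  | 1%N => (true, false, false)
  | 2%N => (false, false, true)
  | _ => (false, true, false)
  end.

Definition chevalley_e (i : 'I_4) : A :=
  let: (t, t', b) := chevalley_flags i in bilin t t' b.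

Definition chevalley_f (i : 'I_4) : A :=
  let: (t, t', b) := chevalley_flags i in bilin (~~ t) (~~ t') (~~ b).

Definition chevalley_h (i : 'I_4) : A :=
  commutator (chevalley_e i) (chevalley_f i).

Lemma cartan_flags (i j : 'I_4) :
  let: (t, t', b) := chevalley_flags i in
  let: (s, s', c) := chevalley_flags j in
  cartan_A31 i j = - (weight_shift t b s c + weight_shift t' b s' c).
Proof. by case: i j => [[|[|[|[|//]]]] ?] [[|[|[|[|//]]]] ?]. Qed.

Lemma chevalley_he i j :
  commutator (chevalley_h i) (chevalley_e j) = chevalley_e j *~ cartan_A31 i j.
Proof.
rewrite /chevalley_h /chevalley_e /chevalley_f; have := cartan_flags i j.
case: (chevalley_flags i) (chevalley_flags j) => [[t t'] b] [[s s'] c] ->.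
exact: comm_cartan_bilin.
Qed.

Lemma chevalley_hf i j :
  commutator (chevalley_h i) (chevalley_f j) = - (chevalley_f j *~ cartan_A31 i j).
Proof.
rewrite /chevalley_h /chevalley_e /chevalley_f; have := cartan_flags i j.
case: (chevalley_flags i) (chevalley_flags j) => [[t t'] b] [[s s'] c] ->.
rewrite [LHS]comm_cartan_bilin -mulrNz; congr (_ *~ _).
by case: t t' b s s' c => [] [] [] [] [] [].
Qed.

Lemma chevalley_ef i j :
  commutator (chevalley_e i) (chevalley_f j) = if i == j then chevalley_h i else 0.
Proof.
have [->//|ij] := eqVneq i j.
move: ij; rewrite /chevalley_e /chevalley_f.
by case: i j => [[|[|[|[|//]]]] ?] [[|[|[|[|//]]]] ?] //= _; apply: bilin_comm0.
Qed.

Lemma chevalley_hh i j : commutator (chevalley_h i) (chevalley_h j) = 0.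
Proof.
rewrite {2}/chevalley_h {2}/commutator commutatorBr !commutator_mulr.
rewrite !chevalley_he !chevalley_hf !mulrN !mulNr !mulrzAl !mulrzAr.
by rewrite subrr addNr subrr.
Qed.

Lemma chevalley_serre i j : i != j ->
  iter `|1 - cartan_A31 i j|%N (commutator (chevalley_e i)) (chevalley_e j) = 0 /\
  iter `|1 - cartan_A31 i j|%N (commutator (chevalley_f i)) (chevalley_f j) = 0.
Proof.
rewrite /chevalley_e /chevalley_f.
case: i j => [[|[|[|[|//]]]] ?] [[|[|[|[|//]]]] ?] //= _; split;
  by [apply: bilin_comm0 | apply: serre_bilin].
Qed.

End FermionBilinears.

(** * Clifford algebras: creation and annihilation operators *)

Section Generation.
Variables (F : fieldType) (W : lmodType F) (B : W -> W -> F).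
Variable Cl : clifford_algebra B.

Let clproducts : set Cl :=
  lspan [set a | exists s : seq W, a = \prod_(v <- s) cl_in Cl v].

(** A boolean predicate, so that the generated subalgebra can be formed as a subtype. *)
Definition cl_generated : {pred Cl} := fun a => `[< clproducts a >].

Lemma cl_generated_subalg : subalg_closed cl_generated.
Proof.
have prod1 s : clproducts (\prod_(v <- s) cl_in Cl v) by apply: lspan_gen; exists s.
split=> [|a x y /asboolP Px /asboolP Py|x y /asboolP Px /asboolP Py]; apply/asboolP.
- by have := prod1 [::]; rewrite big_nil.
- by apply: lspanP.
- case: Px => k [c [w [Xw ->]]]; rewrite mulr_suml.
  apply: vsubspace_sum => [|i _]; first exact: lspan_subspace.
  have [s ->] := Xw i; case: Py => l [d [v [Xv ->]]]; rewrite mulr_sumr.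
  apply: vsubspace_sum => [|j _]; first exact: lspan_subspace.
  have [t ->] := Xv j; rewrite -scalerAr -scalerAl -big_cat.
  have S := lspan_subspace [set a | exists s : seq W, a = \prod_(v <- s) cl_in Cl v].
  by apply: (vsubspaceZ _ S); apply: (vsubspaceZ _ S); apply: prod1.
Qed.

HB.instance Definition _ :=
  GRing.isSubalgClosed.Build F Cl cl_generated cl_generated_subalg.

Record cl_sub := ClSub { cl_sub_val :> Cl; cl_subP : cl_sub_val \in cl_generated }.
HB.instance Definition _ := [isSub for cl_sub_val].
HB.instance Definition _ := [Choice of cl_sub by <:].
HB.instance Definition _ := [SubChoice_isSubAlgebra of cl_sub by <:].

Lemma cl_sub_val_linear : linear cl_sub_val. Proof. by []. Qed.
Lemma cl_sub_val_monoid : monoid_morphism cl_sub_val. Proof. by []. Qed.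
HB.instance Definition _ :=
  GRing.isLinear.Build F cl_sub Cl *:%R cl_sub_val cl_sub_val_linear.
HB.instance Definition _ :=
  GRing.isMonoidMorphism.Build cl_sub Cl cl_sub_val cl_sub_val_monoid.

(** The universal property gives a morphism from [Cl] to its subalgebra generated by the
    vectors; by uniqueness, its composite with the inclusion is the identity. *)
Lemma cl_generatedT (a : Cl) : clproducts a.
Proof.
have inP v : cl_in Cl v \in cl_generated.
  apply/asboolP/lspan_gen; exists (v :: [::]); by rewrite big_seq1.
pose f v : cl_sub := ClSub (inP v).
have f_lin : linear f.
  by move=> c v w; apply: val_inj; rewrite /= linearP.
pose fL : {linear W -> cl_sub} := HB.pack f (GRing.isLinear.Build F W cl_sub _ f f_lin).
have fC : clifford_map B fL.
  move=> v w; apply: val_inj; have := @cl_inP _ _ _ Cl v w; rewrite /= => ->.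
  by [].
have [g [gf _]] := @cl_univ _ _ _ Cl _ _ fC.
have [h [_ hu]] := @cl_univ _ _ _ Cl _ _ (@cl_inP _ _ _ Cl).
pose k : {lrmorphism Cl -> Cl} := cl_sub_val \o g.
have kE v : k (cl_in Cl v) = cl_in Cl v by rewrite /k /= gf.
have -> : a = cl_sub_val (g a) by rewrite -[LHS]/(idfun a) (hu idfun)// -(hu k kE).
by apply/asboolP; apply: cl_subP.
Qed.

Lemma cl_ind (P : set Cl) : vsubspace P -> P 1 ->
  (forall v a, P a -> P (cl_in Cl v * a)) -> forall a, P a.
Proof.
move=> PS P1 PM a; have := cl_generatedT a; apply: (lspan_min PS) => _ [s ->].
by elim: s => [|v s IH]; rewrite ?big_nil// big_cons; apply: PM.
Qed.

Lemma cl_gamma_ex : exists g : {lrmorphism Cl -> Cl},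
  forall v, g (cl_in Cl v) = - cl_in Cl v.
Proof.
have fC : clifford_map B (\- cl_in Cl).
  by move=> v w; rewrite /= !mulrNN; apply: cl_inP.
by have [g [gf _]] := @cl_univ _ _ _ Cl _ _ fC; exists g.
Qed.

(** The parity automorphism: with it, the two signs in the definitions of the exterior
    product and the contraction become one formula on all of [Cl]. *)
Definition cl_gamma : {lrmorphism Cl -> Cl} := sval (cid cl_gamma_ex).

Lemma cl_gamma_in v : cl_gamma (cl_in Cl v) = - cl_in Cl v.
Proof. by rewrite /cl_gamma; case: cid => /= g gE; rewrite gE. Qed.

Lemma cl_gammaK : involutive cl_gamma.
Proof.
apply: cl_ind => [||v a /= IH]; first exact: (linear_eq_vsubspace (cl_gamma \o cl_gamma) idfun).
  by rewrite /= !rmorph1.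
by rewrite !rmorphM /= cl_gamma_in rmorphN /= cl_gamma_in opprK IH.
Qed.

Lemma cl_parity_gamma b a : cl_parity b a -> cl_gamma a = (-1) ^+ b *: a.
Proof.
pose g := GRing.scale ((-1) ^+ b : F) : {linear Cl -> Cl}.
apply: (lspan_min (linear_eq_vsubspace cl_gamma g)) => _ [s sb ->] /=.
rewrite /g /= -sb signr_odd; elim: s {sb} => [|v s IH].
  by rewrite big_nil rmorph1 scale1r.
by rewrite big_cons rmorphM /= cl_gamma_in IH exprS mulN1r scaleNr -scalerAr mulNr scalerN.
Qed.

Lemma cl_parity_decomp (x : Cl) :
  exists y : {ffun bool -> Cl}, (forall b, cl_parity b (y b)) /\ x = \sum_b y b.
Proof.
move: x; apply: cl_ind => [||v a [y [yP ->]]].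
- split=> [|c _ _ [y [yP ->]] [z [zP ->]]].
    exists [ffun=> 0]; split=> [b|]; rewrite ?ffunE; first exact: lspan0.
    by rewrite big1// => b _; rewrite ffunE.
  exists [ffun b => c *: y b + z b]; split=> [b|].
    by rewrite ffunE; apply: lspanP; [apply: yP|apply: zP].
  by rewrite scaler_sumr -big_split; apply: eq_bigr => b _; rewrite ffunE.
- exists [ffun b => if b then 0 else 1]; split=> [[]|]; rewrite ?ffunE.
  + exact: lspan0.
  + by apply: lspan_gen; exists [::]; rewrite ?big_nil.
  + by rewrite big_bool !ffunE /= add0r.
- exists [ffun b => cl_in Cl v * y (~~ b)]; split=> [b|]; last first.
    by rewrite mulr_sumr !big_bool !ffunE /= addrC.
  rewrite ffunE; have := yP (~~ b); move: (y _) => a'.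
  apply: (@lspan_min _ _ _ [set a | cl_parity b (cl_in Cl v * a)]) => [|_ [s sb ->]] /=.
    split=> [|c p q]; first by rewrite /= mulr0; apply: lspan0.
    by rewrite /= mulrDr -scalerAr; apply: lspanP.
  by apply: lspan_gen; exists (v :: s); rewrite ?big_cons//= sb negbK.
Qed.

(** Exterior product and contraction as one symbol: the relations between them, and the
    effect of the Hodge star, are symmetric under reversal of [t]. *)
Definition cl_fermion (t : bool) (v : W) : Cl -> Cl :=
  if t then cl_wedge v else cl_contr v.
Arguments cl_fermion : simpl never.

Let sg (t : bool) : F := if t then 1 else -1.

Let fermion_lin t v (a : Cl) :=
  2^-1 *: (cl_in Cl v * a + sg t *: (cl_gamma a * cl_in Cl v)).

Let fermion_lin_linear t v : linear (fermion_lin t v).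
Proof.
move=> c a b; rewrite /fermion_lin linearP mulrDr mulrDl -scalerAr -scalerAl.
rewrite !scalerDr !scalerA !(mulrC c) -!addrA; congr (_ + _); rewrite addrCA.
by rewrite -!mulrA [c * _]mulrC.
Qed.

Lemma cl_fermionE t v a : cl_fermion t v a =
  2^-1 *: (cl_in Cl v * a + (if t then 1 else -1) *: (cl_gamma a * cl_in Cl v)).
Proof.
pose g : {linear Cl -> Cl} := HB.pack (fermion_lin t v)
  (GRing.isLinear.Build F Cl Cl _ _ (fermion_lin_linear t v)).
rewrite -[RHS]/(g a) /cl_fermion; case: t @g => g;
  apply: linext_linear => [x|b x /cl_parity_gamma xE]; try exact: cl_parity_decomp;
  by rewrite /g /= /fermion_lin xE -scalerAl ?scale1r ?scaleN1r.
Qed.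

Lemma cl_fermion_linear t v : linear (cl_fermion t v).
Proof. by move=> c a b; rewrite !cl_fermionE; apply: fermion_lin_linear. Qed.

HB.instance Definition _ t v :=
  GRing.isLinear.Build F Cl Cl *:%R (cl_fermion t v) (@cl_fermion_linear t v).

Lemma cl_fermion_vec_linear t a : linear (cl_fermion t ^~ a).
Proof.
move=> c v w; rewrite !cl_fermionE !linearP /= mulrDl mulrDr -scalerAr -scalerAl.
rewrite !scalerDr !scalerA !(mulrC c) -!addrA; congr (_ + _); rewrite addrCA.
by rewrite -!mulrA [c * _]mulrC.
Qed.

Hypothesis two_neq0 : (2 : F) != 0.

Lemma cl_mulE v a : cl_in Cl v * a = cl_fermion true v a + cl_fermion false v a.
Proof.
rewrite !cl_fermionE -scalerDr scale1r scaleN1r addrACA subrr addr0.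
by rewrite -mulr2n -scaler_nat scalerA mulVf ?scale1r.
Qed.

(** Expand both products with [cl_fermionE]. The terms with [cl_gamma a] cancel, and the
    others combine to multiples of [v w + w v], which is the scalar [2 B v w]. *)
Lemma cl_fermion_anticomm t v s w a :
  cl_fermion t v (cl_fermion s w a) + cl_fermion s w (cl_fermion t v a) =
  (if t != s then B v w else 0) *: a.
Proof.
pose x := cl_in Cl v; pose y := cl_in Cl w; pose g := cl_gamma a.
have quad t1 v1 s1 w1 : cl_fermion t1 v1 (cl_fermion s1 w1 a) =
    (2^-1 * 2^-1) *: (cl_in Cl v1 * cl_in Cl w1 * a
      + sg s1 *: (cl_in Cl v1 * g * cl_in Cl w1)
      - sg t1 *: (cl_in Cl w1 * g * cl_in Cl v1)
      - (sg t1 * sg s1) *: (a * cl_in Cl w1 * cl_in Cl v1)).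
  have gE : cl_gamma (2^-1 *: (cl_in Cl w1 * a + sg s1 *: (g * cl_in Cl w1))) =
      2^-1 *: (- (cl_in Cl w1 * g) - sg s1 *: (a * cl_in Cl w1)).
    rewrite linearZ/= linearD/= linearZ/= !rmorphM /= cl_gamma_in cl_gammaK.
    by rewrite mulNr mulrN scalerN.
  rewrite !cl_fermionE -/(sg t1) -/(sg s1) -/g gE -scalerAr -scalerAl.
  have pull k (p q : Cl) :
      2^-1 *: (2^-1 *: p + k *: (2^-1 *: q)) = (2^-1 * 2^-1) *: (p + k *: q).
    by rewrite !scalerDr !scalerA mulrAC.
  rewrite pull; congr (_ *: _); rewrite mulrDr !mulrA -scalerAr mulrBl -scalerAl !mulrA scalerBr.
  by rewrite scalerA mulNr scalerN addrA.
rewrite !quad -scalerDr -/x -/y.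
have -> : x * y * a + sg s *: (x * g * y) - sg t *: (y * g * x)
    - (sg t * sg s) *: (a * y * x) +
    (y * x * a + sg t *: (y * g * x) - sg s *: (x * g * y)
    - (sg s * sg t) *: (a * x * y)) =
    (x * y + y * x) * a - (sg t * sg s) *: (a * (x * y + y * x)).
  rewrite mulrDl mulrDr !mulrA scalerDr opprD [sg s * sg t]mulrC.
  set p := x * y * a; set q := y * x * a; set u := sg s *: _; set z := sg t *: _.
  set c := _ *: (a * y * x); set d := _ *: (a * x * y).
  rewrite [LHS](AC (4*4) (1*5*(2*7)*(3*6)*(4*8)))/= subrr addNr !addr0.
  by rewrite [- c - d]addrC.
have := cl_inP Cl v w; rewrite -/x -/y => ->.
rewrite mulr_algl mulr_algr scalerA -scalerBl scalerA; congr (_ *: _).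
have four (z : F) : 2^-1 * 2^-1 * ((1 + 1) * (z *+ 2)) = z.
  by rewrite -[z *+ 2]mulr_natr -[1 + 1]/(2 : F) mulrACA mulVf// mul1r mulrC mulfK.
rewrite -[X in X - _]mul1r -mulrBl /sg.
by case: t s => [] []; rewrite /= ?mulr1 ?mul1r ?mulN1r ?opprK ?subrr ?mul0r ?mulr0.
Qed.

Lemma cl_fermion1 v : cl_fermion false v 1 = 0.
Proof. by rewrite cl_fermionE rmorph1 mulr1 mul1r scaleN1r subrr scaler0. Qed.

Lemma cl_wedge_sq v a : cl_fermion true v (cl_fermion true v a) = 0.
Proof.
have := cl_fermion_anticomm true v true v a; rewrite eqxx scale0r => /eqP.
by rewrite -mulr2n -scaler_nat scaler_eq0 (negPf two_neq0) => /eqP.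
Qed.

Lemma cl_wedgeC v w a :
  cl_fermion true v (cl_fermion true w a) = - cl_fermion true w (cl_fermion true v a).
Proof.
by apply/eqP; rewrite -addr_eq0 cl_fermion_anticomm eqxx scale0r.
Qed.

Lemma cl_contr_wedge v w a : cl_fermion false v (cl_fermion true w a) =
  B v w *: a - cl_fermion true w (cl_fermion false v a).
Proof. by rewrite -(cl_fermion_anticomm false v true w a) addrK. Qed.

Lemma cl_wedges_cons v s : cl_wedges Cl (v :: s) = cl_fermion true v (cl_wedges Cl s).
Proof. by []. Qed.

Lemma cl_wedges_perm s s' : perm_eq s s' ->
  exists k : nat, cl_wedges Cl s = (-1) ^+ k *: cl_wedges Cl s'.
Proof.
elim: s s' => [|v s IH] s' ps.
  by exists 0%N; rewrite expr0 scale1r; move: ps; rewrite perm_sym => /perm_nilP ->.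
have vs' : v \in s' by rewrite -(perm_mem ps) mem_head.
case/splitPr: vs' ps => s1 s2 ps; have /IH[k sE] : perm_eq s (s1 ++ s2).
  by rewrite -(perm_cons v) (perm_trans ps)// -cat1s perm_catCA.
have [l lE] : exists l, cl_wedges Cl (s1 ++ v :: s2) =
    (-1) ^+ l *: cl_fermion true v (cl_wedges Cl (s1 ++ s2)).
  elim: s1 {ps sE} => [|w s1 [l IHl]]; first by exists 0%N; rewrite expr0 scale1r.
  exists l.+1; rewrite !cat_cons !cl_wedges_cons IHl linearZ /= cl_wedgeC exprS mulN1r.
  by rewrite scaleNr scalerN.
exists (k + l)%N; rewrite lE scalerA exprD -mulrA -expr2 -signr_odd.
by rewrite cl_wedges_cons sE linearZ -signr_odd sqrr_sign mulr1 signr_odd.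
Qed.

Lemma cl_wedges_dup v s : v \in s -> cl_fermion true v (cl_wedges Cl s) = 0.
Proof.
move=> /perm_to_rem/cl_wedges_perm[k ->].
by rewrite cl_wedges_cons linearZ /= cl_wedge_sq scaler0.
Qed.

Lemma cl_contr_wedges0 v s : {in s, forall w, B v w = 0} ->
  cl_fermion false v (cl_wedges Cl s) = 0.
Proof.
elim: s => [|w s IH] vs; first exact: cl_fermion1.
rewrite cl_wedges_cons cl_contr_wedge vs ?mem_head// scale0r sub0r IH ?linear0 ?oppr0//.
by move=> u us; apply: vs; rewrite inE us orbT.
Qed.

End Generation.

Arguments cl_fermion : simpl never.

(** * Words in dual bases and the Hodge star *)

Section DualBases.
Variables (F : fieldType) (W : lmodType F) (B : W -> W -> F).
Variable Cl : clifford_algebra B.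
Hypotheses (two_neq0 : (2 : F) != 0) (Bsym : forall v w, B v w = B w v).
Variables (J : finType) (e e' : J -> W).
Hypothesis dualE : forall j k, B (e j) (e' k) = (j == k)%:R.
Hypothesis basisE : forall v, v = \sum_j B v (e' j) *: e j.

Local Notation wedge := (@cl_fermion F W B Cl true).
Local Notation contr := (@cl_fermion F W B Cl false).
Local Notation contr_wedge := (cl_contr_wedge two_neq0).

Definition cl_word (r : seq J) : Cl := cl_wedges Cl (map e r).

Lemma cl_word_cons j r : cl_word (j :: r) = wedge (e j) (cl_word r).
Proof. by []. Qed.

Lemma cl_fermion_basis t v (a : Cl) :
  cl_fermion t v a = \sum_j B v (e' j) *: cl_fermion t (e j) a.
Proof.
pose f : {linear W -> Cl} := HB.pack ((cl_fermion t)^~ a)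
  (GRing.isLinear.Build F W Cl _ _ (cl_fermion_vec_linear t a)).
by rewrite -[LHS]/(f v) [in LHS](basisE v) linear_sum; apply: eq_bigr => j _; rewrite linearZ.
Qed.

Lemma cl_word_dup j r : j \in r -> wedge (e j) (cl_word r) = 0.
Proof. by move=> jr; apply: cl_wedges_dup => //; apply: map_f. Qed.

Lemma contr_word_notin j r : j \notin r -> contr (e' j) (cl_word r) = 0.
Proof.
move=> jr; apply: (cl_contr_wedges0 Cl two_neq0) => _ /mapP[k kr ->].
by rewrite Bsym dualE; case: eqP kr jr => // -> ->.
Qed.

Lemma contr_word_cons j r :
  j \notin r -> contr (e' j) (cl_word (j :: r)) = cl_word r.
Proof.
move=> jr; rewrite cl_word_cons contr_wedge contr_word_notin// linear0 subr0.
by rewrite Bsym dualE eqxx scale1r.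
Qed.

Lemma cl_word_perm r r' : perm_eq r r' ->
  exists k : nat, cl_word r = (-1) ^+ k *: cl_word r'.
Proof. by move=> rr'; apply: cl_wedges_perm => //; apply: perm_map. Qed.

Lemma cl_word_neq0 r : uniq r -> cl_word r != 0.
Proof.
elim: r => [|j r IH] /=; first by rewrite oner_neq0.
move=> /andP[jr /IH]; apply: contra => /eqP r0.
by rewrite -(contr_word_cons jr) r0 linear0.
Qed.

(** Left multiplication by a vector is creation plus annihilation, and both operators
    preserve the span of the words without repeated letters. *)
Lemma cl_word_span a : lspan [set b | exists2 r, uniq r & b = cl_word r] a.
Proof.
set Q := lspan _; have QS : vsubspace Q by apply: lspan_subspace.
have Qw v b : Q b -> Q (wedge v b).
  move: b; apply: (@lspan_min _ _ _ [set b | Q (wedge v b)]) => [|_ [r ur ->]] /=.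
    split=> [|c x y] /=; first by rewrite linear0; case: QS.
    by rewrite linearP; apply: QS.2.
  rewrite cl_fermion_basis; apply: vsubspace_sum => // j _; apply: vsubspaceZ => //.
  have [jr|jr] := boolP (j \in r); first by rewrite cl_word_dup//; case: QS.
  by apply: lspan_gen; exists (j :: r); rewrite //= jr.
have Qc v b : Q b -> Q (contr v b).
  move: b; apply: (@lspan_min _ _ _ [set b | Q (contr v b)]) => [|_ [r ur ->]] /=.
    split=> [|c x y] /=; first by rewrite linear0; case: QS.
    by rewrite linearP; apply: QS.2.
  elim: r ur => [_|j r IH /=/andP[jr ur]]; first by rewrite cl_fermion1; case: QS.
  rewrite cl_word_cons contr_wedge -scaleN1r addrC; apply: QS.2.
    by apply: Qw; apply: IH.
  by apply: vsubspaceZ => //; apply: lspan_gen; exists r.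
apply: (cl_ind QS) => [|v b Qb]; first by apply: lspan_gen; exists [::].
by rewrite (cl_mulE two_neq0); apply: vsubspaceD => //; [apply: Qw|apply: Qc].
Qed.

Lemma cl_word_ind (P : set Cl) : vsubspace P ->
  (forall r, uniq r -> P (cl_word r)) -> forall a, P a.
Proof.
by move=> PS Pw a; move: (cl_word_span a); apply: (lspan_min PS) => _ [r ur ->]; apply: Pw.
Qed.

Lemma cl_wedges_degree s :
  lspan [set b | exists2 r, uniq r /\ size r = size s & b = cl_word r]
    (cl_wedges Cl s).
Proof.
elim: s => [|v s IH]; first by apply: lspan_gen; exists [::].
rewrite cl_wedges_cons; set Q := lspan _; have QS : vsubspace Q by apply: lspan_subspace.
move: IH; apply: (@lspan_min _ _ _ [set b | Q (wedge v b)]) => [|_ [r [ur sr] ->]] /=.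
  split=> [|c x y] /=; first by rewrite linear0; case: QS.
  by rewrite linearP; apply: QS.2.
rewrite cl_fermion_basis; apply: vsubspace_sum => // j _; apply: vsubspaceZ => //.
have [jr|jr] := boolP (j \in r); first by rewrite cl_word_dup//; case: QS.
by apply: lspan_gen; exists (j :: r); rewrite //= ?jr ?sr.
Qed.

(** A word without repetition of maximal length is a permutation of the full one. *)
Lemma cl_degree_top a : cl_degree #|J| a ->
  exists k, a = k *: cl_word (enum J).
Proof.
pose P := [set b : Cl | exists k : F, b = k *: cl_word (enum J)].
have PS : vsubspace P.
  split=> [|c _ _ [k ->] [l ->]]; first by exists 0; rewrite scale0r.
  by exists (c * k + l); rewrite scalerDl scalerA.
apply: (lspan_min PS) => _ [s ss ->].
have := cl_wedges_degree s; rewrite ss; apply: (lspan_min PS) => _ [r [ur rJ] ->].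
have [|k ->] := @cl_word_perm r (enum J); last by exists ((-1) ^+ k).
apply: uniq_perm (enum_uniq _) _ => //.
have rsub : {subset r <= enum J} by move=> j _; rewrite mem_enum.
by apply: (uniq_min_size ur rsub _).2; rewrite -cardE -rJ.
Qed.

(** A word that misses the letter [j] is obtained by annihilating [j] in the longer
    word, so that one can descend from the full word to all others. *)
Lemma cl_contr_ind (P : set Cl) : vsubspace P ->
  (forall v a, P a -> P (contr v a)) -> P (cl_word (enum J)) -> forall a, P a.
Proof.
move=> PS Pc Ptop; apply: (cl_word_ind PS) => r.
have [k] := ubnP (#|J| - size r); elim: k r => // k IH r rk ur.
have [full|] := boolP [forall j, j \in r].
  have [|k' ->] := @cl_word_perm r (enum J); last exact: vsubspaceZ.
  by apply: uniq_perm => //; [apply: enum_uniq|move=> j; rewrite mem_enum (forallP full)].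
rewrite negb_forall => /existsP[j jr]; rewrite -(contr_word_cons jr).
apply: Pc; apply: IH; rewrite /= ?jr//.
have : (size r < #|J|)%N.
  by rewrite -[X in (X <= _)%N]/(size (j :: r)) -(card_uniqP _) ?max_card//= jr.
by move=> rJ; rewrite subnS prednK ?subn_gt0.
Qed.

Section Hodge.
Variables (vol : Cl) (star : {linear Cl -> Cl}).
Hypotheses (vol_top : cl_degree #|J| vol) (vol_neq0 : vol != 0).
Hypothesis star_hodge : hodge_star vol star.

(** One half is the defining property of the star. For the other half, let [U] be the
    difference of the two sides, as an operator on [a]. It satisfies
    [U (contr w a) = - wedge w (U a)] and kills the volume element, from which the
    contractions generate everything. *)
Lemma hodge_fermion t v a :
  star (cl_fermion t v a) = cl_fermion (~~ t) v (star a).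
Proof.
case: star_hodge => _ star_vol star_contr.
have half w b : wedge w (star b) = star (contr w b) by apply: star_contr.
case: t => /=; last by rewrite half.
(* [U] measures the failure of the identity for creation operators *)
pose U b := star (wedge v b) - contr v (star b).
suff : U a = 0 by move/eqP; rewrite subr_eq0 => /eqP.
have [k volE] := cl_degree_top vol_top.
have k_neq0 : k != 0 by apply: contra vol_neq0 => /eqP k0; rewrite volE k0 scale0r.
move: a; apply: cl_contr_ind => [|w b /= Ub|].
- split=> [|c x y /= Ux Uy]; first by rewrite /= /U [wedge v 0]linear0 !(linear0 star) [contr v
  0]linear0 subrr.
  rewrite /U [wedge v _]linearP /= !(linearP star) /= [contr v _]linearP /= opprD.
  rewrite addrACA -scalerBr.
  by rewrite -[_ - _]/(U x) -[X in _ + X]/(U y) Ux Uy scaler0 addr0.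
- have : U (contr w b) = - wedge w (U b).
    rewrite /U [wedge w (_ - _)]linearB /= [wedge w (star (wedge _ _))]half.
    rewrite -[star (contr w b)]half !contr_wedge [star (_ - _)]linearB /=.
    by rewrite [star (_ *: _)]linearZ /= [B v w]Bsym !opprB addrCA.
  by rewrite Ub linear0 oppr0.
- have -> : cl_word (enum J) = k^-1 *: vol by rewrite volE scalerA mulVf// scale1r.
  have vol0 : wedge v vol = 0.
    rewrite volE linearZ /= cl_fermion_basis big1 ?scaler0// => j _.
    by rewrite cl_word_dup ?scaler0// mem_enum.
  rewrite /= /U [wedge v _]linearZ /= vol0 scaler0 linear0 [star _]linearZ /= star_vol.
  by rewrite [contr v _]linearZ /= cl_fermion1 scaler0 subr0.
Qed.

End Hodge.

Definition cl_occ (j : J) : endo Cl :=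
  endo_of (cl_fermion true (e j) \o cl_fermion false (e' j)).

Lemma cl_occ_word j r : uniq r -> cl_occ j (cl_word r) = (j \in r)%:R *: cl_word r.
Proof.
move=> ur; rewrite /cl_occ /=; have [jr|jr] := boolP (j \in r); last first.
  by rewrite contr_word_notin// linear0 scale0r.
have [k ->] := cl_word_perm (perm_to_rem jr).
rewrite !linearZ /= contr_word_cons ?scale1r// mem_rem_uniqF//.
Qed.

(** The operators [cl_occ j] and [1 - cl_occ j] are projections onto the words that
    contain [j], respectively do not contain it; their product over all [j], chosen
    according to [S], isolates the coefficient of one word. *)
Lemma cl_word_free (x : {set J} -> F) :
  \sum_S x S *: cl_word (enum S) = 0 -> forall S, x S = 0.
Proof.
move=> x0 S; pose q j : endo Cl := if j \in S then cl_occ j else 1 - cl_occ j.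
have qE l r : uniq r -> (\prod_(j <- l) q j) (cl_word r) =
    (all (fun j => (j \in S) == (j \in r)) l)%:R *: cl_word r.
  move=> ur; elim: l => [|j l IH]; first by rewrite big_nil scale1r.
  rewrite big_cons endo_mul IH linearZ /= -mulnb natrM mulrC -scalerA.
  congr (_ *: _); rewrite /q; have := cl_occ_word j ur.
  by case: (j \in S); case: (j \in r) => /= occE;
    rewrite ?endo_add ?endo_opp occE ?scale0r ?scale1r ?subrr ?subr0.
pose p : endo Cl := \prod_(j <- enum J) q j.
have pE r := qE (enum J) r; rewrite -/p in pE.
have : p (\sum_S x S *: cl_word (enum S)) = 0 by rewrite x0 linear0.
rewrite linear_sum (bigD1 S)//= linearZ /= pE ?enum_uniq//.
rewrite big1 ?addr0 => [|T TS]; last first.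
  rewrite linearZ /= pE ?enum_uniq//.
  have /negPf-> : ~~ all (fun j => (j \in S) == (j \in enum T)) (enum J).
    apply: contra TS => /allP ST; apply/eqP/setP => j.
    by have /eqP-> := ST j (mem_enum _ _); rewrite mem_enum.
  by rewrite scale0r scaler0.
have -> : all (fun j => (j \in S) == (j \in enum S)) (enum J).
  by apply/allP => j _; rewrite mem_enum.
by rewrite scale1r => /eqP; rewrite scaler_eq0 (negPf (cl_word_neq0 _)) ?enum_uniq// orbF => /eqP.
Qed.

Lemma cl_word_full a :
  exists x : {ffun {set J} -> F}, a = \sum_S x S *: cl_word (enum S).
Proof.
move: a; apply: cl_word_ind => [|r ur].
  split=> [|c _ _ [x ->] [y ->]].
    by exists [ffun=> 0]; rewrite big1// => S _; rewrite ffunE scale0r.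
  exists [ffun S => c * x S + y S]; rewrite scaler_sumr -big_split.
  by apply: eq_bigr => S _; rewrite ffunE scalerDl scalerA.
pose S := [set j in r]%SET.
have [|k ->] := @cl_word_perm r (enum S).
  by apply: uniq_perm => //; [apply: enum_uniq|move=> j; rewrite mem_enum inE].
exists [ffun T => (T == S)%:R * (-1) ^+ k]; rewrite (bigD1 S)//= big1 => [|T /negPf TS].
  by rewrite ffunE eqxx mul1r addr0.
by rewrite ffunE TS mul0r scale0r.
Qed.

End DualBases.

(** * Polarizations and number operators *)

Section Polarization.
Variables (F : fieldType) (W : lmodType F) (B : W -> W -> F).
Variables (n : nat) (e : bool -> 'I_n -> W) (L : bool -> set W).

(** Two complementary isotropic subspaces [L true] and [L false] in duality, with bases
    [e true] and [e false] dual to each other. *)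
Definition polarization : Prop :=
  [/\ forall b i c j, B (e b i) (e c j) = ((b != c) && (i == j))%:R,
      forall v, v = \sum_b \sum_i B v (e (~~ b) i) *: e b i,
      forall b i, L b (e b i) &
      forall b v i, L b v -> B v (e b i) = 0].

Hypothesis pol : polarization.
Hypotheses (two_neq0 : (2 : F) != 0) (Bsym : forall v w, B v w = B w v).
Variable Cl : clifford_algebra B.

Definition pol_vec (j : bool * 'I_n) : W := e j.1 j.2.
Definition pol_dual (j : bool * 'I_n) : W := e (~~ j.1) j.2.

Lemma pol_dualE j k : B (pol_vec j) (pol_dual k) = (j == k)%:R.
Proof.
case: pol j k => BE _ _ _ [b i] [c k]; rewrite BE /= xpair_eqE.
by case: b c => [] [].
Qed.

Lemma pol_basisE v : v = \sum_j B v (pol_dual j) *: pol_vec j.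
Proof.
case: pol => _ vE _ _; rewrite [LHS]vE pair_bigA /=.
by apply: eq_bigr => -[].
Qed.

Lemma card_pol : #|{: bool * 'I_n}| = n.*2.
Proof. by rewrite card_prod card_bool card_ord mul2n. Qed.

Definition pol_fermion (t b : bool) (i : 'I_n) : endo Cl :=
  endo_of (cl_fermion t (e b i)).

Lemma pol_fermion_anticomm t b i s c j :
  pol_fermion t b i * pol_fermion s c j + pol_fermion s c j * pol_fermion t b i =
  [&& t != s, b != c & i == j]%:R.
Proof.
apply: endoP => x; rewrite endo_nat endo_add !endo_mul /= cl_fermion_anticomm//.
by case: pol => -> _ _ _; case: (t != s); rewrite ?scale0r ?scaler_nat.
Qed.

Definition pol_number (b : bool) : endo Cl :=
  \sum_i pol_fermion true b i * pol_fermion false (~~ b) i.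

Lemma pol_partE b v : L b v -> v = \sum_i B v (e (~~ b) i) *: e b i.
Proof.
case: pol => _ vE _ iso Lv; rewrite [LHS]vE (bigD1 b)//= [X in _ + X]big1 ?addr0//.
move=> c cb; rewrite big1// => i _.
have -> : ~~ c = b by case: b c cb {Lv} => [] [].
by rewrite iso// scale0r.
Qed.

Lemma pol_number_wedge b c v x : L c v ->
  pol_number b (cl_fermion true v x) =
  cl_fermion true v (pol_number b x) + (b == c)%:R *: cl_fermion true v x.
Proof.
move=> Lv; case: pol => BE vE Le iso.
have -> : (b == c)%:R *: cl_fermion true v x =
    \sum_i B (e (~~ b) i) v *: cl_fermion true (e b i) x.
  have [bc|bc] := eqVneq b c.
    rewrite scale1r; pose f : {linear W -> Cl} := HB.pack ((@cl_fermion _ _ _ Cl true)^~ x)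
      (GRing.isLinear.Build F W Cl _ _ (cl_fermion_vec_linear true x)).
    rewrite -bc in Lv; rewrite -[LHS]/(f v) [in LHS](pol_partE Lv) linear_sum.
    by apply: eq_bigr => i _; rewrite linearZ Bsym.
  rewrite scale0r big1// => i _; have <- : c = ~~ b by case: b c bc {Lv} => [] [].
  by rewrite Bsym iso ?scale0r.
rewrite !endo_sum /= linear_sum -big_split; apply: eq_bigr => i _ /=.
rewrite (cl_contr_wedge two_neq0) linearB linearZ /= addrC (cl_wedgeC two_neq0).
by rewrite opprK.
Qed.

(** Each creation operator of the species [b] raises the eigenvalue of the number
    operator by one, those of the other species commute with it, and it vanishes
    on [1]. *)
Lemma pol_number_wedges b s t :
  {in s, forall v, L true v} -> {in t, forall v, L false v} ->
  pol_number b (cl_wedges Cl (s ++ t)) =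
  (if b then size s else size t)%:R *: cl_wedges Cl (s ++ t).
Proof.
elim: s => [|v s IH] sL tL.
  elim: t tL => [|v t IH] tL.
    rewrite /= if_same scale0r endo_sum big1// => i _ /=.
    by rewrite cl_fermion1 linear0.
  rewrite cl_wedges_cons (pol_number_wedge _ _ (tL _ (mem_head _ _))) IH; last first.
    by move=> w wt; apply: tL; rewrite inE wt orbT.
  rewrite linearZ /= -scalerDl -natrD; congr (_%:R *: _).
  by case: b {IH}; rewrite /= ?addn0 ?addn1.
rewrite cat_cons cl_wedges_cons (pol_number_wedge _ _ (sL _ (mem_head _ _))) IH//; last first.
  by move=> w ws; apply: sL; rewrite inE ws orbT.
rewrite linearZ /= -scalerDl -natrD; congr (_%:R *: _).
by case: b {IH}; rewrite /= ?addn0 ?addn1.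
Qed.

(** Sort a word without repetition by species: either part has at most [n] letters. *)
Lemma cl_bigraded_ind (P : set Cl) : vsubspace P ->
  (forall s t, (size s <= n)%N -> (size t <= n)%N ->
     {in s, forall v, L true v} -> {in t, forall v, L false v} ->
     P (cl_wedges Cl (s ++ t))) -> forall a, P a.
Proof.
move=> PS Pst; apply: (cl_word_ind two_neq0 pol_basisE PS) => r ur.
pose part b := [seq j <- r | j.1 == b].
have [|k ->] := @cl_word_perm _ _ _ Cl two_neq0 _ pol_vec r (part true ++ part false).
  rewrite -(perm_filterC (fun j => j.1 == true)) perm_sym perm_cat2l.
  by rewrite (eq_filter (a2 := fun j => j.1 == false))// => -[[] ?].
apply: vsubspaceZ => //; rewrite /cl_word map_cat.
have size_part b : (size (map pol_vec (part b)) <= n)%N.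
  rewrite size_map -(size_map snd) -[X in (_ <= X)%N]card_ord -(card_uniqP _) ?max_card//.
  rewrite map_inj_in_uniq ?filter_uniq// => -[c i] [d j].
  by rewrite !mem_filter /= => /andP[/eqP-> _] /andP[/eqP-> _] ->.
have L_part b : {in map pol_vec (part b), forall v, L b v}.
  move=> _ /mapP[[c i] + ->]; rewrite mem_filter /= => /andP[/eqP-> _].
  by case: pol => _ _ + _; apply.
by apply: Pst.
Qed.

End Polarization.

(** * The polarization of a hermitian space and of its dual *)

Section HermitianBases.
Variables (R : realType) (n : nat) (V : hermitian_space R n).
Local Notation VC := (VC V).
Local Notation dualVC := (dualVC V).
Local Notation etaC := (@etaC R n V).
Local Notation JC := (@JC R n V).

Lemma two_neq0C : (2 : R[i]) != 0. Proof. by rewrite pnatr_eq0. Qed.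

Lemma etaP (a : R) (u v w : V) : hs_eta (a *: u + v) w = a * hs_eta u w + hs_eta v w.
Proof. exact: hs_eta_linear. Qed.

Lemma etaCC u w : etaC u w = etaC w u.
Proof.
rewrite /Defs.etaC ![hs_eta w.1 _]hs_eta_sym ![hs_eta w.2 _]hs_eta_sym.
by rewrite [hs_eta u.1 w.2 + _]addrC.
Qed.

Lemma etaC_linear w : linear ((etaC ^~ w) : VC -> R[i]^o).
Proof.
have D (x y z : V) : hs_eta (x + y) z = hs_eta x z + hs_eta y z.
  by rewrite -[x]scale1r etaP mul1r scale1r.
have Z (a : R) (x z : V) : hs_eta (a *: x) z = a * hs_eta x z.
  have eta0 : hs_eta 0 z = 0 by apply: (addrI (hs_eta 0 z)); rewrite -D !addr0.
  by rewrite -[a *: x]addr0 etaP eta0 addr0.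
have N (x z : V) : hs_eta (- x) z = - hs_eta x z by rewrite -scaleN1r Z mulN1r.
move=> [a b] [u1 u2] [v1 v2]; apply/eqP; rewrite eq_complex /= !(D, Z, N).
by apply/andP; split; apply/eqP; ring.
Qed.

Lemma etaC_lin (a : R[i]) u v w : etaC (a *: u + v) w = a * etaC u w + etaC v w.
Proof. exact: etaC_linear. Qed.

Definition etaC_form (w : VC) : {linear VC -> R[i]^o} :=
  HB.pack (etaC ^~ w : VC -> R[i]^o)
    (GRing.isLinear.Build R[i] VC R[i]^o *:%R (etaC ^~ w) (etaC_linear w)).

Lemma etaC_nondeg u : (forall w, etaC u w = 0) -> u = 0.
Proof.
have eta0 (z : V) : hs_eta z 0 = 0.
  have := etaP 1 0 0 z; rewrite scaler0 addr0 mul1r hs_eta_sym => h.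
  by apply: (addrI (hs_eta z 0)); rewrite -h addr0.
case: u => u1 u2 u0; congr pair; apply: hs_eta_nondeg => w;
  have := u0 (w, 0); rewrite /Defs.etaC /= !eta0 subr0 add0r => /eqP;
  by rewrite eq_complex /= => /andP[/eqP ? /eqP ?].
Qed.

(** The isomorphism of the space with its dual given by the form; [sharp] is its
    inverse. *)
Definition flat (u : VC) : dualVC := linfun (etaC_form u).

Lemma flatE u v : flat u v = etaC u v.
Proof. by rewrite lfunE /= etaCC. Qed.

Lemma flat_linear : linear flat.
Proof. by move=> a u v; apply/lfunP => w; rewrite add_lfunE scale_lfunE !flatE etaC_lin. Qed.

Definition flatL : {linear VC -> dualVC} :=
  HB.pack flat (GRing.isLinear.Build R[i] VC dualVC *:%R flat flat_linear).

Lemma flat_surj (l : dualVC) : exists v, l = flat v.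
Proof.
have ker0 : lker (linfun flatL) == 0%VS.
  apply/eqP/vspaceP => u; rewrite memv_ker memv0 lfunE /=; apply/eqP/eqP => [u0|->].
    by apply: etaC_nondeg => w; rewrite -flatE u0 zero_lfunE.
  by apply: (linear0 flatL).
have : l \in limg (linfun flatL).
  suff -> : limg (linfun flatL) = fullv by rewrite memvf.
  apply/eqP; rewrite -(dimv_leqif_eq (subvf _)).
  rewrite limg_dim_eq ?(eqP ker0) ?capv0// !dimvf /=.
  by rewrite /dim /= muln1.
by case/memv_imgP => v _ ->; exists v; rewrite lfunE.
Qed.

Lemma flat_sharp l : flat (sharp l) = l.
Proof.
apply/lfunP => w; rewrite flatE; have [v lE] := flat_surj l.
by rewrite (xgetPex 0 (P := [set v | forall w, etaC v w = l w]))//; exists v => u;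
  rewrite lE flatE.
Qed.

Lemma sharpE l w : etaC (sharp l) w = l w.
Proof. by rewrite -flatE flat_sharp. Qed.

Lemma sharp_flat u : sharp (flat u) = u.
Proof.
apply/eqP; rewrite -subr_eq0; apply/eqP/etaC_nondeg => w.
by rewrite -[_ - _]addrC -scaleN1r etaC_lin sharpE flatE mulN1r addNr.
Qed.

Lemma etaC_invC (l k : dualVC) : etaC_inv l k = etaC_inv k l.
Proof. exact: etaCC. Qed.

(** The eigenvalue of [J] on [holo b]. *)
Definition Jval (b : bool) : R[i] := 0 +i* (if b then 1 else -1).

Lemma Jval_sq b : Jval b * Jval b = -1.
Proof.
by apply/eqP; rewrite eq_complex /=; case: b; apply/andP; split; apply/eqP => /=; ring.
Qed.

Lemma JvalN b : Jval (~~ b) = - Jval b.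
Proof.
by apply/eqP; rewrite eq_complex /=; case: b; apply/andP; split; apply/eqP => /=; ring.
Qed.

Lemma JC_linear : linear (JC : VC -> VC).
Proof.
move=> [a b] [u1 u2] [v1 v2]; congr pair; rewrite /= !linearD /=.
  by rewrite linearN !linearZ.
by rewrite !linearZ.
Qed.

Lemma JCJC u : JC (JC u) = - u.
Proof. by case: u => u v; rewrite /Defs.JC /= !hs_JJ. Qed.

Lemma etaC_JC u v : etaC (JC u) (JC v) = etaC u v.
Proof. by rewrite /Defs.etaC /= !hs_eta_J. Qed.

Definition JC_map : {linear VC -> VC} :=
  HB.pack (JC : VC -> VC) (GRing.isLinear.Build R[i] VC VC *:%R JC JC_linear).

Definition holo_proj (b : bool) (u : VC) : VC := 2^-1 *: (u - Jval b *: JC u).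

Lemma holo_proj_linear b : linear (holo_proj b).
Proof. exact: (linearP (2^-1 \*: (idfun \- Jval b \*: JC_map))). Qed.

HB.instance Definition _ b :=
  GRing.isLinear.Build R[i] VC VC *:%R (holo_proj b) (holo_proj_linear b).

Lemma holo_proj_holo b u : holo b (holo_proj b u).
Proof.
have JZ a x : JC (a *: x) = a *: JC x by exact: (linearZ_LR JC_map).
have JB x y : JC (x - y) = JC x - JC y by exact: (linearB JC_map).
rewrite /holo /= -/(Jval b) /holo_proj JZ JB JZ JCJC scalerN opprK scalerA [Jval b / 2]mulrC
  -scalerA; congr (_ *: _).
by rewrite scalerBr scalerA Jval_sq scaleN1r opprK addrC.
Qed.

Lemma holo_proj_sum u : u = \sum_b holo_proj b u.
Proof.
rewrite big_bool /= !/holo_proj -scalerDr (JvalN true) scaleNr opprK addrACA addNr addr0.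
by rewrite -mulr2n -(scaler_nat 2 u) scalerA mulVf ?two_neq0C ?scale1r.
Qed.

Lemma holo_projP b c u : holo c u -> holo_proj b u = if b == c then u else 0.
Proof.
rewrite /holo /= -/(Jval c) /holo_proj => ->; rewrite scalerA.
have [->|bc] := eqVneq b c.
  rewrite Jval_sq scaleN1r opprK -mulr2n -(scaler_nat 2 u) scalerA mulVf ?two_neq0C//.
  by rewrite scale1r.
have -> : b = ~~ c by case: b c bc => [] [].
by rewrite JvalN mulNr Jval_sq opprK scale1r subrr scaler0.
Qed.

Lemma holo_component u b : component (@holo R n V) u b = holo_proj b u.
Proof.
apply: componentE => [c||i c v]; last exact: holo_projP.
- exact: holo_proj_holo.
- exact: holo_proj_sum.
Qed.

(** [J] is an isometry that acts on the product by the square of its eigenvalue, [-1]. *)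
Lemma holo_isotropic b u v : holo b u -> holo b v -> etaC u v = 0.
Proof.
rewrite /holo /= -/(Jval b) => uE vE.
have scaleC a x y : etaC (a *: x) y = a * etaC x y.
  exact: (linearZ_LR (etaC_form y)).
have /eqP : etaC u v = - etaC u v.
  by rewrite -{1}etaC_JC uE vE scaleC etaCC scaleC mulrA Jval_sq mulN1r etaCC.
by rewrite -addr_eq0 -mulr2n -mulr_natl mulf_eq0 (negPf two_neq0C) => /eqP.
Qed.

(** Take a basis of one eigenspace of [J], extend its coordinate functions by zero to the
    other eigenspace, and represent them by vectors; by isotropy these lie in the other
    eigenspace. *)
Lemma polarization_dim_ex : exists m (e : bool -> 'I_m -> VC),
  polarization etaC e (@holo R n V).
Proof.
pose U := lker (linfun (holo_proj false)).
have UP u : reflect (holo true u) (u \in U).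
  rewrite memv_ker lfunE /=; apply: (iffP eqP) => [u0|/holo_projP->//].
  by rewrite (holo_proj_sum u) big_bool /= u0 addr0; apply: holo_proj_holo.
pose a i := (vbasis U)`_i.
have aU i : (i < \dim U)%N -> holo true (a i).
  by move=> im; apply/UP/vbasis_mem/mem_nth; rewrite size_tuple.
pose l (i : 'I_(\dim U)) : dualVC :=
  linfun ((coord (vbasis U) i : {linear VC -> R[i]^o}) \o holo_proj true).
have lE i v : l i v = coord (vbasis U) i (holo_proj true v) by rewrite lfunE.
pose e (b : bool) (i : 'I_(\dim U)) : VC := if b then a i else sharp (l i).
have etaDl x y z : etaC (x + y) z = etaC x z + etaC y z.
  exact: (linearD (etaC_form z)).
have fF i : holo false (sharp (l i)).
  suff h : holo_proj true (sharp (l i)) = 0.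
    by rewrite (holo_proj_sum (sharp _)) big_bool /= h add0r; apply: holo_proj_holo.
  apply: etaC_nondeg => w; rewrite (holo_proj_sum w) big_bool /= etaCC etaDl.
  rewrite [X in X + _](holo_isotropic (holo_proj_holo _ _) (holo_proj_holo _ _)) add0r.
  have -> : etaC (holo_proj false w) (holo_proj true (sharp (l i))) =
      etaC (sharp (l i)) (holo_proj false w).
    rewrite [in RHS](holo_proj_sum (sharp (l i))) big_bool /= etaDl etaCC.
    by rewrite [X in _ = _ + X](holo_isotropic (holo_proj_holo _ _) (holo_proj_holo _ _)) addr0.
  by rewrite sharpE lE (holo_projP _ (holo_proj_holo _ _)) linear0.
have eL b i : holo b (e b i) by case: b => /=; [apply: aU|apply: fF].
have fa i (j : 'I_(\dim U)) : etaC (sharp (l i)) (a j) = (i == j)%:R.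
  by rewrite sharpE lE (holo_projP _ (aU _ (ltn_ord _))) eqxx coord_free ?(basis_free (vbasisP
    U))// eq_sym.
have eE b i c j : etaC (e b i) (e c j) = ((b != c) && (i == j))%:R.
  case: b c => [] [] /=; rewrite ?(holo_isotropic (eL true _) (eL true _))//.
  - by rewrite etaCC fa eq_sym.
  - by rewrite (holo_isotropic (fF _) (fF _)).
have partE v : holo true v -> v = \sum_i etaC v (e false i) *: e true i.
  move=> tv; rewrite [LHS](coord_vbasis (introT (UP _) tv)).
  by apply: eq_bigr => i _; rewrite etaCC sharpE lE (holo_projP _ tv).
have etaC_suml (c : 'I_(\dim U) -> R[i]) (g : 'I_(\dim U) -> VC) w :
    etaC (\sum_i c i *: g i) w = \sum_i c i * etaC (g i) w.
  rewrite -[LHS]/(etaC_form w _) linear_sum; apply: eq_bigr => i _.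
  exact: (linearZ_LR (etaC_form w)).
have partF v : holo false v -> v = \sum_i etaC v (e true i) *: e false i.
  move=> fv; apply/eqP; rewrite -subr_eq0; apply/eqP; set w := v - _.
  have wa k : etaC w (e true k) = 0.
    rewrite /w -scaleN1r addrC etaC_lin etaC_suml (bigD1 k)//= big1 => [|i /negPf ik].
      by rewrite fa eqxx mulr1 addr0 mulN1r addNr.
    by rewrite fa ik mulr0.
  have fw : holo false w.
    suff <- : holo_proj false w = w by apply: holo_proj_holo.
    rewrite /w linearB linear_sum /= (holo_projP _ fv) /=; congr (_ - _).
    by apply: eq_bigr => i _; rewrite linearZ /= (holo_projP _ (fF i)).
  apply: etaC_nondeg => u; rewrite (holo_proj_sum u) big_bool /= etaCC etaDl.
  rewrite [X in _ + X](holo_isotropic (holo_proj_holo _ _) fw) addr0.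
  rewrite (partE _ (holo_proj_holo true u)) etaC_suml big1// => i _.
  by rewrite [etaC _ w]etaCC wa mulr0.
exists (\dim U), e; split=> // [v|b v i bv]; last exact: (holo_isotropic bv (eL b i)).
have etaP b i : etaC v (e (~~ b) i) = etaC (holo_proj b v) (e (~~ b) i).
  rewrite [in LHS](holo_proj_sum v) (bigD1 b)//= etaDl [X in _ + X](_ : _ = 0) ?addr0//.
  rewrite (big_pred1 (~~ b)) => [|c]; last by case: b c => [] [].
  by rewrite (holo_isotropic (holo_proj_holo _ _) (eL _ _)).
rewrite [LHS]holo_proj_sum !big_bool /=; congr (_ + _).
  rewrite [LHS](partE _ (holo_proj_holo _ _)).
  by apply: eq_bigr => i _; rewrite (etaP true).
rewrite [LHS](partF _ (holo_proj_holo _ _)).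
by apply: eq_bigr => i _; rewrite (etaP false).
Qed.

(** Families in duality that reproduce all vectors are bases, so that their size is the
    dimension; this is what makes both eigenspaces [n]-dimensional. *)
Lemma card_dual_bases (J : finType) (g g' : J -> VC) :
  (forall j k, etaC (g j) (g' k) = (j == k)%:R) ->
  (forall v, v = \sum_j etaC v (g' j) *: g j) -> #|J| = n.*2.
Proof.
move=> gE vE; pose X := [tuple g (enum_val i) | i < #|J|].
have Xi (i : 'I_#|J|) : X`_i = g (enum_val i) by rewrite -tnth_nth tnth_mktuple.
have Xfree : free X.
  apply/freeP => k k0 i; have := congr1 (etaC_form (g' (enum_val i))) k0.
  have etaZ c x w : etaC (c *: x) w = c * etaC x w by exact: (linearZ_LR (etaC_form w)).
  rewrite linear0 linear_sum (bigD1 i)//= etaZ Xi gE eqxx mulr1 big1 ?addr0// => j ji.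
  by rewrite etaZ Xi gE (inj_eq enum_val_inj) (negPf ji) mulr0.
have Xfull : <<X>>%VS = fullv.
  apply/eqP; rewrite eqEsubv subvf /=; apply/subvP => v _; rewrite (vE v).
  apply: memv_suml => j _; apply: memvZ; apply: memv_span.
  by rewrite -(enum_rankK j) -Xi mem_nth ?size_tuple.
have := Xfree; rewrite /free Xfull size_tuple dimvf => /eqP <-.
by rewrite -(hs_dim V) dimvf.
Qed.

Lemma polarization_ex : exists e : bool -> 'I_n -> VC,
  polarization etaC e (@holo R n V).
Proof.
have [m [e pol]] := polarization_dim_ex.
have /eqP := card_dual_bases (pol_dualE pol) (pol_basisE pol).
rewrite card_pol -!mul2n eqn_pmul2l => [|//] /eqP mn; move: e pol; rewrite mn => e pol.
by exists e.
Qed.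

Lemma dual_polarization (e : bool -> 'I_n -> VC) :
  polarization etaC e (@holo R n V) ->
  polarization (@etaC_inv R n V) (fun b i => flat (e (~~ b) i)) (@dual_holo R n V).
Proof.
case=> eE vE eL iso; split=> [b i c j|l|b i v|b l i lL].
- by rewrite /etaC_inv !sharp_flat eE; case: b c => [] [].
- apply/lfunP => v; rewrite sum_lfunE (vE v) linear_sum; apply: eq_bigr => b _.
  rewrite linear_sum sum_lfunE -vE; apply: eq_bigr => i _.
  by rewrite linearZ scale_lfunE /etaC_inv sharp_flat sharpE negbK flatE /= [RHS]mulrC etaCC.
- by move=> vL; rewrite flatE etaCC; apply: iso.
- by rewrite /etaC_inv sharp_flat sharpE; apply: lL; apply: eL.
Qed.

End HermitianBases.

(** * The exterior algebra in coordinates *)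

Section SortedWords.
Variables (K : pzRingType) (X : lmodType K) (d : nat) (W : 'I_d -> endo X) (x0 : X).
Hypothesis WW : forall i j x, W i (W j x) = - W j (W i x).
Hypothesis W_sq : forall i x, W i (W i x) = 0.

Definition sorted_word (r : seq 'I_d) : X := foldr (fun i x => W i x) x0 r.

Definition count_below (i : 'I_d) (S : {set 'I_d}) : nat := (\sum_(j in S) (j < i))%N.

Lemma word_insert i r r' :
  W i (sorted_word (r ++ r')) = (-1) ^+ size r *: sorted_word (r ++ i :: r').
Proof.
elim: r => [|j r IH]; first by rewrite expr0 scale1r.
by rewrite /= WW IH linearZ /= exprS mulN1r scaleNr.
Qed.

Lemma word_dup i r : i \in r -> W i (sorted_word r) = 0.
Proof.
move=> ir; case/splitPr: ir => r1 r2; elim: r1 => [|j r1 IH] /=; first exact: W_sq.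
by rewrite WW IH linear0 oppr0.
Qed.

(** To put [i] in its place one has to move it past the elements of [S] below it. *)
Lemma word_enum_insert i (S : {set 'I_d}) : W i (sorted_word (enum S)) =
  if i \in S then 0 else (-1) ^+ count_below i S *: sorted_word (enum (i |: S)%SET).
Proof.
have [iS|iS] := boolP (i \in S); first by rewrite word_dup// mem_enum.
have : i \in enum 'I_d by rewrite mem_enum.
have := enum_uniq 'I_d; have : pairwise (fun j k : 'I_d => (j < k)%N) (enum 'I_d).
  have : pairwise ltn (map val (enum 'I_d)).
    by rewrite val_enum_ord -sorted_pairwise ?iota_ltn_sorted//; apply: ltn_trans.
  by rewrite pairwise_map.
have enumE (T : {set 'I_d}) : enum T = [seq j <- enum 'I_d | j \in T] by rewrite enumT.
move=> + + idx; rewrite /count_below -big_enum /= !enumE big_filter.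
case/splitPr: idx => r1 r2.
rewrite pairwise_cat => /and3P[/allrelP r12 _ /= /andP[/allP ir2 _]].
rewrite cat_uniq /= => /and3P[_ /norP[ir1 _] /andP[ir2' _]].
rewrite !filter_cat /= (negPf iS) !inE eqxx.
have eq_ins r : i \notin r -> [seq j <- r | j \in (i |: S)%SET] = [seq j <- r | j \in S].
  move=> ir; apply: eq_in_filter => j jr; rewrite !inE.
  by case: eqP => [ji|//]; rewrite -ji jr in ir.
rewrite !eq_ins// word_insert; congr (_ ^+ _ *: _).
rewrite big_cat /= big_cons (negPf iS) [X in (_ + X)%N]big1_seq ?addn0; last first.
  by move=> j /andP[_ /ir2]; case: ltngtP.
rewrite size_filter -sum1_count big_mkcond [RHS]big_mkcond /=.
apply: eq_big_seq => j jr1; case: ifP => // _.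
by rewrite (r12 _ _ jr1 (mem_head _ _)).
Qed.

End SortedWords.
Arguments count_below {d}.

Section ExteriorOperators.
Variables (K : fieldType) (A : lmodType K) (d : nat).
Local Notation ext := (ext d A).
Implicit Types (S T : {set 'I_d}) (i j : 'I_d) (x y : ext).

(** Exterior multiplication by [dx^i], and contraction with the vector [d/dx^i]. *)
Definition dx_wedge i x : ext :=
  [ffun S : {set 'I_d} => if i \in S then (-1) ^+ count_below i S *: x (S :\ i)%SET else 0].
Definition dx_contr i x : ext :=
  [ffun S : {set 'I_d} => if i \in S then 0 else (-1) ^+ count_below i S *: x (i |: S)%SET].

Lemma dx_wedge_linear i : linear (dx_wedge i).
Proof.
move=> a x y; apply/ffunP => S; rewrite !ffunE; case: ifP => _.
  by rewrite scalerDr !scalerA mulrC.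
by rewrite scaler0 addr0.
Qed.

Lemma dx_contr_linear i : linear (dx_contr i).
Proof.
move=> a x y; apply/ffunP => S; rewrite !ffunE; case: ifP => _.
  by rewrite scaler0 addr0.
by rewrite scalerDr !scalerA mulrC.
Qed.

HB.instance Definition _ i :=
  GRing.isLinear.Build K ext ext *:%R (dx_wedge i) (dx_wedge_linear i).
HB.instance Definition _ i :=
  GRing.isLinear.Build K ext ext *:%R (dx_contr i) (dx_contr_linear i).

Lemma count_belowD1 i j S : j \in S ->
  count_below i S = ((j < i) + count_below i (S :\ j)%SET)%N.
Proof.
move=> jS; rewrite /count_below (bigD1 j)//=; congr (_ + _)%N.
by apply: eq_bigl => k; rewrite !inE andbC.
Qed.

Lemma count_belowU1 i j S : j \notin S ->
  count_below i (j |: S)%SET = ((j < i) + count_below i S)%N.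
Proof. by move=> jS; rewrite (@count_belowD1 i j) ?setU11// finset.setU1K. Qed.

Lemma dx_wedge_sq i x : dx_wedge i (dx_wedge i x) = 0.
Proof.
by apply/ffunP => S; rewrite !ffunE !inE eqxx /= scaler0 if_same.
Qed.

Lemma dx_wedgeC i j x : dx_wedge i (dx_wedge j x) = - dx_wedge j (dx_wedge i x).
Proof.
have [->|ij] := eqVneq i j; first by rewrite dx_wedge_sq oppr0.
apply/ffunP => S; rewrite !ffunE !inE ij eq_sym ij /=.
case iS: (i \in S); case jS: (j \in S); rewrite ?scaler0 ?oppr0//.
have -> : (S :\ i :\ j)%SET = (S :\ j :\ i)%SET.
  by apply/finset.setP => k; rewrite !inE andbCA.
rewrite (count_belowD1 i jS) (count_belowD1 j iS) !exprD !scalerA -scaleNr.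
congr (_ *: _); rewrite -!mulrA [X in _ = - (_ * X)]mulrC.
by case: ltngtP ij => [||/val_inj->]; rewrite ?eqxx//= expr0 expr1 ?mul1r ?mulN1r ?opprK.
Qed.

Lemma dx_contr_wedge i j x : dx_contr j (dx_wedge i x) =
  (i == j)%:R *: x - dx_wedge i (dx_contr j x).
Proof.
apply/ffunP => S; rewrite !ffunE !inE.
have [->|ij] := eqVneq i j.
  rewrite scale1r; case: ifP => jS /=.
    rewrite scalerA -exprD (@count_belowD1 j j S)// ltnn add0n.
    by rewrite addnn -mul2n exprM sqrrN !expr1n scale1r finset.setD1K// subrr.
  rewrite finset.setU1K ?jS// subr0 (@count_belowU1 j j S) ?jS// ltnn add0n.
  by rewrite scalerA -exprD addnn -mul2n exprM sqrrN !expr1n scale1r.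
rewrite /= scale0r sub0r.
have iUj : ((j |: S) :\ i = j |: (S :\ i))%SET.
  by apply/finset.setP => k; rewrite !inE; case: eqVneq => // ->; rewrite (negPf ij).
case jS: (j \in S); case iS: (i \in S); rewrite /= ?scaler0 ?oppr0//.
rewrite iUj count_belowU1 ?jS// (@count_belowD1 j i S)// !exprD !scalerA -scaleNr.
congr (_ *: _); set p := _ ^+ count_below _ _; set q := _ ^+ count_below _ _.
by case: ltngtP ij => [||/val_inj->]; rewrite ?eqxx//= => _ _; rewrite expr0 expr1; ring.
Qed.

End ExteriorOperators.

Section ExteriorTensors.
Variables (K : fieldType) (A : lmodType K) (d : nat).
Local Notation ext := (ext d A).
Local Notation scal := {ffun {set 'I_d} -> K^o}.
Implicit Types (S T : {set 'I_d}).

Definition dx (S : {set 'I_d}) : scal := [ffun T : {set 'I_d} => (T == S)%:R].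

Definition ext_tens (w : scal) (a : A) : ext := [ffun S : {set 'I_d} => w S *: a].

Lemma ext_tens_linearl a : linear (ext_tens^~ a).
Proof.
by move=> k w z; apply/ffunP => S; rewrite !ffunE scalerDl scalerA.
Qed.

Lemma ext_tens_linearr w : linear (ext_tens w).
Proof.
by move=> k a b; apply/ffunP => S; rewrite !ffunE scalerDr !scalerA mulrC.
Qed.

HB.instance Definition _ w :=
  GRing.isLinear.Build K A ext *:%R (ext_tens w) (ext_tens_linearr w).

Lemma ext_tens_suml a (I : Type) (r : seq I) (P : pred I) (c : I -> K) (w : I -> scal) :
  ext_tens (\sum_(i <- r | P i) c i *: w i) a =
  \sum_(i <- r | P i) c i *: ext_tens (w i) a.
Proof.
apply/ffunP => S; rewrite !ffunE !sum_ffunE scaler_suml; apply: eq_bigr => i _.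
by rewrite !ffunE scalerA.
Qed.

Lemma scal_sum (w : scal) : w = \sum_S w S *: dx S.
Proof.
apply/ffunP => S; rewrite sum_ffunE (bigD1 S)//= !ffunE eqxx big1 ?addr0 => [|T TS].
  by rewrite /GRing.scale /= mulr1.
by rewrite !ffunE eq_sym (negPf TS) scaler0.
Qed.

Lemma ext_sum (x : ext) : x = \sum_S ext_tens (dx S) (x S).
Proof.
apply/ffunP => S; rewrite sum_ffunE (bigD1 S)//= !ffunE eqxx scale1r big1 ?addr0// => T TS.
by rewrite !ffunE eq_sym (negPf TS) scale0r.
Qed.

Lemma ext_tens_ind (P : set ext) : vsubspace P ->
  (forall w a, P (ext_tens w a)) -> forall x, P x.
Proof. by move=> PS Pt x; rewrite (ext_sum x); apply: vsubspace_sum. Qed.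

Lemma dx_wedge_tens i w a : dx_wedge i (ext_tens w a) = ext_tens (dx_wedge i w) a.
Proof.
apply/ffunP => S; rewrite !ffunE; case: ifP => _; last by rewrite scale0r.
by rewrite scalerA.
Qed.

Lemma dx_contr_tens i w a : dx_contr i (ext_tens w a) = ext_tens (dx_contr i w) a.
Proof.
apply/ffunP => S; rewrite !ffunE; case: ifP => _; first by rewrite scale0r.
by rewrite scalerA.
Qed.

Lemma dx0 : dx finset.set0 = ext_one d K.
Proof. by []. Qed.

Lemma dx_setU1 i S : i \notin S ->
  dx (i |: S)%SET = (-1) ^+ count_below i S *: dx_wedge i (dx S).
Proof.
move=> iS; apply/ffunP => T; rewrite !ffunE; have [->|TiS] := eqVneq T (i |: S)%SET.
  rewrite !inE eqxx /= finset.setU1K// eqxx count_belowU1// ltnn add0n.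
  rewrite /GRing.scale /= mulr1 -exprD addnn -mul2n exprM sqrrN !expr1n//.
case: ifP => iT; last by rewrite scaler0.
have /negPf-> : (T :\ i)%SET != S.
  by apply: contra TiS => /eqP <-; rewrite finset.setD1K.
by rewrite !scaler0.
Qed.

(** The exterior algebra is generated from its unit by the [dx^i]. *)
Lemma ext_ind (P : set ext) : vsubspace P ->
  (forall a, P (ext_tens (ext_one d K) a)) ->
  (forall i x, P x -> P (dx_wedge i x)) -> forall x, P x.
Proof.
move=> PS P1 Pw x; rewrite (ext_sum x); apply: vsubspace_sum => // S _; move: (x S) => a.
have [k] := ubnP #|S|; elim: k S => // k IH S Sk.
have [->|[i iS]] := set_0Vmem S; first by rewrite dx0.
rewrite -(finset.setD1K iS) dx_setU1 ?setD11//.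
rewrite -[_ *: _]addr0 -[ext_tens _ _](_ : (-1) ^+ count_below i (S :\ i)%SET *:
  dx_wedge i (ext_tens (dx (S :\ i)%SET) a) = _); last first.
  by rewrite addr0 dx_wedge_tens; apply/ffunP => T; rewrite !ffunE scalerA.
apply: vsubspaceZ => //; apply: Pw; apply: IH.
by move: Sk; rewrite (cardsD1 i) iS.
Qed.

Definition form_wedge (c : 'I_d -> K) : endo ext :=
  \sum_i endo_of (c i \*: dx_wedge i).
Definition form_contr (u : 'I_d -> K) : endo ext :=
  \sum_i endo_of (u i \*: dx_contr i).

Lemma form_wedgeE c x : form_wedge c x = \sum_i c i *: dx_wedge i x.
Proof. by rewrite endo_sum. Qed.
Lemma form_contrE u x : form_contr u x = \sum_i u i *: dx_contr i x.
Proof. by rewrite endo_sum. Qed.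

Lemma form_wedgeC c c' x : form_wedge c (form_wedge c' x) = - form_wedge c' (form_wedge c x).
Proof.
rewrite !form_wedgeE -sumrN; under eq_bigr => i _ do rewrite linear_sum scaler_sumr.
rewrite exchange_big; apply: eq_bigr => i _ /=.
rewrite linear_sum scaler_sumr -sumrN; apply: eq_bigr => j _ /=.
by rewrite !linearZ /= dx_wedgeC !scalerN !scalerA mulrC.
Qed.

Lemma form_contr_wedge u i x : form_contr u (dx_wedge i x) =
  u i *: x - dx_wedge i (form_contr u x).
Proof.
rewrite !form_contrE linear_sum; under eq_bigr => j _ do rewrite dx_contr_wedge scalerBr.
rewrite sumrB (bigD1 i)//= eqxx scale1r big1 ?addr0 => [|j /negPf ji]; last first.
  by rewrite eq_sym ji scale0r scaler0.
by congr (_ - _); apply: eq_bigr => j _; rewrite linearZ.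
Qed.

Lemma form_contr_wedge_form u c x : form_contr u (form_wedge c x) =
  (\sum_i u i * c i) *: x - form_wedge c (form_contr u x).
Proof.
rewrite !form_wedgeE linear_sum scaler_suml -sumrB; apply: eq_bigr => i _.
by rewrite linearZ /= form_contr_wedge scalerBr scalerA mulrC.
Qed.

Lemma form_contr1 u a : form_contr u (ext_tens (ext_one d K) a) = 0.
Proof.
rewrite form_contrE big1// => i _; rewrite dx_contr_tens.
have -> : dx_contr i (ext_one d K : scal) = 0.
  apply/ffunP => S; rewrite !ffunE; case: ifP => // iS.
  have /negPf-> : (i |: S)%SET != finset.set0 by apply/set0Pn; exists i; rewrite setU11.
  by rewrite scaler0.
by apply/ffunP => S; rewrite !ffunE scale0r scaler0.
Qed.

(** The operators [f (x) 1] and [1 (x) g] on the tensor product. *)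
Definition lift_left_fun (f : endo A) (x : ext) : ext := [ffun S : {set 'I_d} => f (x S)].

Lemma lift_left_linear f : linear (lift_left_fun f).
Proof. by move=> k x y; apply/ffunP => S; rewrite !ffunE linearP. Qed.

Definition lift_left f : endo ext := Endo (lift_left_linear f).

Definition lift_right_fun (g : scal -> scal) (x : ext) : ext :=
  [ffun S : {set 'I_d} => \sum_T g (dx T) S *: x T].

Lemma lift_right_linear g : linear (lift_right_fun g).
Proof.
move=> k x y; apply/ffunP => S; rewrite !ffunE scaler_sumr -big_split.
by apply: eq_bigr => T _; rewrite !ffunE scalerDr !scalerA mulrC.
Qed.

Definition lift_right g : endo ext := Endo (lift_right_linear g).

Lemma lift_left_tens f w a : lift_left f (ext_tens w a) = ext_tens w (f a).
Proof. by apply/ffunP => S; rewrite !ffunE linearZ. Qed.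

Lemma lift_right_tens (g : endo scal) w a : lift_right g (ext_tens w a) = ext_tens (g w) a.
Proof.
apply/ffunP => S; rewrite !ffunE [in RHS](scal_sum w) linear_sum sum_ffunE scaler_suml.
by apply: eq_bigr => T _; rewrite linearZ !ffunE scalerA mulrC.
Qed.

Lemma endo_tens_eq (f g : endo ext) :
  (forall w a, f (ext_tens w a) = g (ext_tens w a)) -> f = g.
Proof.
move=> fg; apply: endoP; apply: ext_tens_ind => //; exact: linear_eq_vsubspace.
Qed.

Lemma lift_leftM f g : lift_left (f * g) = lift_left f * lift_left g.
Proof. by apply: endo_tens_eq => w a; rewrite endo_mul !lift_left_tens. Qed.

Lemma lift_leftD f g : lift_left (f + g) = lift_left f + lift_left g.
Proof. by apply: endo_tens_eq => w a; rewrite endo_add !lift_left_tens linearD. Qed.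

Lemma lift_left1 : lift_left 1 = 1.
Proof. by apply: endo_tens_eq => w a; rewrite !lift_left_tens. Qed.

Lemma lift_rightM (f g : endo scal) :
  lift_right (f * g) = lift_right f * lift_right g.
Proof. by apply: endo_tens_eq => w a; rewrite endo_mul !lift_right_tens. Qed.

Lemma lift_rightD (f g : endo scal) :
  lift_right (f + g) = lift_right f + lift_right g.
Proof.
apply: endo_tens_eq => w a; rewrite endo_add !lift_right_tens endo_add.
by have := ext_tens_linearl a 1 (f w) (g w); rewrite !scale1r.
Qed.

Lemma lift_right1 : lift_right (1 : endo scal) = 1.
Proof. by apply: endo_tens_eq => w a; rewrite !lift_right_tens. Qed.

Lemma lift_comm f (g : endo scal) : lift_left f * lift_right g = lift_right g * lift_left f.
Proof.
by apply: endo_tens_eq => w a; rewrite !endo_mul !(lift_left_tens, lift_right_tens).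
Qed.

Lemma form_wedge_sq c x : (2 : K) != 0 -> form_wedge c (form_wedge c x) = 0.
Proof.
move=> two_neq0; have /eqP := form_wedgeC c c x.
by rewrite -addr_eq0 -mulr2n -(scaler_nat 2) scaler_eq0 (negPf two_neq0) => /eqP.
Qed.

End ExteriorTensors.
Arguments form_wedge {K A d} c.
Arguments form_contr {K A d} u.
Arguments lift_left {K A d} f.
Arguments lift_right {K A d} g.
Arguments dx {K d} S.

Section ExteriorProduct.
Variables (K : fieldType) (A : algType K) (d : nat).
Implicit Types (S T : {set 'I_d}) (x : ext d A) (c : 'I_d -> A).

Lemma signr_scale (k : nat) (a : A) : (-1) ^+ k * a = (-1 : K) ^+ k *: a.
Proof. by rewrite -signr_odd mulr_sign -[in RHS]signr_odd scaler_sign. Qed.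

Lemma one_formE c S : one_form c S = \sum_(i | S == [set i]%SET) c i.
Proof. by rewrite ffunE. Qed.

Lemma inversions1 i S : inversions [set i]%SET S = count_below i S.
Proof. by rewrite /inversions big_set1. Qed.

Lemma ext_mul_one_form c x :
  ext_mul (one_form c) x = \sum_i [ffun S : {set 'I_d} => c i * dx_wedge i x S].
Proof.
apply/ffunP => S; rewrite !ffunE sum_ffunE.
under eq_bigr => T _ do rewrite one_formE mulr_suml mulr_sumr.
rewrite (exchange_big_dep predT)//=; apply: eq_bigr => i _.
rewrite !ffunE; case: ifP => iS; last first.
  by rewrite mulr0 big1// => T /andP[TS /eqP TE]; rewrite TE finset.sub1set iS in TS.
rewrite (big_pred1 [set i]%SET) => [|T]; last first.
  by rewrite /= eq_sym andbC; case: eqP => // <-; rewrite finset.sub1set iS.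
by rewrite inversions1 signr_scale (count_belowD1 i iS) ltnn scalerAr.
Qed.

(** Moving the one-form from the right to the left of a [q]-form costs [(-1) ^ q]. *)
Lemma ext_mul_one_formr c x (q : nat) : (forall S, #|S| != q -> x S = 0) ->
  ext_mul x (one_form c) =
  (-1) ^+ q *: \sum_i [ffun S : {set 'I_d} => dx_wedge i x S * c i].
Proof.
move=> xq; apply/ffunP => S; rewrite !ffunE sum_ffunE scaler_sumr.
under eq_bigr => T _ do rewrite one_formE mulr_sumr mulr_sumr.
rewrite (exchange_big_dep predT)//=; apply: eq_bigr => i _.
rewrite !ffunE; case: ifP => iS; last first.
  rewrite mul0r scaler0 big1// => T /andP[TS /eqP TE].
  by have := set11 i; rewrite -TE inE iS andbF.
rewrite (big_pred1 (S :\ i)%SET) => [|T]; last first.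
  rewrite /=; apply/andP/eqP => [[TS /eqP TE]|->]; first by rewrite -TE finset.setDDr
    finset.setDv finset.set0U (finset.setIidPr TS).
  by split; rewrite ?subD1set// finset.setDDr finset.setDv finset.set0U;
    apply/eqP/finset.setIidPr; rewrite finset.sub1set.
rewrite finset.setDDr finset.setDv finset.set0U (finset.setIidPr _) ?finset.sub1set//.
have [Sq|/xq->] := eqVneq #|S :\ i|%SET q; last by rewrite !(mul0r, mulr0, scaler0).
rewrite signr_scale -scalerAl scalerA; congr (_ *: _).
rewrite (count_belowD1 i iS) ltnn add0n -Sq.
have <- : (count_below i (S :\ i) + inversions (S :\ i) [set i])%N = #|S :\ i|.
  rewrite /inversions /count_below -big_split -sum1_card; apply: eq_bigr => j jS /=.
  rewrite big_set1; case: ltngtP => // /val_inj ij.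
  by rewrite ij !inE eqxx in jS.
by rewrite exprD mulrAC -exprD addnn -mul2n exprM sqrrN !expr1n mul1r.
Qed.

End ExteriorProduct.

Section Pullback.
Variables (R : rcfType) (d : nat) (J : 'M[R]_d).

Lemma ext_mul_scal (K : fieldType) (c : 'I_d -> K) (y : ext d K) :
  ext_mul (one_form c) y = form_wedge c (y : {ffun {set 'I_d} -> K^o}).
Proof.
rewrite (@ext_mul_one_form K K^o) form_wedgeE; apply: eq_bigr => i _.
by apply/ffunP => S; rewrite !ffunE.
Qed.

Let wd (j : 'I_d) : endo {ffun {set 'I_d} -> R^o} := form_wedge (fun i => J i j).

Lemma ext_pull_basisE S : ext_pull_basis J S = sorted_word wd (ext_one d R) (enum S).
Proof.
rewrite /ext_pull_basis; elim: (enum S) => //= j r IH.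
by rewrite /wedges /= -/(wedges _) IH ext_mul_scal.
Qed.

Variable (A : lmodType R[i]).
Implicit Types x : ext d A.

Lemma ext_pull_linear : linear (@ext_pull R A d J).
Proof.
move=> k x y; apply/ffunP => T; rewrite !ffunE scaler_sumr -big_split.
by apply: eq_bigr => S _; rewrite !ffunE scalerDr !scalerA mulrC.
Qed.

(** Pullback is multiplicative: both sides create the pullback of [dx^j] in front of the
    pulled back monomials, up to sorting. *)
Lemma ext_pull_wedge j x :
  ext_pull J (dx_wedge j x) = form_wedge (fun i => (J i j)%:C) (ext_pull J x).
Proof.
have wedgeG S : wd j (ext_pull_basis J S) = if j \in S then 0 else
    (-1) ^+ count_below j S *: (ext_pull_basis J (j |: S)%SET : {ffun {set 'I_d} -> R^o}).
  rewrite !ext_pull_basisE word_enum_insert// => [i k y|i y]; first exact: form_wedgeC.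
  by apply: form_wedge_sq; rewrite pnatr_eq0.
rewrite form_wedgeE; apply/ffunP => T; rewrite !ffunE sum_ffunE.
under [RHS]eq_bigr => i _ do rewrite !ffunE.
transitivity (\sum_S (wd j (ext_pull_basis J S) T)%:C *: x S).
  under [RHS]eq_bigr => S _ do rewrite wedgeG.
  rewrite (bigID (fun S : {set 'I_d} => j \in S))/= [RHS](bigID (fun S : {set 'I_d} => j \in S))/=.
  rewrite addrC; congr (_ + _).
    rewrite big1 => [|S jS]; last by rewrite ffunE (negPf jS) scaler0.
    by rewrite big1// => S jS; rewrite jS ffunE scale0r.
  rewrite (reindex_onto (fun S => j |: S)%SET (fun S => S :\ j)%SET)/= => [|S jS]; last first.
    exact: finset.setD1K.
  rewrite [LHS](eq_bigl (fun S : {set 'I_d} => j \notin S)) => [|S]; last first.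
    rewrite !inE eqxx /=; apply/eqP/idP => [<-|jS]; first by rewrite !inE eqxx.
    by rewrite finset.setU1K.
  apply: eq_bigr => S jS; rewrite !ffunE (negPf jS) !inE eqxx /= finset.setU1K//.
  rewrite count_belowU1// ltnn add0n scalerA; congr (_ *: _).
  by rewrite ffunE [_ *: _](_ : _ = (-1) ^+ count_below j S * ext_pull_basis J (j |: S)%SET
    T)// rmorphM /= rmorphXn /= rmorphN1 mulrC.
have wdE y : wd j y = \sum_i J i j *: dx_wedge i y by apply: form_wedgeE.
under [LHS]eq_bigr => S _ do rewrite wdE sum_ffunE rmorph_sum scaler_suml.
rewrite exchange_big; apply: eq_bigr => i _ /=.
case: ifP => iT; last first.
  by rewrite scaler0 big1// => S _; rewrite !ffunE iT scaler0 scale0r.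
rewrite !scaler_sumr; apply: eq_bigr => S _; rewrite !ffunE iT !scalerA; congr (_ *: _).
have -> : (-1) ^+ count_below i T = ((-1) ^+ count_below i T)%:C :> R[i].
  by rewrite rmorphXn /= rmorphN1.
by rewrite -!rmorphM.
Qed.

Lemma ext_pull1 (a : A) : ext_pull J (ext_tens (ext_one d R[i]) a) = ext_tens (ext_one d R[i]) a.
Proof.
apply/ffunP => T; rewrite !ffunE (bigD1 finset.set0)//= big1 ?addr0 => [|S S0].
  rewrite !ffunE eqxx scale1r ext_pull_basisE.
  have -> : enum (finset.set0 : {set 'I_d}) = [::] by apply/eqP; rewrite -size_eq0 -cardE cards0.
  by rewrite /= ffunE rmorph_nat.
by rewrite [ext_tens _ _ _]ffunE [ext_one _ _ _]ffunE (negPf S0) scale0r scaler0.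
Qed.

Definition ext_pull_endo : endo (ext d A) := Endo ext_pull_linear.

Lemma form_wedge_pull c x :
  form_wedge (fun i => \sum_j c j * (J i j)%:C) (ext_pull J x) = ext_pull J (form_wedge c x).
Proof.
rewrite -[RHS]/(ext_pull_endo _) [in RHS]form_wedgeE linear_sum.
under [RHS]eq_bigr => j _ do rewrite linearZ /= ext_pull_wedge form_wedgeE scaler_sumr.
rewrite exchange_big form_wedgeE; apply: eq_bigr => i _ /=.
by rewrite scaler_suml; apply: eq_bigr => j _; rewrite scalerA.
Qed.

(** Contraction with a vector is determined by its anticommutators with the [dx^j], and
    the pairing of a vector with a pulled back covector is the pairing of its image
    with the covector. *)
Lemma form_contr_pull u x :
  form_contr u (ext_pull J x) = ext_pull J (form_contr (fun j => \sum_i u i * (J i j)%:C) x).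
Proof.
move: x; apply: ext_ind => [|a|j x IH].
- exact: (linear_eq_vsubspace (form_contr u \o ext_pull_endo)
    (ext_pull_endo \o form_contr (fun j => \sum_i u i * (J i j)%:C))).
- by rewrite ext_pull1 !form_contr1 -[RHS]/(ext_pull_endo _) linear0.
- rewrite ext_pull_wedge form_contr_wedge_form IH form_contr_wedge.
  by rewrite -[RHS]/(ext_pull_endo _) linearB linearZ /= ext_pull_wedge.
Qed.

Lemma lift_left_pull f x : lift_left f (ext_pull J x) = ext_pull J (lift_left f x).
Proof.
apply/ffunP => T; rewrite !ffunE linear_sum; apply: eq_bigr => S _.
by rewrite linearZ ffunE.
Qed.

End Pullback.

(** * The exterior algebra of the cotangent space as a Clifford algebra *)

Lemma pinv_bij (T U : Type) (f : T -> U) (f0 : U -> T) : bijective f ->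
  cancel f ('pinv_f0 setT f) /\ cancel ('pinv_f0 setT f) f.
Proof.
case=> g fK gK; split=> x.
  by apply: pinvKV; rewrite ?inE// => y z _ _ /(can_inj fK).
by apply: pinvK; rewrite inE; exists (g x).
Qed.

Lemma pinv_can (T U : Type) (f : T -> U) (f0 : U -> T) g :
  cancel f g -> cancel g f -> 'pinv_f0 setT f =1 g.
Proof.
move=> fK gK x; apply: (can_inj fK); rewrite gK.
by case: (pinv_bij f0 (Bijective fK gK)) => _ ->.
Qed.

Lemma dx_wedge_dx (K : fieldType) (d : nat) (i : 'I_d) (S : {set 'I_d}) :
  dx_wedge i (dx S : {ffun {set 'I_d} -> K^o}) =
  if i \in S then 0 else (-1) ^+ count_below i S *: dx (i |: S)%SET.
Proof.
case: ifPn => iS; last first.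
  rewrite dx_setU1// scalerA -exprD addnn -mul2n exprM sqrrN !expr1n.
  by apply/ffunP => T; rewrite !ffunE /GRing.scale /= mul1r.
apply/ffunP => T; rewrite !ffunE; case: ifP => // iT.
have /negPf-> : (T :\ i)%SET != S by apply: contraTneq iS => <-; rewrite !inE eqxx.
by rewrite scaler0.
Qed.

Section CliffordGrading.
Variables (F : fieldType) (W : lmodType F) (B : W -> W -> F).
Variable Cl : clifford_algebra B.

Lemma cl_gamma_fermion t v a :
  cl_gamma Cl (cl_fermion t v a) = - cl_fermion t v (cl_gamma Cl a).
Proof.
rewrite !cl_fermionE linearZ /= linearD /= linearZ /= !rmorphM /= cl_gamma_in.
by rewrite mulNr mulrN scalerN -opprD scalerN.
Qed.

Lemma cl_gamma_wedges s : cl_gamma Cl (cl_wedges Cl s) = (-1) ^+ size s *: cl_wedges Cl s.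
Proof.
elim: s => [|v s IH]; first by rewrite rmorph1 scale1r.
by rewrite cl_wedges_cons cl_gamma_fermion IH linearZ exprS mulN1r scaleNr.
Qed.
End CliffordGrading.

Section Fibre.
Variables (R : realType) (n : nat) (V : hermitian_space R n).
Variables (Cl : clifford_algebra (@etaC R n V)).
Variables (Cl' : clifford_algebra (@etaC_inv R n V)).
Variables (M : manifold R n.*2) (theta : vielbein M V) (m : M).
Local Notation scal := {ffun {set 'I_(n.*2)} -> R[i]^o}.
Local Notation vbc := (vb_coef theta m).

Lemma VC_of_linear (a : R) (v w : V) : VC_of (a *: v + w) = a%:C *: VC_of v + VC_of w.
Proof. by congr pair; rewrite /= ?scale0r ?scaler0 ?subr0 ?addr0. Qed.

Lemma vb_coord_ex : exists c : {linear VC V -> 'rV[R[i]]_(n.*2)},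
  (forall w, w = \sum_i c w 0 i *: vbc i) /\
  (forall i j, c (vbc j) 0 i = (i == j)%:R).
Proof.
have [g gK Kg] := vb_bij theta m.
have g_lin : linear g := can2_linear gK Kg.
pose gL : {linear V -> 'rV[R]_(n.*2)} := HB.pack g (GRing.isLinear.Build _ _ _ _ g g_lin).
pose c (w : VC V) : 'rV[R[i]]_(n.*2) := \row_i (g w.1 0 i +i* g w.2 0 i).
have c_lin : linear c.
  move=> [a b] [u1 u2] [v1 v2]; apply/rowP => i; rewrite !mxE /=.
  rewrite -[g (_ + v1)]/(gL _) -[g (_ + v2)]/(gL _) !linearD linearN !linearZ !mxE /=.
  by apply/eqP; rewrite eq_complex /= !mulrN !eqxx.
pose cL : {linear VC V -> 'rV[R[i]]_(n.*2)} :=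
  HB.pack c (GRing.isLinear.Build _ _ _ _ c c_lin).
exists cL; split=> [[w1 w2]|i j] /=.
  pose vc : V -> VC V := @VC_of R n V.
  have vc_sum (I : finType) (a : I -> R) (h : I -> V) :
      vc (\sum_i a i *: h i) = \sum_i (a i)%:C *: vc (h i).
    elim/big_rec2: _ => [|i x y _ <-]; first by [].
    by rewrite -VC_of_linear.
  have sumE w : vc w = \sum_i (g w 0 i)%:C *: vbc i.
    rewrite -[in LHS](Kg w) [in LHS](row_sum_delta (g w)) linear_sum.
    under eq_bigr => i _ do rewrite linearZ.
    exact: vc_sum.
  transitivity (vc w1 + 'i *: vc w2).
    by congr pair; rewrite /= ?scale0r ?scale1r ?scaler0 ?subr0 ?addr0 ?add0r.
  rewrite !sumE scaler_sumr -big_split; apply: eq_bigr => i _ /=.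
  rewrite mxE scalerA -scalerDl; congr (_ *: _).
  by apply/eqP; rewrite eq_complex /=; apply/andP; split; apply/eqP; ring.
rewrite mxE /vb_coef /= gK -[g 0]/(gL 0) linear0 !mxE eqxx /= eq_sym.
by rewrite -[RHS](rmorph_nat (real_complex R)).
Qed.

Definition vb_coord : {linear VC V -> 'rV[R[i]]_(n.*2)} := sval (cid vb_coord_ex).

Lemma vb_coordE w : w = \sum_i vb_coord w 0 i *: vbc i.
Proof. by rewrite /vb_coord; case: cid => c [] /=. Qed.

Lemma vb_coord_frame i j : vb_coord (vbc j) 0 i = (i == j)%:R.
Proof. by rewrite /vb_coord; case: cid => c [] /=. Qed.

Lemma vb_dualE i w : vb_dual theta m i w = vb_coord w 0 i.
Proof.
pose f w : R[i]^o := vb_coord w 0 i.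
have f_lin : linear f by move=> a u v; rewrite /f linearP !mxE.
pose fL : {linear VC V -> R[i]^o} := HB.pack f (GRing.isLinear.Build _ _ _ _ f f_lin).
have ex : exists l : dualVC V, forall j, l (vbc j) = (i == j)%:R.
  by exists (linfun fL) => j; rewrite lfunE /= /f vb_coord_frame.
rewrite [in LHS](vb_coordE w) linear_sum (bigD1 i)//= linearZ /=.
have dE := xgetPex 0 ex; rewrite -/(vb_dual theta m i) in dE.
rewrite dE eqxx big1 ?addr0 => [|j /negPf ji]; first exact: mulr1.
by rewrite linearZ /= dE eq_sym ji scaler0.
Qed.

Lemma vb_dual_frame i j : vb_dual theta m i (vbc j) = (i == j)%:R.
Proof. by rewrite vb_dualE vb_coord_frame. Qed.

Lemma vb_dual_flat i j :
  etaC_inv (vb_dual theta m i) (flat (vbc j)) = (i == j)%:R.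
Proof. by rewrite /etaC_inv sharp_flat sharpE vb_dual_frame. Qed.

Lemma vb_dual_basis (l : dualVC V) :
  l = \sum_i etaC_inv l (flat (vbc i)) *: vb_dual theta m i.
Proof.
apply/lfunP => w; rewrite sum_lfunE [in LHS](vb_coordE w) linear_sum.
apply: eq_bigr => i _; rewrite linearZ scale_lfunE vb_dualE /etaC_inv sharp_flat sharpE.
exact: mulrC.
Qed.

Definition Phi (x : scal) : Cl' := form_to_cl Cl' theta m x.

Lemma Phi_word x : Phi x = \sum_S x S *: cl_word Cl' (vb_dual theta m) (enum S).
Proof. by []. Qed.

Lemma Phi_linear : linear Phi.
Proof.
move=> a x y; rewrite !Phi_word scaler_sumr -big_split; apply: eq_bigr => S _.
by rewrite !ffunE scalerDl scalerA.
Qed.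

HB.instance Definition _ := GRing.isLinear.Build R[i] scal Cl' *:%R Phi Phi_linear.

(** The words in the covectors dual to the frame form a basis of [Cl']. *)
Lemma Phi_bij : bijective Phi.
Proof.
have ex a : exists x : scal, Phi x = a.
  have [x ->] := cl_word_full (two_neq0C R) vb_dual_basis a.
  by exists x.
pose g a := sval (cid (ex a)).
have Phig : cancel g Phi by move=> a; rewrite /g; case: cid.
exists g => // x; apply/eqP; rewrite -subr_eq0; apply/eqP/ffunP => S.
rewrite [RHS]ffunE.
apply: (cl_word_free (two_neq0C R) (@etaC_invC _ _ V) vb_dual_flat).
by rewrite -[LHS]/(Phi (g (Phi x) - x)) linearB /= Phig subrr.
Qed.

Definition Psi : Cl' -> scal := 'pinv_(fun=> 0) setT Phi.

Lemma PhiK : cancel Phi Psi. Proof. by case: (pinv_bij (fun=> 0) Phi_bij). Qed.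
Lemma PsiK : cancel Psi Phi. Proof. by case: (pinv_bij (fun=> 0) Phi_bij). Qed.

Lemma Psi_linear : linear Psi. Proof. exact: can2_linear PhiK PsiK. Qed.

HB.instance Definition _ := GRing.isLinear.Build R[i] Cl' scal *:%R Psi Psi_linear.

(** Operators on [Cl'], seen on the exterior algebra. *)
Definition transport (f : endo Cl') : endo scal := endo_of (Psi \o f \o Phi).

Lemma transportM f g : transport (f * g) = transport f * transport g.
Proof. by apply: endoP => x; rewrite endo_mul /= PsiK. Qed.
Lemma transportD f g : transport (f + g) = transport f + transport g.
Proof. by apply: endoP => x; rewrite endo_add /= linearD. Qed.
Lemma transport1 : transport 1 = 1.
Proof. by apply: endoP => x; rewrite /= PhiK. Qed.

Lemma Phi1 : Phi (ext_one n.*2 R[i]) = 1.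
Proof.
rewrite Phi_word (bigD1 finset.set0)//= ffunE eqxx scale1r big1 ?addr0 => [|S S0].
  have -> : enum (finset.set0 : {set 'I_(n.*2)}) = [::].
    by apply/eqP; rewrite -size_eq0 -cardE cards0.
  by [].
by rewrite ffunE (negPf S0) scale0r.
Qed.

Lemma Phi_dx S : Phi (dx S) = cl_word Cl' (vb_dual theta m) (enum S).
Proof.
rewrite Phi_word (bigD1 S)//= ffunE eqxx scale1r big1 ?addr0// => T TS.
by rewrite ffunE (negPf TS) scale0r.
Qed.

Lemma Phi_dx_wedge i z : Phi (dx_wedge i z) = cl_fermion true (vb_dual theta m i) (Phi z).
Proof.
pose W i : endo Cl' := endo_of (cl_fermion true (vb_dual theta m i)).
have WW j k x : W j (W k x) = - W k (W j x) by apply: (cl_wedgeC (two_neq0C R)).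
have W_sq j x : W j (W j x) = 0 by apply: (cl_wedge_sq (two_neq0C R)).
have wordE r : cl_word Cl' (vb_dual theta m) r = sorted_word W 1 r.
  by elim: r => //= j r IH; rewrite cl_word_cons IH.
pose f : {linear scal -> Cl'} := Phi \o dx_wedge i.
pose g : {linear scal -> Cl'} := cl_fermion true (vb_dual theta m i) \o Phi.
suff fg S : f (dx S) = g (dx S).
  rewrite -[LHS]/(f z) -[RHS]/(g z) (scal_sum z) !linear_sum.
  by apply: eq_bigr => S _; rewrite !linearZ fg.
rewrite /f /g /= Phi_dx dx_wedge_dx wordE -[RHS]/(W i _) word_enum_insert//.
by case: ifP => _; rewrite ?linear0// linearZ /= Phi_dx wordE.
Qed.

Lemma Phi_form_wedge (l : dualVC V) z :
  Phi (form_wedge (vb_covector theta m l) z) = cl_fermion true l (Phi z).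
Proof.
rewrite (cl_fermion_basis vb_dual_basis) form_wedgeE linear_sum; apply: eq_bigr => i _.
by rewrite linearZ /= Phi_dx_wedge /etaC_inv sharp_flat sharpE.
Qed.

Lemma transport_wedge l :
  transport (endo_of (cl_fermion true l)) = form_wedge (vb_covector theta m l).
Proof. by apply: endoP => z; rewrite /= -Phi_form_wedge PhiK. Qed.

(** Both sides kill the unit, and have the same anticommutators with the [dx^i]. *)
Lemma transport_contr l : transport (endo_of (cl_fermion false l)) =
  form_contr (fun i => vb_coord (sharp l) 0 i).
Proof.
apply: endoP; apply: ext_ind => [|a|i x /= IH].
- exact: linear_eq_vsubspace.
- rewrite form_contr1; have -> : ext_tens (ext_one n.*2 R[i]) a = a *: (ext_one n.*2 R[i] : scal).
    by apply/ffunP => S; rewrite !ffunE; apply: mulrC.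
  by rewrite /= !linearZ /= Phi1 cl_fermion1 !linear0.
- rewrite form_contr_wedge -IH /= Phi_dx_wedge (cl_contr_wedge (two_neq0C R)).
  rewrite linearB linearZ /= PhiK; congr (_ *: _ - _).
    by rewrite /etaC_inv etaCC sharpE vb_dualE.
  by apply: (can_inj PhiK); rewrite PsiK Phi_dx_wedge PsiK.
Qed.

End Fibre.

(** * The Chevalley generators on one fibre *)

Section FibreOperators.
Variables (R : realType) (n : nat) (V : hermitian_space R n).
Variables (Cl : clifford_algebra (@etaC R n V)).
Variables (Cl' : clifford_algebra (@etaC_inv R n V)).
Variables (M : manifold R n.*2) (theta : vielbein M V) (m : M).
Variable e : bool -> 'I_n -> VC V.
Hypothesis pol : polarization (@etaC R n V) e (@holo R n V).
Local Notation form := (ext n.*2 Cl).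
Local Notation scal := {ffun {set 'I_(n.*2)} -> R[i]^o}.
Local Notation vbc := (vb_coef theta m).

Definition dual_frame (b : bool) (i : 'I_n) : dualVC V := flat (e (~~ b) i).

Let pol' : polarization (@etaC_inv R n V) dual_frame (@dual_holo R n V).
Proof. exact: dual_polarization. Qed.

Definition cliff_op (t b : bool) (i : 'I_n) : endo form :=
  lift_left (pol_fermion e Cl t b i).
Definition form_op (t b : bool) (i : 'I_n) : endo form :=
  lift_right (transport theta m (pol_fermion dual_frame Cl' t b i)).

Lemma cliff_op_anticomm t b i s c j :
  cliff_op t b i * cliff_op s c j + cliff_op s c j * cliff_op t b i =
  [&& t != s, b != c & i == j]%:R.
Proof.
rewrite /cliff_op -!lift_leftM -lift_leftD (pol_fermion_anticomm pol (two_neq0C R)).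
case: [&& _, _ & _]; first exact: lift_left1.
by apply: endo_tens_eq => w a; rewrite lift_left_tens linear0.
Qed.

Lemma form_op_anticomm t b i s c j :
  form_op t b i * form_op s c j + form_op s c j * form_op t b i =
  [&& t != s, b != c & i == j]%:R.
Proof.
rewrite /form_op -!lift_rightM -lift_rightD -!transportM -transportD.
rewrite (pol_fermion_anticomm pol' (two_neq0C R)).
case: [&& _, _ & _]; first by rewrite transport1 lift_right1.
apply: endo_tens_eq => w a; rewrite lift_right_tens /= linear0.
by apply/ffunP => S; rewrite !ffunE scale0r.
Qed.

Lemma cliff_form_op_comm t b i s c j :
  cliff_op t b i * form_op s c j = form_op s c j * cliff_op t b i.
Proof. exact: lift_comm. Qed.

Lemma lift_right_wedge (c : 'I_(n.*2) -> R[i]) :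
  lift_right (form_wedge c : endo scal) = form_wedge c :> endo form.
Proof.
apply: endo_tens_eq => w a; rewrite lift_right_tens !form_wedgeE ext_tens_suml.
by apply: eq_bigr => i _; rewrite dx_wedge_tens.
Qed.

Lemma lift_right_contr (u : 'I_(n.*2) -> R[i]) :
  lift_right (form_contr u : endo scal) = form_contr u :> endo form.
Proof.
apply: endo_tens_eq => w a; rewrite lift_right_tens !form_contrE ext_tens_suml.
by apply: eq_bigr => i _; rewrite dx_contr_tens.
Qed.

(** In coordinates, creation is the exterior product with the pullback of a fixed
    covector along the vielbein, and annihilation is the contraction with the preimage
    of a fixed vector; this is what smoothness is read off from. *)
Lemma form_op_wedge b i :
  form_op true b i = form_wedge (vb_covector theta m (dual_frame b i)).
Proof. by rewrite /form_op transport_wedge lift_right_wedge. Qed.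

Lemma form_op_contr b i :
  form_op false b i = form_contr (fun j => vb_coord theta m (e (~~ b) i) 0 j).
Proof. by rewrite /form_op transport_contr lift_right_contr /dual_frame sharp_flat. Qed.

(** The consequence of being of type [k] that determines the two signs in the
    commutators with [theta]. *)
Definition homogeneous (k : form_index n) : set form :=
  let: (p, pb, q, qb) := k in
  [set x : form |
    (forall S : {set 'I_(n.*2)}, #|S| != (q + qb)%N -> x S = 0) /\
    forall S : {set 'I_(n.*2)}, cl_gamma Cl (x S) = (-1) ^+ (p + pb) *: x S].

Lemma wedges_supp (c : seq ('I_(n.*2) -> R[i])) (S : {set 'I_(n.*2)}) : #|S| != size c ->
  wedges c S = 0.
Proof.
elim: c S => [|c0 c IH] S; first by rewrite ffunE cards_eq0 => /negPf->.
rewrite /= /wedges /= -/(wedges _) ext_mul_scal form_wedgeE sum_ffunE => Sc.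
rewrite big1// => i _; rewrite !ffunE; case: ifP => iS; last by rewrite scaler0.
rewrite IH ?scaler0//; apply: contra Sc => /eqP <-.
by rewrite (cardsD1 i) iS.
Qed.

Lemma homogeneous_subspace k : vsubspace (homogeneous k).
Proof.
case: k => [[[p pb] q] qb]; split=> /=; first by split=> S; rewrite ffunE// linear0 scaler0.
move=> a x y [xS xg] [yS yg]; split=> S; rewrite !ffunE.
  by move=> Sq; rewrite xS// yS// scaler0 addr0.
by rewrite linearP /= xg yg scalerDr !scalerA mulrC.
Qed.

Lemma cl_type_gamma p pb a : cl_type p pb a -> cl_gamma Cl a = (-1) ^+ (p + pb) *: a.
Proof.
pose g : {linear Cl -> Cl} := GRing.scale ((-1) ^+ (p + pb) : R[i]).
apply: (lspan_min (linear_eq_vsubspace (cl_gamma Cl) g)) => _ [s [t [sp tp _ _ ->]]] /=.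
by rewrite cl_gamma_wedges size_cat sp tp.
Qed.

Lemma form_type_homogeneous k x : form_type theta m k x -> homogeneous k x.
Proof.
case: k => [[[p pb] q] qb]; apply: (lspan_min (homogeneous_subspace _)).
move=> _ [a [s [t [/cl_type_gamma ag sq tq _ ->]]]]; split=> S; rewrite ffunE.
  by move=> Sq; rewrite wedges_supp ?scale0r// size_map size_cat sq tq.
by rewrite linearZ /= ag !scalerA mulrC.
Qed.

Lemma theta_holo b j : component (@holo R n V) (vbc j) b =
  \sum_i vb_covector theta m (dual_frame b i) j *: e b i.
Proof.
rewrite holo_component [LHS](pol_partE pol (holo_proj_holo _ _)).
apply: eq_bigr => i _; rewrite /vb_covector /dual_frame flatE; congr (_ *: _).
have [_ _ eL _] := pol; have := holo_proj_sum (vbc j).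
rewrite (bigD1 b)//= (big_pred1 (~~ b)) => [{2}->|c]; last by case: b c => [] [].
rewrite [RHS]etaCC -[RHS]/(etaC_form _ _) linearD /=.
by rewrite [X in _ + X](holo_isotropic (holo_proj_holo _ _) (eL _ _)) addr0.
Qed.

(** On homogeneous forms, the sign from moving the one-form across the form factor
    cancels against the form degree in [cliff_sign], and what is left of that sign is
    the parity of the Clifford factor: [theta] then acts by creation, or annihilation,
    on the Clifford factor and by creation on the form factor. *)
Lemma half_theta (t b : bool) k x : homogeneous k x ->
  2^-1 *: (ext_mul (theta_form Cl theta m b) x +
    ((if t then 1 else -1) * cliff_sign R k) *: ext_mul x (theta_form Cl theta m b)) =
  bilin cliff_op form_op t true b x.
Proof.
case: k => [[[p pb] q] qb] [xS xg].
rewrite /theta_form ext_mul_one_form (ext_mul_one_formr _ xS) /cliff_sign scalerA.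
have -> c : c * (-1 : R[i]) ^+ (p + pb + q + qb) * (-1) ^+ (q + qb) = c * (-1) ^+ (p + pb).
  rewrite -[(p + pb + q + qb)%N]addnA exprD -!mulrA -exprD addnn -mul2n exprM sqrrN.
  by rewrite !expr1n mulr1.
(* after the form sign, only the parity of the Clifford factor is left *)
have wedge_gamma j S : cl_gamma Cl (dx_wedge j x S) = (-1) ^+ (p + pb) *: dx_wedge j x S.
  rewrite !ffunE; case: ifP => _; last by rewrite linear0 scaler0.
  by rewrite linearZ /= xg !scalerA mulrC.
have fermionE j S : cl_fermion t (component (@holo R n V) (vbc j) b) (dx_wedge j x S) =
    \sum_i vb_covector theta m (dual_frame b i) j *: cl_fermion t (e b i) (dx_wedge j x S).
  rewrite theta_holo; pose f : {linear VC V -> Cl} := HB.pack ((@cl_fermion _ _ _ Cl t)^~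
    (dx_wedge j x S))
    (GRing.isLinear.Build _ (VC V) Cl _ _ (cl_fermion_vec_linear t (dx_wedge j x S))).
  by rewrite -[LHS]/(f _) linear_sum; apply: eq_bigr => i _; rewrite linearZ.
apply/ffunP => S; rewrite endo_sum !sum_ffunE.
under [RHS]eq_bigr => i _.
  rewrite endo_mul form_op_wedge form_wedgeE /cliff_op ffunE sum_ffunE linear_sum.
  under eq_bigr => j _ do rewrite ffunE linearZ.
  over.
rewrite exchange_big ffunE; rewrite [X in _ *: X]ffunE [X in _ *: (_ + X)]ffunE !sum_ffunE.
rewrite scaler_sumr -big_split scaler_sumr; apply: eq_bigr => j _ /=.
rewrite -fermionE cl_fermionE wedge_gamma !ffunE; congr (_ *: (_ + _)).
by rewrite -scalerAl scalerA.
Qed.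

Lemma wedges_Psi (s : seq (dualVC V)) :
  wedges (map (vb_covector theta m) s) = Psi theta m (cl_wedges Cl' s).
Proof.
apply: (can_inj (@PhiK _ _ _ Cl' _ theta m)); rewrite PsiK.
elim: s => [|l s IH]; first exact: Phi1.
by rewrite /= /wedges /= -/(wedges _) ext_mul_scal Phi_form_wedge IH.
Qed.

(** Both tensor factors are spanned by products of vectors of the first kind followed by
    products of vectors of the second kind, with at most [n] vectors of either kind. *)
Lemma form_type_span (x : form) : exists y : {ffun form_index n -> form},
  (forall k, form_type theta m k (y k)) /\ x = \sum_k y k.
Proof.
have SS k : vsubspace (@form_type R n V Cl M theta m k).
  by case: k => [[[p pb] q] qb]; apply: lspan_subspace.
have [QS SQ] := sum_subspaces SS; set Q := [set x | _] in QS SQ.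
rewrite -[exists _, _]/(Q x); move: x; apply: ext_tens_ind => // w.
apply: (cl_bigraded_ind pol (two_neq0C R)) => [|s t sn tn sL tL].
  split=> [|a x y /= Qx Qy]; first by rewrite /= linear0; case: QS.
  by rewrite /= linearP; apply: QS.2.
rewrite -(@PhiK _ _ _ Cl' _ theta m w); move: (Phi _ _ _ w).
have tens0 (a : Cl) : ext_tens (0 : scal) a = 0.
  by apply/ffunP => S; rewrite !ffunE scale0r.
apply: (cl_bigraded_ind pol' (two_neq0C R)) => [|s' t' sn' tn' sL' tL'].
  split=> [|a x y /= Qx Qy]; first by rewrite /= linear0 tens0; case: QS.
  by rewrite /= linearP ext_tens_linearl; apply: QS.2.
have lt_n k : (k <= n)%N -> (k < n.+1)%N by rewrite ltnS.
apply: (SQ (Ordinal (lt_n _ sn), Ordinal (lt_n _ tn), Ordinal (lt_n _ sn'), Ordinal (lt_n _ tn'))).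
apply: lspan_gen; exists (cl_wedges Cl (s ++ t)), s', t'; split=> //.
  by apply: lspan_gen; exists s, t.
by rewrite wedges_Psi.
Qed.

Lemma mul_plusE b x : mul_plus theta m b x = bilin cliff_op form_op true true b x.
Proof.
apply: (linext_linear (g := bilin cliff_op form_op true true b)) => [y|k y
  /form_type_homogeneous ky].
  exact: form_type_span.
by rewrite -[RHS](half_theta true b ky) mul1r.
Qed.

Lemma mul_minusE b x : mul_minus theta m b x = bilin cliff_op form_op false true b x.
Proof.
apply: (linext_linear (g := bilin cliff_op form_op false true b)) => [y|k y
  /form_type_homogeneous ky].
  exact: form_type_span.
by rewrite -[RHS](half_theta false b ky) mulN1r scaleNr.
Qed.

Lemma cliff_number_op (k : form_index n) b x : form_type theta m k x ->
  (\sum_i cliff_op true b i * cliff_op false (~~ b) i) x =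
  (let: (p, pb, _, _) := k in if b then p%:R else pb%:R : R[i]) *: x.
Proof.
case: k => [[[p pb] q] qb].
set N := \sum_i _; set c : R[i] := if b then _ else _.
pose g : {linear form -> form} := GRing.scale c.
apply: (lspan_min (linear_eq_vsubspace N g)) => _ [a [s [t [ta _ _ _ ->]]]] /=.
set w : scal := wedges _; rewrite /g /=.
have -> : N = lift_left (pol_number e Cl b).
  apply: endo_tens_eq => u y; rewrite endo_sum lift_left_tens endo_sum linear_sum.
  by apply: eq_bigr => i _; rewrite !endo_mul !lift_left_tens.
rewrite -[[ffun S => _]]/(ext_tens w a) lift_left_tens -linearZ; congr (ext_tens w _).
pose h : {linear Cl -> Cl} := GRing.scale c.
move: ta; apply: (lspan_min (linear_eq_vsubspace (pol_number e Cl b) h)).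
move=> _ [s0 [t0 [s0p t0p s0L t0L ->]]] /=.
rewrite (pol_number_wedges pol (two_neq0C R) (@etaCC _ _ V))// s0p t0p /h /= /c.
by case: (b).
Qed.

Lemma form_number_op (k : form_index n) b x : form_type theta m k x ->
  (\sum_i form_op true b i * form_op false (~~ b) i) x =
  (let: (_, _, q, qb) := k in if b then q%:R else qb%:R : R[i]) *: x.
Proof.
case: k => [[[p pb] q] qb].
set N := \sum_i _; set c : R[i] := if b then _ else _.
pose g : {linear form -> form} := GRing.scale c.
apply: (lspan_min (linear_eq_vsubspace N g)) => _ [a [s [t [_ sq tq [sL tL] ->]]]] /=.
rewrite wedges_Psi /g /=; set w := Psi _ _ _.
have -> : N = lift_right (transport theta m (pol_number dual_frame Cl' b)).
  have transportE f z : transport theta m f z = Psi theta m (f (Phi Cl' theta m z)) by [].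
  apply: endo_tens_eq => u y; rewrite endo_sum lift_right_tens transportE endo_sum linear_sum.
  transitivity (\sum_i 1 *: ext_tens (Psi theta m ((pol_fermion dual_frame Cl' true b i *
      pol_fermion dual_frame Cl' false (~~ b) i) (Phi Cl' theta m u))) y).
    apply: eq_bigr => i _.
    by rewrite /form_op -lift_rightM -transportM lift_right_tens transportE scale1r.
  by rewrite -ext_tens_suml; congr (ext_tens _ _); apply: eq_bigr => i _; rewrite scale1r.
rewrite -[[ffun S => _]]/(ext_tens w a) lift_right_tens /= /w PsiK.
rewrite (pol_number_wedges pol' (two_neq0C R) (@etaC_invC _ _ V))// sq tq linearZ /=.
have -> : (if b then q : nat else qb)%:R = c :> R[i] by rewrite /c; case: (b).
by apply/ffunP => S; rewrite !ffunE scalerA.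
Qed.

End FibreOperators.

(** Conjugation by a star reverses the flag of the factor on which it acts, so that all
    the generators arise from the four products with [theta] and its conjugate. *)
Section FibreChevalley.
Variables (R : realType) (n : nat) (V : hermitian_space R n).
Variables (Cl : clifford_algebra (@etaC R n V)).
Variables (Cl' : clifford_algebra (@etaC_inv R n V)).
Variables (vol : Cl) (star : {linear Cl -> Cl}).
Hypotheses (vol_top : cl_degree n.*2 vol) (vol_sq : vol * vol = 1).
Hypothesis star_hodge : hodge_star vol star.
Variables (vol' : Cl') (star' : {linear Cl' -> Cl'}).
Hypotheses (vol'_top : cl_degree n.*2 vol') (vol'_sq : vol' * vol' = 1).
Hypothesis star'_hodge : hodge_star vol' star'.
Variables (M : manifold R n.*2) (theta : vielbein M V) (m : M).
Variable e : bool -> 'I_n -> VC V.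
Hypothesis pol : polarization (@etaC R n V) e (@holo R n V).
Local Notation form := (ext n.*2 Cl).
Local Notation C := (cliff_op Cl e).
Local Notation D := (form_op Cl Cl' theta m e).

Lemma star_fermion t v a : star (cl_fermion t v a) = cl_fermion (~~ t) v (star a).
Proof.
have vol0 : vol != 0 by apply: contra_eq_neq vol_sq => ->; rewrite mul0r eq_sym oner_neq0.
have top : cl_degree #|{: bool * 'I_n}| vol by rewrite card_pol.
exact: (hodge_fermion (two_neq0C R) (@etaCC _ _ V) (pol_dualE pol) (pol_basisE pol)
  top vol0 star_hodge).
Qed.

Lemma star'_fermion t v a : star' (cl_fermion t v a) = cl_fermion (~~ t) v (star' a).
Proof.
have vol0 : vol' != 0 by apply: contra_eq_neq vol'_sq => ->; rewrite mul0r eq_sym oner_neq0.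
have top : cl_degree #|{: bool * 'I_n}| vol' by rewrite card_pol.
have pol' := dual_polarization pol.
exact: (hodge_fermion (two_neq0C R) (@etaC_invC _ _ V) (pol_dualE pol') (pol_basisE pol')
  top vol0 star'_hodge).
Qed.

Lemma star1_conj (X : form -> form) t t' b : X =1 bilin C D t t' b ->
  star1_inv star \o X \o star1 star =1 bilin C D (~~ t) t' b.
Proof.
move=> XE x /=; case: (star_hodge) => /linear_bij_inv[g [starK gK]] _ _.
have lK (f h : endo Cl) : cancel f h ->
    cancel (lift_left f : endo form) (lift_left h : endo form).
  by move=> fK y; apply/ffunP => S; rewrite !ffunE fK.
rewrite /star1_inv (pinv_can (fun=> 0) (lK (endo_of star) g starK) (lK g (endo_of star) gK)).
rewrite XE -[star1 star x]/((lift_left (endo_of star) : endo form) x) -!endo_mul.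
congr (endo_fun _ x); rewrite /bilin !(mulr_suml, mulr_sumr); apply: eq_bigr => i _.
rewrite !mulrA -[_ * _ * lift_left _]mulrA -lift_comm !mulrA -!lift_leftM; congr (_ * _).
congr lift_left; apply: endoP => a; rewrite !endo_mul /=.
by apply: (canLR starK); rewrite star_fermion negbK.
Qed.

Lemma star2_conj (X : form -> form) t t' b : X =1 bilin C D t t' b ->
  star2_inv star' theta m \o X \o star2 star' theta m =1 bilin C D t (~~ t') b.
Proof.
move=> XE x /=; case: (star'_hodge) => /linear_bij_inv[g [starK gK]] _ _.
have lK (f h : endo Cl') : cancel f h ->
    cancel (lift_right (transport theta m f) : endo form)
           (lift_right (transport theta m h) : endo form).
  move=> fK y; rewrite -endo_mul -lift_rightM -transportM.
  have -> : h * f = 1 by apply: endoP => z; apply: fK.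
  by rewrite transport1 lift_right1.
rewrite /star2_inv.
rewrite (pinv_can (fun=> 0) (lK (endo_of star') g starK) (lK g (endo_of star') gK)).
rewrite XE.
rewrite -[star2 _ _ _ x]/((lift_right (transport theta m (endo_of star')) : endo form) x).
rewrite -!endo_mul; congr (endo_fun _ x).
rewrite /bilin !(mulr_suml, mulr_sumr); apply: eq_bigr => i _.
rewrite !mulrA -lift_comm -!mulrA; congr (_ * _); rewrite !mulrA -!lift_rightM -!transportM.
congr (lift_right (endo_fun (transport theta m _))); apply: endoP => a; rewrite !endo_mul /=.
by apply: (canLR starK); rewrite star'_fermion negbK.
Qed.

Lemma opE_chevalley i x : opE star star' theta m i x = chevalley_e C D i x.
Proof.
rewrite /chevalley_e; case: i => [[|[|[|[|//]]]] i4]; rewrite /opE /=.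
- exact: (mul_plusE Cl' theta m pol).
- exact: (star2_conj (mul_plusE Cl' theta m pol false)).
- exact: (star1_conj (star2_conj (mul_plusE Cl' theta m pol true))).
- exact: (mul_minusE Cl' theta m pol).
Qed.

Lemma opF_chevalley i x : opF star star' theta m i x = chevalley_f C D i x.
Proof.
rewrite /chevalley_f; case: i => [[|[|[|[|//]]]] i4]; rewrite /opF /=.
- exact: (star1_conj (star2_conj (mul_plusE Cl' theta m pol false))).
- exact: (mul_minusE Cl' theta m pol).
- exact: (mul_plusE Cl' theta m pol).
- exact: (star2_conj (mul_plusE Cl' theta m pol true)).
Qed.

(** [[E_i, F_i]] is a combination of [n] and two number operators. On forms of a given
    type the number operators are the degrees, once annihilation before creation has
    been rewritten as [n] minus creation before annihilation. *)
Lemma opH_chevalley i x : opH theta m i x = chevalley_h C D i x.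
Proof.
apply: (linext_linear (g := chevalley_h C D i)) => [y|k y ky].
  exact: (form_type_span Cl' theta m pol).
have CC := cliff_op_anticomm Cl pol.
have DD := form_op_anticomm Cl Cl' theta m pol.
have flip (X : bool -> bool -> 'I_n -> endo form) (b : bool) :
    (forall t b i s c j, X t b i * X s c j + X s c j * X t b i =
      [&& t != s, b != c & i == j]%:R) ->
    \sum_i X false b i * X true (~~ b) i = n%:R - \sum_i X true (~~ b) i * X false b i.
  move=> XX; apply/eqP; rewrite -subr_eq0 opprB addrA subr_eq0 -big_split /=.
  rewrite (eq_bigr (fun=> 1)) ?sumr_const ?card_ord// => j _.
  by rewrite XX eqxx; case: b.
have NC b := cliff_number_op pol b ky.
have ND b := form_number_op Cl' pol b ky.
have sumE (X Y : endo form) : (n%:R - X - Y) y = (n%:R : R[i]) *: y - X y - Y y.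
  by rewrite !endo_add !endo_opp endo_nat scaler_nat.
have subE (X : endo form) : (n%:R - X) y = (n%:R : R[i]) *: y - X y.
  by rewrite endo_add endo_opp endo_nat scaler_nat.
have hE t t' b := comm_bilin_dual CC DD (cliff_form_op_comm _ _ _ _ _) t t' b.
pose h t t' b := commutator (bilin C D t t' b) (bilin C D (~~ t) (~~ t') (~~ b)).
move: k ky NC ND => [[[p pb] q] qb] ky NC ND.
case: i => [[|[|[|[|//]]]] i4].
- rewrite -[RHS]/(h true true true y) /h hE sumE /= !(flip _ false)// !subE (NC true) (ND true)
  -!scalerBl; congr (_ *: _).
  by rewrite natrD; ring.
- rewrite -[RHS]/(h true false false y) /h hE sumE /= (flip _ true)// (ND true) subE (NC false)
  -!scalerBl; congr (_ *: _).
  by ring.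
- rewrite -[RHS]/(h false false true y) /h hE sumE /= (NC false) (ND false) -!scalerBl natrD;
  congr (_ *: _).
  by ring.
- rewrite -[RHS]/(h false true false y) /h hE sumE /= (flip _ true)// (NC true) subE (ND false)
  -!scalerBl; congr (_ *: _).
  by ring.
Qed.

End FibreChevalley.

(** * Smooth functions and the chain rule *)

Section SmoothCalculus.
Variables (R : realType) (d : nat) (U : set 'rV[R]_d).
Hypothesis openU : open U.
Implicit Types f g : 'rV[R]_d -> R.

Lemma near_open f g : (forall y, U y -> f y = g y) ->
  forall y, U y -> \near y, f y = g y.
Proof.
move=> fg y Uy; have : nbhs y U by apply: open_nbhs_nbhs.
by apply: filterS => z /fg.
Qed.

Lemma continuous_ext f g : (forall y, U y -> f y = g y) ->
  forall y, U y -> {for y, continuous f} -> {for y, continuous g}.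
Proof.
move=> fg y Uy fy; have /near_eq_cvg fgy := near_open fg Uy.
have gy : g y = f y by rewrite fg.
by rewrite /prop_for /continuous_at gy; apply: cvg_trans fy.
Qed.

Lemma Ck_ext k f g : (forall y, U y -> f y = g y) -> Ck k U f -> Ck k U g.
Proof.
elim: k f g => [|k IH] f g fg [fc fD].
  by split=> // y Uy; apply: continuous_ext (fc y Uy).
split=> [y Uy|i]; first exact: continuous_ext (fc y Uy).
have [fd fDi] := fD i; split=> [y Uy|].
  by apply: near_eq_derivable (fd y Uy); apply: near_open.
apply: IH fDi => y Uy; apply: near_eq_derive; exact: near_open.
Qed.

Lemma CkS k f : Ck k.+1 U f -> Ck k U f.
Proof.
elim: k f => [|k IH] f [fc fD]; first by split.
by split=> // i; have [fd fDi] := fD i; split=> //; apply: IH.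
Qed.

Lemma Ck_cst k (c : R) : Ck k U (fun=> c).
Proof.
elim: k c => [|k IH] c; first by split=> [y _|]; first exact: cst_continuous.
split=> [y _|i]; first exact: cst_continuous.
split=> [y Uy|]; first exact: derivable_cst.
by apply: Ck_ext (IH 0) => y _; rewrite derive_cst.
Qed.

Lemma CkD k f g : Ck k U f -> Ck k U g -> Ck k U (fun y => f y + g y).
Proof.
elim: k f g => [|k IH] f g [fc fD] [gc gD].
  by split=> // y Uy; exact: (cvgD (fc y Uy) (gc y Uy)).
split=> [y Uy|i]; first by exact: (cvgD (fc y Uy) (gc y Uy)).
have [fd fDi] := fD i; have [gd gDi] := gD i; split=> [y Uy|].
  by apply: derivableD; [apply: fd|apply: gd].
apply: Ck_ext (IH _ _ fDi gDi) => y Uy.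
by rewrite (deriveD (fd y Uy) (gd y Uy)).
Qed.

Lemma CkM k f g : Ck k U f -> Ck k U g -> Ck k U (fun y => f y * g y).
Proof.
elim: k f g => [|k IH] f g Cf Cg.
  by case: Cf Cg => fc _ [gc _]; split=> // y Uy; exact: (cvgM (fc y Uy) (gc y Uy)).
have [fk gk] := (CkS Cf, CkS Cg); case: Cf Cg => fc fD [gc gD].
split=> [y Uy|i]; first by exact: (cvgM (fc y Uy) (gc y Uy)).
have [fd fDi] := fD i; have [gd gDi] := gD i; split=> [y Uy|].
  by apply: derivableM; [apply: fd|apply: gd].
apply: Ck_ext (CkD (IH _ _ fk gDi) (IH _ _ gk fDi)) => y Uy.
by rewrite (deriveM (fd y Uy) (gd y Uy)).
Qed.

Lemma CkV k f : (forall y, U y -> f y != 0) -> Ck k U f -> Ck k U (fun y => (f y)^-1).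
Proof.
move=> f0; elim: k => [|k IH] Cf.
  by case: Cf => fc _; split=> // y Uy; exact: (cvgV (f0 y Uy) (fc y Uy)).
have Vk := IH (CkS Cf); case: Cf => fc fD.
split=> [y Uy|i]; first by exact: (cvgV (f0 y Uy) (fc y Uy)).
have [fd fDi] := fD i; split=> [y Uy|].
  by apply: derivableV; [apply: f0|apply: fd].
apply: Ck_ext (CkM (CkM (Ck_cst k (-1)) (CkM Vk Vk)) fDi) => y Uy.
by rewrite (deriveV (f0 y Uy) (fd y Uy)) mulN1r -expr2 exprVn.
Qed.

Lemma smooth_ext f g : (forall y, U y -> f y = g y) -> smooth U f -> smooth U g.
Proof. by move=> fg sf k; apply: Ck_ext (sf k). Qed.
Lemma smooth_cst (c : R) : smooth U (fun=> c).
Proof. by move=> k; apply: Ck_cst. Qed.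
Lemma smoothD f g : smooth U f -> smooth U g -> smooth U (fun y => f y + g y).
Proof. by move=> sf sg k; apply: CkD. Qed.
Lemma smoothM f g : smooth U f -> smooth U g -> smooth U (fun y => f y * g y).
Proof. by move=> sf sg k; apply: CkM. Qed.
Lemma smoothV f : (forall y, U y -> f y != 0) -> smooth U f -> smooth U (fun y => (f y)^-1).
Proof. by move=> f0 sf k; apply: CkV. Qed.
Lemma smoothN f : smooth U f -> smooth U (fun y => - f y).
Proof.
move=> sf; apply: smooth_ext (smoothM (smooth_cst (-1)) sf) => y _.
by rewrite mulN1r.
Qed.

Lemma smooth_sum (I : Type) (r : seq I) (P : pred I) (f : I -> 'rV[R]_d -> R) :
  (forall i, smooth U (f i)) -> smooth U (fun y => \sum_(i <- r | P i) f i y).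
Proof.
move=> sf; elim: r => [|i r IH].
  by apply: smooth_ext (smooth_cst 0) => y _; rewrite big_nil.
case Pi: (P i); last by apply: smooth_ext IH => y _; rewrite big_cons Pi.
by apply: smooth_ext (smoothD (sf i) IH) => y _; rewrite big_cons Pi.
Qed.

Lemma smooth_prod (I : Type) (r : seq I) (P : pred I) (f : I -> 'rV[R]_d -> R) :
  (forall i, smooth U (f i)) -> smooth U (fun y => \prod_(i <- r | P i) f i y).
Proof.
move=> sf; elim: r => [|i r IH].
  by apply: smooth_ext (smooth_cst 1) => y _; rewrite big_nil.
case Pi: (P i); last by apply: smooth_ext IH => y _; rewrite big_cons Pi.
by apply: smooth_ext (smoothM (sf i) IH) => y _; rewrite big_cons Pi.
Qed.

Lemma smooth_det p (A : 'rV[R]_d -> 'M[R]_p) :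
  (forall i j, smooth U (fun y => A y i j)) -> smooth U (fun y => \det (A y)).
Proof.
move=> sA; apply: smooth_sum => s; apply: smoothM; first exact: smooth_cst.
by apply: smooth_prod => i.
Qed.

(** Cramer's rule. *)
Lemma smooth_invmx p (A : 'rV[R]_d -> 'M[R]_p) :
  (forall i j, smooth U (fun y => A y i j)) ->
  (forall y, U y -> A y \in unitmx) ->
  forall i j, smooth U (fun y => invmx (A y) i j).
Proof.
move=> sA uA i j.
apply: (@smooth_ext (fun y => (\det (A y))^-1 * ((-1) ^+ (j + i) * \det (row' j (col' i (A y)))))).
  by move=> y Uy; rewrite /invmx uA// !mxE.
apply: smoothM.
  by apply: smoothV (smooth_det sA) => y /uA; rewrite unitmxE unitfE.
apply: smoothM; first exact: smooth_cst.
apply: smooth_det => k l; apply: smooth_ext (sA (lift j k) (lift i l)) => y _.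
by rewrite !mxE.
Qed.

End SmoothCalculus.

Lemma filter_finite_forall (T : Type) (I : finType) (F : set_system T) (P : I -> set T) :
  Filter F -> (forall i, F (P i)) -> F [set x | forall i, P i x].
Proof.
move=> FF FP; suff : F [set x | forall i, i \in enum I -> P i x].
  by apply: filterS => x Px i; apply: Px; rewrite mem_enum.
elim: (enum I) => [|i r IH]; first by apply: filterS filterT.
apply: filterS2 (FP i) IH => x Pi Px j; rewrite inE => /orP[/eqP->//|]; exact: Px.
Qed.

Lemma cvg_finite_sum (R : realType) (T I : Type) (F : set_system T) (r : seq I)
  (f : I -> T -> R) (l : I -> R) : Filter F -> (forall i, f i t @[t --> F] --> l i) ->
  \sum_(i <- r) f i t @[t --> F] --> \sum_(i <- r) l i.
Proof.
move=> FF fl; elim: r => [|i r IH].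
  by rewrite big_nil; under eq_fun => t do rewrite big_nil; apply: cvg_cst.
by rewrite big_cons; under eq_fun => t do rewrite big_cons; apply: cvgD.
Qed.

Section Differential.
Variables (R : realType) (d : nat).
Implicit Types (f : 'rV[R]_d -> R) (p v y z : 'rV[R]_d).

Lemma line_is_derive f p v (t : R) : derivable f (t *: v + p) v ->
  is_derive t 1 (fun s : R => f (s *: v + p)) ('D_v f (t *: v + p)).
Proof.
move=> df; pose g s := f (s *: v + p).
have E : (fun h : R => h^-1 *: ((g \o shift t) (h *: 1) - g t)) =
    (fun h : R => h^-1 *: ((f \o shift (t *: v + p)) (h *: v) - f (t *: v + p))).
  apply/funext => h; rewrite /g /=; congr (_ *: (f _ - _)).
  by rewrite scalerDl [_%:A]mulr1 addrA.
split; first by rewrite /derivable E.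
by rewrite /derive E.
Qed.

Lemma line_MVT f p v (h : R) :
  (forall t, `|t| <= `|h| -> derivable f (t *: v + p) v) ->
  exists2 t, `|t| <= `|h| & f (h *: v + p) - f p = 'D_v f (t *: v + p) * h.
Proof.
move=> df; have [h0|h0] := leP 0 h.
  have bnd t : t \in `[0, h]%R -> `|t| <= `|h|.
    by rewrite in_itv /= => /andP[t0 th]; rewrite !ger0_norm.
  have [||t /bnd th] := @MVT_segment R (fun s => f (s *: v + p))
      (fun t => 'D_v f (t *: v + p)) 0 h h0.
  - by move=> t th; apply/line_is_derive/df/bnd/subset_itv_oo_cc.
  - apply: derivable_within_continuous => t th.
    by have [] := line_is_derive (df t (bnd t th)).
  - by rewrite scale0r add0r subr0 => fE; exists t.
have bnd t : t \in `[h, 0]%R -> `|t| <= `|h|.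
  by rewrite in_itv /= => /andP[ht t0]; rewrite !ler0_norm ?lerN2 // ltW.
have [||t /bnd th] := @MVT_segment R (fun s => f (s *: v + p))
    (fun t => 'D_v f (t *: v + p)) h 0 (ltW h0).
- by move=> t th; apply/line_is_derive/df/bnd/subset_itv_oo_cc.
- apply: derivable_within_continuous => t th.
  by have [] := line_is_derive (df t (bnd t th)).
- rewrite scale0r add0r sub0r mulrN => fE; exists t => //.
  by rewrite -[LHS]opprB fE opprK.
Qed.

(** From [y] to [z] one moves along one coordinate at a time, and uses the mean value
    theorem and the continuity of the partial derivatives on each segment. *)
Lemma Ck1_total_diff (U : set 'rV[R]_d) f y (eps : R) : open U -> Ck 1 U f -> U y -> 0 < eps ->
  \forall z \near y, `|f z - f y - \sum_i (z 0 i - y 0 i) * 'D_(delta_mx 0 i) f y|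
    <= eps * \sum_i `|z 0 i - y 0 i|.
Proof.
move=> openU [fc fD] Uy eps0.
have /nbhs_ballP[del del0 good] : nbhs y [set q | forall i, U q /\
    `|'D_(delta_mx 0 i) f q - 'D_(delta_mx 0 i) f y| <= eps].
  apply: filter_finite_forall => i; apply: filterI; first exact: open_nbhs_nbhs.
  have [_ [Dc _]] := fD i; have /cvgrPdist_le/(_ eps eps0) := Dc y Uy.
  by apply: filterS => q; rewrite distrC.
have : nbhs y (ball y del) by apply: nbhsx_ballx.
apply: filterS => z [_ yz].
have zi i : `|z 0 i - y 0 i| < del by have := yz 0 i; rewrite /ball /= distrC.
(* [p k] has the first [k] coordinates of [z] and the others of [y] *)
pose p (k : nat) : 'rV[R]_d := \row_i (if (i < k)%N then z 0 i else y 0 i).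
have p0 : p 0%N = y by apply/rowP => i; rewrite mxE.
have pd : p d = z by apply/rowP => i; rewrite mxE ltn_ord.
have step (k : 'I_d) : exists2 q, ball y del q &
    f (p k.+1) - f (p k) = 'D_(delta_mx 0 k) f q * (z 0 k - y 0 k).
  pose h := z 0 k - y 0 k.
  have pS : p k.+1 = h *: delta_mx 0 k + p k.
    apply/rowP => i; rewrite !mxE eqxx /= ltnS leq_eqVlt val_eqE.
    have [->|ik] := eqVneq i k; first by rewrite ltnn mulr1 subrK.
    by rewrite mulr0 add0r.
  have in_ball t : `|t| <= `|h| -> ball y del (t *: delta_mx 0 k + p k).
    move=> th; split=> // i j; rewrite (ord1 i) !mxE eqxx /= /ball /=.
    have [->|jk] := eqVneq j k.
      rewrite ltnn mulr1 opprD addrCA subrr addr0 normrN.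
      exact: le_lt_trans th (zi k).
    rewrite mulr0 add0r; case: ifP => _; first by rewrite distrC.
    by rewrite subrr normr0.
  have [t th|t th fE] := @line_MVT f (p k) (delta_mx 0 k) h.
    by have [fd _] := fD k; apply: fd; have [] := good _ (in_ball t th) k.
  by exists (t *: delta_mx 0 k + p k); [apply: in_ball|rewrite pS].
have -> : f z - f y = \sum_(k < d) (f (p k.+1) - f (p k)).
  by rewrite -(big_mkord xpredT (fun k => f (p k.+1) - f (p k))) telescope_sumr// p0 pd.
rewrite -sumrB mulr_sumr; apply: le_trans (ler_norm_sum _ _ _) _; apply: ler_sum => k _.
have [q yq ->] := step k; rewrite [X in X - _]mulrC -mulrBr normrM mulrC.
by apply: ler_wpM2r; rewrite ?normr_ge0//; have [] := good q yq k.
Qed.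

Lemma line_at0 v y : (h *: v + y) @[h --> (0 : R)] --> y.
Proof.
have : (h *: v + y) @[h --> (0 : R)] --> (0 : R) *: v + y.
  by apply: cvgD; [apply: cvgZr_tmp; exact: cvg_id|exact: cvg_cst].
by rewrite scale0r add0r.
Qed.

(** Difference quotients of [g] along [phi], compared with the differential of [g] applied
    to the difference quotients of [phi]: the error is bounded by a small multiple of
    the latter, which stay bounded. *)
Lemma chain_along_line (W : set 'rV[R]_d) (phi : 'rV[R]_d -> 'rV[R]_d) g y v :
  open W -> Ck 1 W g -> W (phi y) ->
  (forall j, derivable (fun z => phi z 0 j) y v) ->
  (forall j, {for y, continuous (fun z => phi z 0 j)}) ->
  (fun h : R => h^-1 * (g (phi (h *: v + y)) - g (phi y))) @ 0^' -->
    \sum_j 'D_v (fun z => phi z 0 j) y * 'D_(delta_mx 0 j) g (phi y).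
Proof.
move=> openW gC Wy phid phic.
pose q j (h : R) := h^-1 * (phi (h *: v + y) 0 j - phi y 0 j).
have q_cvg j : q j h @[h --> 0^'] --> 'D_v (fun z => phi z 0 j) y by exact: phid.
pose S (h : R) := \sum_j q j h * 'D_(delta_mx 0 j) g (phi y).
have S_cvg : S h @[h --> 0^'] --> \sum_j 'D_v (fun z => phi z 0 j) y * 'D_(delta_mx 0 j) g (phi y).
  apply: cvg_finite_sum => j; exact: (cvgM (q_cvg j) (cvg_cst _)).
set G := fun h : R => _.
suff GS : (G h - S h) @[h --> 0^'] --> 0.
  have GE : G = (fun h => (G h - S h) + S h) by apply/funext => h; rewrite subrK.
  by rewrite GE -[X in _ --> X]add0r; exact: (cvgD GS S_cvg).
pose B := \sum_j `|'D_v (fun z => phi z 0 j) y|.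
have B0 : 0 <= B by apply: sumr_ge0.
have absq_cvg : (\sum_j `|q j h|) @[h --> 0^'] --> B.
  by apply: cvg_finite_sum => j; exact: (cvg_norm (q_cvg j)).
have line_cvg : (h *: v + y) @[h --> (0 : R)] --> y.
  exact: line_at0.
apply/cvgr0Pnorm_le => eps eps0.
have B1 : 0 < B + 1 by rewrite ltr_wpDl.
have small := Ck1_total_diff openW gC Wy (divr_gt0 eps0 B1).
have [del del0 small_ball] := (nbhs_ballP _ _).1 small.
have near_phi : nbhs y [set z | forall j, ball (phi y 0 j) del (phi z 0 j)].
  apply: (filter_finite_forall (nbhs_filter y)) => j.
  exact: phic j _ (nbhsx_ballx _ _ del0).
have near_B : \forall h \near (0 : R)^', \sum_j `|q j h| <= B + 1.
  by apply: (cvgr_le _ absq_cvg); rewrite ltrDl.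
near=> h; have Bh : \sum_j `|q j h| <= B + 1 by near: h.
have phi_h : `|g (phi (h *: v + y)) - g (phi y) - \sum_i (phi (h *: v + y) 0 i - phi y 0 i) *
    'D_(delta_mx 0 i) g (phi y)| <=
    eps / (B + 1) * \sum_i `|phi (h *: v + y) 0 i - phi y 0 i|.
  apply: small_ball; split=> // i j; rewrite (ord1 i); move: j.
  by near: h; apply: cvg_within; exact: line_cvg near_phi.
have -> : G h - S h = h^-1 * (g (phi (h *: v + y)) - g (phi y) -
    \sum_i (phi (h *: v + y) 0 i - phi y 0 i) * 'D_(delta_mx 0 i) g (phi y)).
  rewrite /G /S [RHS]mulrBr; congr (_ - _); rewrite mulr_sumr; apply: eq_bigr => j _.
  by rewrite mulrA.
rewrite normrM; apply: le_trans (ler_wpM2l (normr_ge0 _) phi_h) _.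
rewrite mulrCA mulr_sumr; under eq_bigr => j _ do rewrite -normrM.
rewrite -[leRHS]mulr1 -mulrA; apply: ler_wpM2l; first exact: ltW.
by rewrite ler_pdivrMl// mulr1.
Unshelve. all: by end_near. Qed.

(** By the chain rule applied to the coordinates of [psi] along [phi], since the difference
    quotients of the composite are those of the identity. *)
Lemma jacobian_inverse (U W : set 'rV[R]_d) (phi psi : 'rV[R]_d -> 'rV[R]_d) y :
  open U -> open W -> U y -> W (phi y) ->
  (forall j, Ck 1 U (fun z => phi z 0 j)) -> (forall j, Ck 1 W (fun z => psi z 0 j)) ->
  (\forall z \near y, psi (phi z) = z) ->
  jacobian_mx phi y *m jacobian_mx psi (phi y) = 1%:M.
Proof.
move=> openU openW Uy Wy phiC psiC psi_phi; apply/matrixP => i k; rewrite !mxE.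
under eq_bigr => j _ do rewrite !mxE.
have phid j : derivable (fun z => phi z 0 j) y (delta_mx 0 i).
  by have [_ fD] := phiC j; have [fd _] := fD i; apply: fd.
have phic j : {for y, continuous (fun z => phi z 0 j)} by have [fc _] := phiC j; apply: fc.
have lim1 := chain_along_line openW (psiC k) Wy phid phic.
suff lim2 : (fun h : R => h^-1 * (psi (phi (h *: delta_mx 0 i + y)) 0 k - psi (phi y) 0 k))
    @ 0^' --> ((i == k)%:R : R).
  exact: (cvg_unique _ lim1 lim2).
have line_cvg : (h *: delta_mx 0 i + y : 'rV[R]_d) @[h --> (0 : R)] --> y.
  exact: line_at0.
apply: (@cvg_trans _ ((fun=> (i == k)%:R : R) @ 0^')); last exact: cvg_cst.
apply: near_eq_cvg; near=> h.
have -> : psi (phi (h *: delta_mx 0 i + y)) = h *: delta_mx 0 i + y.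
  by near: h; apply: cvg_within; exact: line_cvg psi_phi.
rewrite (nbhs_singleton psi_phi) !mxE addrK eqxx /= [k == i]eq_sym mulrA mulVf ?mul1r//.
by near: h; exact: nbhs_dnbhs_neq.
Unshelve. all: by end_near. Qed.

End Differential.

(** * Smooth fields of operators *)

Section Charts.
Variables (R : realType) (d : nat) (M : manifold R d).
Implicit Types (m : M) (y : 'rV[R]_d).
Local Notation ch := (@mf_chart R d M).

Lemma coord_image_open (m : M) : open (coord_image m).
Proof. exact: ch_img_open. Qed.

Lemma ch_invK (c : chart R d M) p : ch_dom c p -> ch_inv c (c p) = p.
Proof. by move=> cp; apply: ch_mapK; rewrite inE. Qed.

Lemma chart_image_open (c : chart R d M) (A : set M) : open A ->
  open (c @` (ch_dom c `&` A)).
Proof.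
move=> openA; rewrite openE => _ [p [cp Ap] <-].
have img : (c @` ch_dom c) (c p) by exists p.
have := @ch_inv_cont _ _ _ c.
rewrite continuous_open_subspace; last exact: ch_img_open.
move=> /(_ (c p)); rewrite inE => /(_ img) invc.
have nA : nbhs (c p) (ch_inv c @^-1` A).
  by apply: invc; rewrite ch_invK//; apply: open_nbhs_nbhs.
have nI : nbhs (c p) (c @` ch_dom c) by apply: open_nbhs_nbhs; split=> //; apply: ch_img_open.
apply: filterS2 nA nI => z Az [q cq qz]; exists q => //; split=> //.
by move: Az; rewrite /= -qz ch_invK.
Qed.

Lemma to_frame_unit (m0 : M) y : coord_image m0 y -> to_frame m0 y \in unitmx.
Proof.
move=> [m c0m <-]; rewrite /to_frame ch_invK//.
set T := transition (ch m0) (ch m); set T' := transition (ch m) (ch m0).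
pose U := ch m0 @` (ch_dom (ch m0) `&` ch_dom (ch m)).
pose W := ch m @` (ch_dom (ch m) `&` ch_dom (ch m0)).
have cm := mf_chart_mem m.
have TE p : ch_dom (ch m0) p -> T (ch m0 p) = ch m p.
  by move=> p0; rewrite /T /transition ch_invK.
have openU : open U by apply: chart_image_open; apply: ch_dom_open.
have openW : open W by apply: chart_image_open; apply: ch_dom_open.
have Uy : U (ch m0 m) by exists m.
have Wy : W (T (ch m0 m)) by rewrite TE//; exists m.
have TC j : Ck 1 U (fun z => T z 0 j) by apply: mf_smooth.
have T'C j : Ck 1 W (fun z => T' z 0 j) by apply: mf_smooth.
have TT' : \forall z \near ch m0 m, T' (T z) = z.
  have : nbhs (ch m0 m) U by apply: open_nbhs_nbhs.
  by apply: filterS => _ [p [p0 pm] <-]; rewrite TE// /T' /transition ch_invK.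
by have [] := mulmx1_unit (jacobian_inverse openU openW Uy Wy TC T'C TT').
Qed.

End Charts.

Section SmoothVectors.
Variables (R : realType) (d : nat) (U : set 'rV[R]_d).
Hypothesis openU : open U.

Definition smoothC (c : 'rV[R]_d -> R[i]) : Prop :=
  smooth U (fun y => complex.Re (c y)) /\ smooth U (fun y => complex.Im (c y)).

Lemma smoothC_ext f g : (forall y, U y -> f y = g y) -> smoothC f -> smoothC g.
Proof.
by move=> fg [fr fi]; split; [apply: smooth_ext fr|apply: smooth_ext fi] => // y /fg->.
Qed.

Lemma smoothCD f g : smoothC f -> smoothC g -> smoothC (fun y => f y + g y).
Proof.
move=> [fr fi] [gr gi]; split.
  apply: smooth_ext (smoothD openU fr gr) => // y _.
  by case: (f y) (g y) => ? ? [].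
apply: smooth_ext (smoothD openU fi gi) => // y _.
by case: (f y) (g y) => ? ? [].
Qed.

Lemma smoothCM f g : smoothC f -> smoothC g -> smoothC (fun y => f y * g y).
Proof.
move=> [fr fi] [gr gi]; split.
  apply: smooth_ext (smoothD openU (smoothM openU fr gr)
    (smoothN openU (smoothM openU fi gi))) => // y _.
  by case: (f y) (g y) => ? ? [].
apply: smooth_ext (smoothD openU (smoothM openU fr gi) (smoothM openU fi gr)) => // y _.
by case: (f y) (g y) => ? ? [].
Qed.

Lemma smoothC_cst c : smoothC (fun=> c).
Proof. by split; apply: smooth_cst. Qed.

Section OneSpace.
Variables (W : lmodType R[i]).
Implicit Types f g : 'rV[R]_d -> W.

Lemma smooth_cvec_ext f g : (forall y, U y -> f y = g y) -> smooth_cvec U f -> smooth_cvec U g.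
Proof.
move=> fg sf l; apply: (@smoothC_ext (l \o f)); last exact: sf.
by move=> y Uy; rewrite /= fg.
Qed.

Lemma smooth_cvec0 : smooth_cvec U (fun=> 0 : W).
Proof.
move=> l; apply: (@smoothC_ext (fun=> 0)); last exact: smoothC_cst.
by move=> y _; rewrite linear0.
Qed.

Lemma smooth_cvecD f g : smooth_cvec U f -> smooth_cvec U g ->
  smooth_cvec U (fun y => f y + g y).
Proof.
move=> sf sg l; apply: (@smoothC_ext (fun y => l (f y) + l (g y))).
  by move=> y _; rewrite linearD.
by apply: smoothCD; [apply: sf|apply: sg].
Qed.

Lemma smooth_cvecZ c f : smoothC c -> smooth_cvec U f ->
  smooth_cvec U (fun y => c y *: f y).
Proof.
move=> sc sf l; apply: (@smoothC_ext (fun y => c y * l (f y))).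
  by move=> y _; rewrite linearZ.
by apply: smoothCM => //; apply: sf.
Qed.

Lemma smooth_cvec_sum (I : Type) (r : seq I) (P : pred I) (f : I -> 'rV[R]_d -> W) :
  (forall i, smooth_cvec U (f i)) -> smooth_cvec U (fun y => \sum_(i <- r | P i) f i y).
Proof.
move=> sf; elim: r => [|i r IH].
  by apply: smooth_cvec_ext smooth_cvec0 => y _; rewrite big_nil.
case Pi: (P i); last by apply: smooth_cvec_ext IH => y _; rewrite big_cons Pi.
by apply: smooth_cvec_ext (smooth_cvecD (sf i) IH) => y _; rewrite big_cons Pi.
Qed.

Lemma smooth_cvec_linear (W' : lmodType R[i]) (L : {linear W -> W'}) f :
  smooth_cvec U f -> smooth_cvec U (fun y => L (f y)).
Proof. by move=> sf l; apply: (sf (l \o L)). Qed.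

End OneSpace.

End SmoothVectors.

Section SmoothForms.
Variables (R : realType) (d : nat) (M : manifold R d) (A : lmodType R[i]).
Local Notation form := (ext d A).
Implicit Types x : M -> form.

Lemma smooth_form_linear (a : R[i]) x x' :
  smooth_form x -> smooth_form x' -> smooth_form (a *: x + x').
Proof.
move=> sx sx' m0 S.
apply: (smooth_cvec_ext (@coord_image_open _ _ M m0) (f := (fun y => a *: local_form x m0 y S +
  local_form x' m0 y S))).
  move=> y _; rewrite /local_form -[(a *: x + x') _]/(a *: x _ + x' _) ext_pull_linear.
  by rewrite !ffunE.
apply: (smooth_cvecD (@coord_image_open _ _ M m0)); last exact: sx'.
by apply: (smooth_cvecZ (@coord_image_open _ _ M m0)); [exact: (smoothC_cst (@coord_image_open
  _ _ M m0))|exact: sx].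
Qed.

Lemma smooth_form0 : smooth_form (0 : M -> form).
Proof.
move=> m0 S; apply: (smooth_cvec_ext (@coord_image_open _ _ M m0) (f := (fun=> 0))); last by
  apply: smooth_cvec0; apply: coord_image_open.
move=> y _; rewrite /local_form -[0 _]/(0 : form).
by rewrite -[ext_pull _ _]/(ext_pull_endo _ _ 0) linear0 ffunE.
Qed.

(** The components of a form at a point are taken in the chart chosen at that point, which
    varies without any regularity. Exterior products and contractions commute with the
    pullback to a fixed chart, where their coefficients are required to be smooth. *)
Lemma smooth_form_wedge (f : endo A) (c : M -> 'I_d -> R[i]) x :
  (forall m0 i, smoothC (coord_image m0)
     (fun y => \sum_j c (ch_inv (mf_chart m0) y) j * (to_frame m0 y i j)%:C)) ->
  smooth_form x -> smooth_form (fun m => lift_left f (form_wedge (c m) (x m))).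
Proof.
move=> sc sx m0 S.
pose cl y i := \sum_j c (ch_inv (mf_chart m0) y) j * (to_frame m0 y i j)%:C.
pose z i y : A := if i \in S then
  (-1) ^+ count_below i S *: f (local_form x m0 y (S :\ i)%SET) else 0.
apply: (smooth_cvec_ext (@coord_image_open _ _ M m0) (f := (fun y => \sum_i cl y i *: z i y))).
  move=> y _; rewrite /local_form -lift_left_pull -form_wedge_pull form_wedgeE.
  rewrite ffunE sum_ffunE linear_sum; apply: eq_bigr => i _.
  rewrite !ffunE linearZ /= /z; congr (_ *: _); case: ifP => _; last by rewrite linear0.
  by rewrite linearZ /local_form ffunE.
apply: (smooth_cvec_sum (@coord_image_open _ _ M m0)) => i.
apply: (smooth_cvecZ (@coord_image_open _ _ M m0)); first exact: sc.
rewrite /z; have [iS|iS] := boolP (i \in S); last exact: (@smooth_cvec0 _ _ _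
  (@coord_image_open _ _ M m0)).
apply: (smooth_cvecZ (@coord_image_open _ _ M m0)); first exact: (smoothC_cst
  (@coord_image_open _ _ M m0)).
by apply: smooth_cvec_linear; apply: sx.
Qed.

Lemma smooth_form_contr (f : endo A) (c : M -> 'I_d -> R[i]) x
  (u : M -> 'rV[R]_d -> 'I_d -> R[i]) :
  (forall m0 i, smoothC (coord_image m0) (fun y => u m0 y i)) ->
  (forall m0 y j, coord_image m0 y ->
     c (ch_inv (mf_chart m0) y) j = \sum_i u m0 y i * (to_frame m0 y i j)%:C) ->
  smooth_form x -> smooth_form (fun m => lift_left f (form_contr (c m) (x m))).
Proof.
move=> su cE sx m0 S.
pose z i y : A := if i \in S then 0 else
  (-1) ^+ count_below i S *: f (local_form x m0 y (i |: S)%SET).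
apply: (smooth_cvec_ext (@coord_image_open _ _ M m0) (f := (fun y => \sum_i u m0 y i *: z i y))).
  move=> y Uy; rewrite /local_form -lift_left_pull.
  have -> : c (ch_inv (mf_chart m0) y) = fun j => \sum_i u m0 y i * (to_frame m0 y i j)%:C.
    by apply/funext => j; apply: cE.
  rewrite -form_contr_pull form_contrE ffunE sum_ffunE linear_sum; apply: eq_bigr => i _.
  rewrite !ffunE linearZ /= /z; congr (_ *: _); case: ifP => _; first by rewrite linear0.
  by rewrite linearZ /local_form ffunE.
apply: (smooth_cvec_sum (@coord_image_open _ _ M m0)) => i.
apply: (smooth_cvecZ (@coord_image_open _ _ M m0)); first exact: su.
rewrite /z; have [iS|iS] := boolP (i \in S); first exact: (@smooth_cvec0 _ _ _
  (@coord_image_open _ _ M m0)).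
apply: (smooth_cvecZ (@coord_image_open _ _ M m0)); first exact: (smoothC_cst
  (@coord_image_open _ _ M m0)).
by apply: smooth_cvec_linear; apply: sx.
Qed.

End SmoothForms.

Section FrameSmoothness.
Variables (R : realType) (n : nat) (V : hermitian_space R n).
Variables (M : manifold R n.*2) (theta : vielbein M V).

Lemma VC_of_sum (I : finType) (a : I -> R) (h : I -> V) :
  (VC_of (\sum_i a i *: h i) : VC V) = \sum_i (a i)%:C *: VC_of (h i).
Proof.
by elim/big_rec2: _ => [|i x y _ <-]; [|rewrite -VC_of_linear].
Qed.

Lemma VC_of_frame m (r : 'rV[R]_(n.*2)) :
  (VC_of (theta m r) : VC V) = \sum_j (r 0 j)%:C *: vb_coef theta m j.
Proof.
rewrite [in LHS](row_sum_delta r) linear_sum; under eq_bigr => j _ do rewrite linearZ.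
exact: VC_of_sum.
Qed.

(** The image under the vielbein of the [i]-th coordinate vector field of the chart at
    [m0], at the point of coordinates [y]. *)
Definition frame_vec (m0 : M) (y : 'rV[R]_(n.*2)) (i : 'I_(n.*2)) : V :=
  theta (ch_inv (mf_chart m0) y) (row i (to_frame m0 y)).

Lemma covector_smooth (l : dualVC V) (m0 : M) i : smoothC (coord_image m0) (fun y =>
  \sum_j vb_covector theta (ch_inv (mf_chart m0) y) l j * (to_frame m0 y i j)%:C).
Proof.
have lfE y : coord_image m0 y -> l (VC_of (frame_vec m0 y i)) =
    \sum_j vb_covector theta (ch_inv (mf_chart m0) y) l j * (to_frame m0 y i j)%:C.
  move=> _; rewrite VC_of_frame linear_sum; apply: eq_bigr => j _.
  by rewrite linearZ mxE /vb_covector; apply: mulrC.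
apply: (smoothC_ext (@coord_image_open _ _ M m0) lfE).
have lE a (v w : V) : l (VC_of (a *: v + w)) = a%:C * l (VC_of v) + l (VC_of w).
  by rewrite VC_of_linear linearP.
pose fr (v : V) : R^o := complex.Re (l (VC_of v)).
pose fi (v : V) : R^o := complex.Im (l (VC_of v)).
have fr_lin : linear fr.
  move=> a v w; rewrite /fr lE; case: (l (VC_of v)) (l (VC_of w)) => b c [b' c'] /=.
  by rewrite mul0r subr0.
have fi_lin : linear fi.
  move=> a v w; rewrite /fi lE; case: (l (VC_of v)) (l (VC_of w)) => b c [b' c'] /=.
  by rewrite mul0r addr0.
pose frL : {linear V -> R^o} := HB.pack fr (GRing.isLinear.Build _ _ _ _ fr fr_lin).
pose fiL : {linear V -> R^o} := HB.pack fi (GRing.isLinear.Build _ _ _ _ fi fi_lin).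
by split; [exact: (vb_smooth theta m0 i frL)|exact: (vb_smooth theta m0 i fiL)].
Qed.

(** The components of a fixed vector in the moving frame are obtained with the inverse of
    the matrix of the frame, which is invertible because the vielbein and the changes
    of coordinates are. *)
Lemma vector_smooth_ex (w : VC V) : exists u : M -> 'rV[R]_(n.*2) -> 'I_(n.*2) -> R[i],
  (forall m0 i, smoothC (coord_image m0) (fun y => u m0 y i)) /\
  (forall m0 y j, coord_image m0 y ->
    vb_coord theta (ch_inv (mf_chart m0) y) w 0 j =
    \sum_i u m0 y i * (to_frame m0 y i j)%:C).
Proof.
(* a real basis indexed like the coordinates, so that the matrix [T] is square *)
pose X : (n.*2).-tuple V := tcast (hs_dim V) (vbasis {:V}).
have Xb : basis_of {:V} X.
  by rewrite /basis_of /X val_tcast; exact: vbasisP.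
pose T (m0 : M) y : 'M[R]_(n.*2) := \matrix_(i, k) coord X k (frame_vec m0 y i).
have T_smooth m0 i k : smooth (coord_image m0) (fun y => T m0 y i k).
  apply: (@smooth_ext _ _ _ (@coord_image_open _ _ M m0)
    (fun y => (coord X k : {linear V -> R^o}) (frame_vec m0 y i))).
    by move=> y _; rewrite mxE.
  exact: (vb_smooth theta m0 i (coord X k)).
have coordsum v (m0 : M) y (a : 'rV[R]_(n.*2)) :
    (\row_k coord X k v = a *m T m0 y) -> v = \sum_i a 0 i *: frame_vec m0 y i.
  move=> va; rewrite [LHS](coord_basis Xb (memvf v)) [RHS](coord_basis Xb (memvf _)).
  apply: eq_bigr => k _; congr (_ *: _).
  have := congr1 (fun r : 'rV_(n.*2) => r 0 k) va; rewrite !mxE => ->.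
  by rewrite linear_sum; apply: eq_bigr => i _; rewrite linearZ mxE.
have frame_sum (m0 : M) y (a : 'rV[R]_(n.*2)) : \sum_i a 0 i *: frame_vec m0 y i =
    theta (ch_inv (mf_chart m0) y) (a *m to_frame m0 y).
  by rewrite mulmx_sum_row linear_sum; apply: eq_bigr => i _; rewrite linearZ.
have T_unit m0 y : coord_image m0 y -> T m0 y \in unitmx.
  move=> Uy; rewrite unitmxE unitfE; apply/det0P => -[a a0 aT].
  have := @coordsum 0 m0 y a; rewrite aT frame_sum => H.
  have : theta (ch_inv (mf_chart m0) y) (a *m to_frame m0 y) = 0.
    by rewrite -H//; apply/rowP => k; rewrite !mxE linear0.
  rewrite -(linear0 (theta (ch_inv (mf_chart m0) y))) => /(bij_inj (vb_bij _ _)) aJ.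
  move: a0; rewrite -[a](mulmxK (to_frame_unit Uy)) aJ mul0mx eqxx//.
pose r (v : V) : 'rV[R]_(n.*2) := \row_k coord X k v.
pose u m0 y i := (r w.1 *m invmx (T m0 y)) 0 i +i* (r w.2 *m invmx (T m0 y)) 0 i.
have r_smooth v m0 i : smooth (coord_image m0) (fun y => (r v *m invmx (T m0 y)) 0 i).
  have E y : coord_image m0 y ->
      \sum_k r v 0 k * invmx (T m0 y) k i = (r v *m invmx (T m0 y)) 0 i by rewrite [RHS]mxE.
  apply: (smooth_ext (@coord_image_open _ _ M m0) E).
  apply: (smooth_sum (@coord_image_open _ _ M m0)) => k.
  apply: (smoothM (@coord_image_open _ _ M m0)).
    exact: (smooth_cst (@coord_image_open _ _ M m0)).
  by apply: (smooth_invmx (@coord_image_open _ _ M m0)) => // z; apply: T_unit.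
exists u; split=> [m0 i|m0 y j Uy]; first by split; apply: r_smooth.
have wE : w = \sum_i u m0 y i *: (VC_of (frame_vec m0 y i) : VC V).
  have part v : \sum_i (r v *m invmx (T m0 y)) 0 i *: frame_vec m0 y i = v.
    by apply/esym/(@coordsum v m0 y); rewrite mulmxKV// T_unit.
  have uE i : u m0 y i *: (VC_of (frame_vec m0 y i) : VC V) =
      ((r w.1 *m invmx (T m0 y)) 0 i)%:C *: VC_of (frame_vec m0 y i) +
      'i *: (((r w.2 *m invmx (T m0 y)) 0 i)%:C *: VC_of (frame_vec m0 y i)).
    rewrite scalerA -scalerDl; congr (_ *: _).
    by apply/eqP; rewrite eq_complex /=; apply/andP; split; apply/eqP; ring.
  under eq_bigr => i _ do rewrite uE.
  rewrite big_split -scaler_sumr -!VC_of_sum /= !part; case: (w) => w1 w2.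
  by congr pair; rewrite /= ?scale0r ?scale1r ?scaler0 ?subr0 ?addr0 ?add0r.
rewrite [in LHS]wE linear_sum summxE; apply: eq_bigr => i _.
rewrite linearZ mxE VC_of_frame linear_sum summxE (bigD1 j)//=.
rewrite linearZ mxE vb_coord_frame eqxx mulr1 big1 ?addr0 => [|k /negPf kj].
  by rewrite mxE.
by rewrite linearZ mxE vb_coord_frame eq_sym kj mulr0.
Qed.

End FrameSmoothness.

(** * The action on smooth forms *)

Section FieldsOfOperators.
Variables (K : fieldType) (T : Type) (W : lmodType K).
Implicit Types P Q : T -> endo W.

Definition field_op P (x : T -> W) : T -> W := fun m => P m (x m).

Lemma field_op_bracket P Q x :
  op_bracket (field_op P) (field_op Q) x = field_op (fun m => commutator (P m) (Q m)) x.
Proof. by []. Qed.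

Lemma iter_field_op_bracket P Q k :
  iter k (op_bracket (field_op P)) (field_op Q) =
  field_op (fun m => iter k (commutator (P m)) (Q m)).
Proof. by elim: k => // k IH; rewrite iterS IH. Qed.

Lemma field_op_linear P a x y : field_op P (a *: x + y) = a *: field_op P x + field_op P y.
Proof. by apply/funext => m; apply: linearP. Qed.

End FieldsOfOperators.

(** The operators [[E_i, F_i]] preserve smooth forms as soon as the [E_i] and the [F_i]
    do, and these are bilinears. *)
Section SmoothOperators.
Variables (R : realType) (n : nat) (V : hermitian_space R n).
Variables (Cl : clifford_algebra (@etaC R n V)).
Variables (Cl' : clifford_algebra (@etaC_inv R n V)).
Variables (M : manifold R n.*2) (theta : vielbein M V).
Variable e : bool -> 'I_n -> VC V.

Lemma bilin_smooth t t' b (x : M -> ext n.*2 Cl) : smooth_form x ->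
  smooth_form (field_op (fun m => bilin (cliff_op Cl e) (form_op Cl Cl' theta m e) t t' b) x).
Proof.
move=> sx; have smooth_sumf (r : seq 'I_n) (f : 'I_n -> M -> ext n.*2 Cl) :
    (forall i, smooth_form (f i)) -> smooth_form (\sum_(i <- r) f i).
  move=> sf; elim: r => [|i r IH]; first by rewrite big_nil; apply: smooth_form0.
  by rewrite big_cons -[f i]scale1r; apply: smooth_form_linear.
have -> : field_op (fun m => bilin (cliff_op Cl e) (form_op Cl Cl' theta m e) t t' b) x =
    \sum_i field_op (fun m => cliff_op Cl e t b i * form_op Cl Cl' theta m e t' b i) x.
  apply/funext => m; rewrite /field_op endo_sum.
  by rewrite (big_morph (fun f : M -> ext n.*2 Cl => f m) (id1 := 0) (op1 := +%R)).
apply: smooth_sumf => i; case: t'.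
  have -> : field_op (fun m => cliff_op Cl e t b i * form_op Cl Cl' theta m e true b i) x =
      fun m => lift_left (pol_fermion e Cl t b i)
        (form_wedge (vb_covector theta m (dual_frame e b i)) (x m)).
    by apply/funext => m; rewrite /field_op form_op_wedge.
  by apply: smooth_form_wedge sx => m0 j; apply: covector_smooth.
have -> : field_op (fun m => cliff_op Cl e t b i * form_op Cl Cl' theta m e false b i) x =
    fun m => lift_left (pol_fermion e Cl t b i)
      (form_contr (fun j => vb_coord theta m (e (~~ b) i) 0 j) (x m)).
  by apply/funext => m; rewrite /field_op form_op_contr.
have [u [su uE]] := vector_smooth_ex theta (e (~~ b) i).
exact: (smooth_form_contr _ su uE sx).
Qed.

End SmoothOperators.

Theorem proposition4 (R : realType) (n : nat) (V : hermitian_space R n)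
  (Cl : clifford_algebra (@etaC R n V))
  (Cl' : clifford_algebra (@etaC_inv R n V))
  (vol : Cl) (star : {linear Cl -> Cl})
  (vol_top : cl_degree n.*2 vol) (vol_sq : vol * vol = 1)
  (star_hodge : hodge_star vol star)
  (vol' : Cl') (star' : {linear Cl' -> Cl'})
  (vol'_top : cl_degree n.*2 vol') (vol'_sq : vol' * vol' = 1)
  (star'_hodge : hodge_star vol' star')
  (M : manifold R n.*2) (theta : vielbein M V) :
  kac_moody_action cartan_A31 (@smooth_form R n.*2 M Cl)
    (clifford_E star star' theta) (clifford_F star star' theta)
    (clifford_H theta).
Proof.
have [e pol] := polarization_ex V.
pose C := cliff_op Cl e; pose D m := form_op Cl Cl' theta m e.
have CC := cliff_op_anticomm Cl pol.
have DD m := form_op_anticomm Cl Cl' theta m pol.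
have CD m := cliff_form_op_comm Cl Cl' theta m e.
have EE i : clifford_E star star' theta i = field_op (fun m => chevalley_e C (D m) i).
  apply/funext => x; apply/funext => m.
  exact: (opE_chevalley vol_top vol_sq star_hodge vol'_top vol'_sq star'_hodge).
have FF i : clifford_F star star' theta i = field_op (fun m => chevalley_f C (D m) i).
  apply/funext => x; apply/funext => m.
  exact: (opF_chevalley vol_top vol_sq star_hodge vol'_top vol'_sq star'_hodge).
have HH i : clifford_H theta i = field_op (fun m => chevalley_h C (D m) i).
  by apply/funext => x; apply/funext => m; apply: opH_chevalley.
have Es i x : smooth_form x -> smooth_form (field_op (fun m => chevalley_e C (D m) i) x).
  by rewrite /chevalley_e; case: (chevalley_flags i) => [[t t'] b]; apply: bilin_smooth.
have Fs i x : smooth_form x -> smooth_form (field_op (fun m => chevalley_f C (D m) i) x).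
  by rewrite /chevalley_f; case: (chevalley_flags i) => [[t t'] b]; apply: bilin_smooth.
have eq0 (P : M -> endo (ext n.*2 Cl)) x : (forall m, P m = 0) -> field_op P x = 0.
  by move=> P0; apply/funext => m; rewrite /field_op P0.
have scale (P Q : M -> endo (ext n.*2 Cl)) (k : int) x :
    (forall m, P m = Q m *~ k) -> field_op P x = k%:~R *: field_op Q x.
  by move=> PQ; apply/funext => m; rewrite /field_op PQ endo_mulrz -scaler_int.
split.
- by split; [exact: smooth_form0|move=> a x y; apply: smooth_form_linear].
- move=> i; rewrite EE FF HH; split; split=> [x sx|a x y _ _]; try exact: field_op_linear.
  + exact: Es.
  + exact: Fs.
  + have -> : field_op (fun m => chevalley_h C (D m) i) x =
      -1 *: field_op (fun m => chevalley_f C (D m) i) (field_op (fun m => chevalley_e C (D m) i) x)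
      + field_op (fun m => chevalley_e C (D m) i) (field_op (fun m => chevalley_f C (D m) i) x).
      by apply/funext => m; rewrite scaleN1r addrC.
    by apply: smooth_form_linear; [apply/Fs/Es|apply/Es/Fs].
- move=> i j x _; rewrite !HH !EE !FF !field_op_bracket; split.
  + by apply: eq0 => m; apply: (chevalley_hh CC (DD m) (CD m)).
  + by apply: scale => m; apply: (chevalley_he CC (DD m) (CD m)).
  + rewrite -scaleNr -mulrNz; apply: scale => m.
    by rewrite mulrNz; apply: (chevalley_hf CC (DD m) (CD m)).
  + case: eqP => [->|/eqP ij]; first by [].
    by apply: eq0 => m; rewrite (chevalley_ef CC (DD m) (CD m)) (negPf ij).
- move=> i j x ij _; rewrite !EE !FF !iter_field_op_bracket.
  by split; apply: eq0 => m; have [] := chevalley_serre CC (DD m) (CD m) ij.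
Qed.
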